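(* For every real $A>0$ there is a constant $\delta_0(A)>0$, depending only on $A$, such that for every prime $q\ge 3$ there is a constant $c(q,A)$, depending only on $q$ and $A$, with the following property. For every positive integer $\gamma$ and every real $X\ge 2$ with $X\le q^{A\gamma}$, $$ \max_{\gcd(a,q)=1}\left|\sum_{\substack{p\le X\\ p\ \text{prime}}}\mathbf{e}_{q^\gamma}(aM_p)\right| \le c(q,A)\left(X^{1-\delta_0(A)\rho^2}+Xq^{-\delta_0(A)\gamma}\right), \qquad\text{where}\quad \rho=\frac{\log X}{\log q^\gamma}, $$ and the maximum is over all integers $a$ coprime to $q$.
   Context: For a positive integer $m$ and $t\in\mathbb{R}$, $\mathbf{e}_m(t)=\exp(2\pi i t/m)$. $M_p=2^p-1$ denotes the Mersenne number attached to the prime $p$. *)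

(* Defs.v *)
From mathcomp Require Import all_boot all_order all_algebra.
From mathcomp Require Import all_classical all_reals all_analysis.
From mathcomp Require Import complex.

Set Implicit Arguments.
Unset Strict Implicit.
Unset Printing Implicit Defensive.

Import Order.TTheory GRing.Theory Num.Theory.
Local Open Scope ring_scope.
Local Open Scope complex_scope.

(* e_m(t) = exp(2 pi i t / m), written through its real and imaginary parts
   since the library has no exponential on R[i]. *)
Definition em (R : realType) (m : nat) (t : R) : R[i] :=
  cos (2 * pi * t / m%:R) +i* sin (2 * pi * t / m%:R).

Definition mersenne (p : nat) : nat := (2 ^ p - 1)%N.

(* The sum over primes p <= X; for X >= 0, p%:R <= X iff p <= Num.truncn X. *)
Definition mersenne_sum (R : realType) (m : nat) (a : int) (X : R) : R[i] :=
  \sum_(0 <= p < (Num.truncn X).+1 | prime p) em m (a%:~R * (mersenne p)%:R).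

(* Main.v *)
(* Vinogradov's method in the q-adic metric.  Let e be the q-adic valuation of
   2 ^ (q - 1) - 1.  For r > e one has 2 ^ ((q - 1) q ^ (r - e)) = 1 + q ^ r u
   with q not dividing u, so under the shift m -> m + k! (q - 1) q ^ (r - e) y z
   the phase a 2 ^ (m n) / q ^ gamma becomes, by the binomial theorem, a
   polynomial in y z of degree k ~ gamma / r whose coefficients have controlled
   q-adic valuations.  Hoelder's inequality bounds the resulting bilinear sums
   by Vinogradov's mean value; for variables in [0, q ^ b) the latter is bounded
   by iterating on b, because a system of power sum congruences in variables
   that are distinct modulo q ^ k is rigid (Newton's identities).  Sums over
   intervals, also of the differences a 2 ^ (m n) - a 2 ^ (m n'), thus save a
   factor q ^ (c r / k ^ 2) ~ q ^ (c r ^ 3 / gamma ^ 2), and Vaughan's identity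
   carries this over to primes, at the cost of a power of log X.
   Taking r ~ min (log_q X, gamma) gives the first term of the bound when
   X <= q ^ gamma and the second one for larger X.
   The power of log X is harmless: either it is at most a small power of the
   saving, or Chebyshev's bound X / log X for the number of primes suffices. *)

Require Import Defs.
From mathcomp Require Import all_boot all_order all_algebra.
From mathcomp Require Import all_classical all_reals all_analysis.
From mathcomp Require Import complex.
From mathcomp Require Import zify ring lra.

Set Implicit Arguments.
Unset Strict Implicit.
Unset Printing Implicit Defensive.

Import Order.TTheory GRing.Theory Num.Theory.
Local Open Scope ring_scope.
Local Open Scope complex_scope.

(** The quantity that governs everything is r^3 / gamma^2. The obstacle is the factorial: the shift
    is a multiple of k! so that binomial coefficients become integer polynomials, and the powers of
    q hidden in these factorials, with exponent up to k^2, must stay well below r. This forces 4 k^2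
    <= r, that is, r^3 at least a constant times gamma^2. Outside this range the claimed saving is
    at most a power of q with bounded exponent, so the trivial bound suffices and its cost goes into
    the constant; the valuation of 2^(q-1) - 1 is disposed of in the same way.

    Single phases and differences of two phases are treated together, with pairs (a, n) and (a',
    n'); a' = 0 gives the single ones. A difference may have degenerate coefficients, but never at
    two consecutive degrees unless n and n' are congruent modulo a small power of q, so one of any
    two neighbouring degrees is always usable.

    Since k grows with gamma, the mean value theorem is needed with its dependence on k explicit.
    With 11 k^2 variables its excess exponent k^2 / 1024 is small against the gain k^2 / 64 coming
    from the degrees near k / 2. *)

Local Arguments conjc : simpl never.

(** * Absolute values and additive characters *)

Section Cabs.
Variable R : realType.
Implicit Types z w : R[i].

Definition cabs z : R := complex.Re `|z|.

Lemma cabsE z : `|z| = (cabs z)%:C.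
Proof. by rewrite /cabs normc_def. Qed.

Lemma cabs_ge0 z : 0 <= cabs z.
Proof. by rewrite -lecR -cabsE normr_ge0. Qed.

Lemma cabs_le z (x : R) : `|z| <= x%:C <-> cabs z <= x.
Proof. by rewrite cabsE lecR. Qed.

Lemma cabs0 : cabs 0 = 0.
Proof. by rewrite /cabs normr0. Qed.

Lemma cabs1 : cabs 1 = 1.
Proof. by rewrite /cabs normr1. Qed.

Lemma cabsM z w : cabs (z * w) = cabs z * cabs w.
Proof. by apply: (@complexI R); rewrite rmorphM /= -!cabsE normrM. Qed.

Lemma cabsN z : cabs (- z) = cabs z.
Proof. by rewrite /cabs normrN. Qed.

Lemma cabsX z n : cabs (z ^+ n) = cabs z ^+ n.
Proof. by elim: n => [|n IH]; rewrite ?expr0 ?cabs1 // !exprS cabsM IH. Qed.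

Lemma cabsD z w : cabs (z + w) <= cabs z + cabs w.
Proof. by rewrite -lecR rmorphD /= -!cabsE ler_normD. Qed.

Lemma cabsB z w : cabs (z - w) <= cabs z + cabs w.
Proof. by rewrite -(cabsN w) cabsD. Qed.

Lemma cabs_conj z : cabs z^*%C = cabs z.
Proof. by rewrite /cabs normcJ. Qed.

Lemma cabs_nat n : cabs n%:R = n%:R.
Proof. by rewrite /cabs normr_nat -(rmorph_nat (@real_complex R)). Qed.

Lemma cabs_real (x : R) : 0 <= x -> cabs x%:C = x.
Proof. by move=> x0; apply: (@complexI R); rewrite -cabsE ger0_norm // lecR. Qed.

Lemma cabs_sum (I : Type) (r : seq I) (P : pred I) (F : I -> R[i]) :
  cabs (\sum_(i <- r | P i) F i) <= \sum_(i <- r | P i) cabs (F i).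
Proof.
elim/big_rec2: _ => [|i x z _ H]; first by rewrite cabs0.
by apply: le_trans (cabsD _ _) _; rewrite lerD2l.
Qed.

Lemma cabs_prod (I : Type) (r : seq I) (P : pred I) (F : I -> R[i]) :
  cabs (\prod_(i <- r | P i) F i) = \prod_(i <- r | P i) cabs (F i).
Proof. exact: (big_morph _ cabsM cabs1). Qed.

Lemma sqr_cabs z : (cabs z ^+ 2)%:C = z * z^*%C.
Proof. by rewrite rmorphXn /= -cabsE sqr_normc. Qed.

End Cabs.

(** * Convexity and Cauchy-Schwarz inequalities *)

Section PowerMean.
Variable R : realType.

(** Convexity: the graph of [t ^+ m.+1] lies above its tangent at [u]. The form avoids subtraction
    and division. *)
Lemma tangent_pow (t u : R) m : 0 <= t -> 0 <= u ->
  m.+1%:R * u ^+ m * t <= t ^+ m.+1 + m%:R * u ^+ m.+1.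
Proof.
move=> t0 u0; elim: m => [|m IH]; first by rewrite expr1 expr0 mul0r; lra.
have := ler_wpM2l t0 IH; have : 0 <= (m.+1%:R * u ^+ m) * (t - u) ^+ 2.
  by rewrite mulr_ge0 ?sqr_ge0 // mulr_ge0 ?exprn_ge0.
rewrite !exprS -!natr1; set a := t ^+ m; set b := u ^+ m; set c := m%:R.
by nra.
Qed.

Lemma power_mean (I : finType) (A : pred I) (x : I -> R) m :
  (forall i, A i -> 0 <= x i) ->
  (\sum_(i | A i) x i) ^+ m.+1 <= #|A|%:R ^+ m * \sum_(i | A i) x i ^+ m.+1.
Proof.
move=> x0; set S := \sum_(i | A i) x i; set n : R := #|A|%:R.
have S0 : 0 <= S by apply: sumr_ge0.
have n0 : 0 <= n by rewrite ler0n.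
(* The tangent is taken at the mean; everything is multiplied by [n], so the point of contact is [S]
   itself and the empty case needs no division. *)
have H : \sum_(i | A i) (m.+1%:R * S ^+ m * (n * x i)) <=
         \sum_(i | A i) ((n * x i) ^+ m.+1 + m%:R * S ^+ m.+1).
  apply: ler_sum => i Ai; apply: tangent_pow => //.
  by rewrite mulr_ge0 // x0.
move: H; rewrite -mulr_sumr -mulr_sumr -/S big_split /= sumr_const -mulr_natr -/n.
rewrite (eq_bigr (fun i => n ^+ m.+1 * x i ^+ m.+1)); last by move=> i _; rewrite exprMn.
rewrite -mulr_sumr -natr1 => H.
have [n00|nn] := eqVneq n 0.
  have A0 : #|A| = 0%N by apply/eqP; rewrite -(eqr_nat R); apply/eqP.
  have SA : S = 0 by apply: big1 => i Ai; have := card0_eq A0 i; rewrite unfold_in Ai.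
  by rewrite SA expr0n /= mulr_ge0 ?exprn_ge0 // sumr_ge0 // => i Ai; rewrite exprn_ge0 ?x0.
have np : 0 < n by rewrite lt_def nn.
rewrite -(ler_pM2l np) mulrA -exprS; move: H; rewrite ![S ^+ m.+1]exprS.
set T := \sum_(i | _) _; set u := n ^+ m.+1 * T; set v := S ^+ m; set c := m%:R.
rewrite mul1r -[X in _ <= _ + X]mulr_natr -/n. have -> : (c + 1) * v * (n * S) = n * (S * v) + c * (S * v) * n by ring.
by rewrite lerD2r.
Qed.

(** Lagrange's identity: the defect is half the sum of the squares of all two by two minors. *)
Lemma cauchy_sum (I : finType) (A : pred I) (x y : I -> R) :
  (\sum_(i | A i) x i * y i) ^+ 2 <=
  (\sum_(i | A i) x i ^+ 2) * (\sum_(i | A i) y i ^+ 2).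
Proof.
have H : 0 <= \sum_(i | A i) \sum_(j | A j) (x i * y j - x j * y i) ^+ 2.
  by apply: sumr_ge0 => i _; apply: sumr_ge0 => j _; apply: sqr_ge0.
have E : \sum_(i | A i) \sum_(j | A j) (x i * y j - x j * y i) ^+ 2 =
   ((\sum_(i | A i) x i ^+ 2) * (\sum_(i | A i) y i ^+ 2) -
    (\sum_(i | A i) x i * y i) ^+ 2) *+ 2.
  rewrite mulr2n expr2 !big_distrlr /=.
  rewrite [X in _ = _ + (X - _)]exchange_big /= -!sumrB -big_split /=.
  apply: eq_bigr => i _; rewrite -!sumrB -big_split /=.
  by apply: eq_bigr => j _; ring.
by move: H; rewrite E pmulrn_lge0 // subr_ge0.
Qed.

End PowerMean.
Section Psi.
Variable R : realType.

Lemma emD m (t u : R) : em m (t + u) = em m t * em m u.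
Proof.
rewrite /em mulrDr mulrDl cosD sinD; apply/eqP; rewrite eq_complex /= eqxx /=.
by rewrite addrC.
Qed.

Definition psi (Q : nat) (x : int) : R[i] := em Q (x%:~R).

Arguments psi : simpl never.

Lemma psiD Q x y : psi Q (x + y) = psi Q x * psi Q y.
Proof. by rewrite /psi rmorphD emD. Qed.

Lemma psi0 Q : psi Q 0 = 1.
Proof. by rewrite /psi /em mulr0 mul0r cos0 sin0. Qed.

Lemma cabs_psi Q x : cabs (psi Q x) = 1.
Proof. by rewrite /cabs normc_def /= cos2Dsin2 sqrtr1. Qed.

Lemma psiN Q x : psi Q (- x) = (psi Q x)^*%C.
Proof. by rewrite /psi /em rmorphN mulrN mulNr cosN sinN. Qed.

Lemma psi_sum Q (I : Type) (r : seq I) (P : pred I) (F : I -> int) :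
  psi Q (\sum_(i <- r | P i) F i) = \prod_(i <- r | P i) psi Q (F i).
Proof. exact: (big_morph _ (psiD Q) (psi0 Q)). Qed.

Lemma psiMn Q x n : psi Q (x * n%:Z) = psi Q x ^+ n.
Proof.
elim: n => [|n IH]; first by rewrite mulr0 psi0.
by rewrite exprS -IH -psiD; congr psi; rewrite intS mulrDr mulr1.
Qed.

Lemma psi_Q Q : (0 < Q)%N -> psi Q Q%:Z = 1.
Proof.
move=> Q0; rewrite /psi /em; have -> : 2 * pi * (Q%:Z)%:~R / Q%:R = pi *+ 2 :> R.
  by rewrite -mulrA divff ?pnatr_eq0 -?lt0n // mulr1 mulr_natl.
by rewrite cos2pi sin2pi.
Qed.

Lemma psi_dvd Q x : (0 < Q)%N -> (Q%:Z %| x)%Z -> psi Q x = 1.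
Proof.
move=> Q0 /dvdzP [y ->]; rewrite mulrC; case: y => n.
  by rewrite psiMn psi_Q // expr1n.
by rewrite NegzE mulrN psiN psiMn psi_Q // expr1n conjc1.
Qed.

Lemma psi_eq Q x y : (0 < Q)%N -> (Q%:Z %| x - y)%Z -> psi Q x = psi Q y.
Proof. by move=> Q0 H; rewrite -[x](subrK y) psiD psi_dvd // mul1r. Qed.

Lemma psi_neq1 Q x : (0 < Q)%N -> ~~ (Q%:Z %| x)%Z -> psi Q x != 1.
Proof.
move=> Q0 H; have Q0z : Q%:Z != 0 by lia.
have := divz_eq x Q%:Z; set u := (_ %/ _)%Z; set v := (_ %% _)%Z => E.
have v0 : v != 0 by apply: contra H => /eqP v0; rewrite /dvdz_mod0P; apply/dvdz_mod0P.
have vge : 0 <= v by exact: modz_ge0.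
have vlt : v < Q%:Z by rewrite ltz_pmod //; lia.
have -> : psi Q x = psi Q v.
  by apply: psi_eq => //; rewrite E addrK dvdz_mull.
(* Half the angle lies strictly between 0 and pi, where the sine is positive, so the real part 1 - 2
   sin^2 is below 1. *)
set th : R := pi * v%:~R / Q%:R.
have Qp : 0 < Q%:R :> R by rewrite ltr0n.
have hth : 0 < th < pi.
  have pp := pi_gt0 R.
  have v1 : 0 < v%:~R :> R by rewrite ltr0z; lia.
  have v2 : v%:~R < Q%:R :> R by rewrite -[Q%:R]/((Q%:Z)%:~R) ltr_int.
  rewrite /th divr_gt0 ?mulr_gt0 //= ltr_pdivrMr // ltr_pM2l //.
have E2 : 2 * pi * v%:~R / Q%:R = th *+ 2 by rewrite /th mulr2n; ring.
rewrite /psi /em E2 eq_complex /= negb_and; apply/orP; left.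
have := sin_gt0_pi hth => s0.
rewrite cos_mulr2n cos2sin2 -mulr_natr; apply/negP => /eqP.
have : 0 < sin th ^+ 2 by rewrite exprn_gt0.
by lra.
Qed.

Lemma psi_orth Q x : (0 < Q)%N ->
  \sum_(a < Q) psi Q (a%:Z * x) = if (Q%:Z %| x)%Z then Q%:R else 0.
Proof.
move=> Q0; have E : forall a : 'I_Q, psi Q (a%:Z * x) = psi Q x ^+ a.
  by move=> a; rewrite mulrC psiMn.
rewrite (eq_bigr _ (fun a _ => E a)); case: ifP => H.
  rewrite (eq_bigr (fun=> 1)); last by move=> i _; rewrite psi_dvd // expr1n.
  by rewrite sumr_const card_ord.
have := psi_neq1 Q0 (negbT H); rewrite -subr_eq0 => /mulfI; apply.
by rewrite mulr0 -subrX1 -psiMn mulrC psi_dvd ?subrr // dvdz_mulr.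
Qed.

Variables (k Q : nat).
Hypothesis Q0 : (0 < Q)%N.

Definition dotf (al : {ffun 'I_k -> 'I_Q}) (v : 'I_k -> int) : int :=
  \sum_j (al j)%:Z * v j.

Lemma psi_orthf (v : 'I_k -> int) :
  \sum_(al : {ffun 'I_k -> 'I_Q}) psi Q (dotf al v) =
  if [forall j, (Q%:Z %| v j)%Z] then Q%:R ^+ k else 0.
Proof.
rewrite (eq_bigr (fun al : {ffun 'I_k -> 'I_Q} => \prod_j psi Q ((al j)%:Z * v j))).
  rewrite -(bigA_distr_bigA (fun (j : 'I_k) (a : 'I_Q) => psi Q (a%:Z * v j))).
  rewrite (eq_bigr _ (fun j _ => psi_orth (v j) Q0)).
  case: ifP => [/forallP H|/negbT].
    rewrite (eq_bigr (fun=> Q%:R)); last by move=> j _; rewrite H.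
    by rewrite prodr_const card_ord.
  rewrite negb_forall => /existsP [j H].
  by rewrite (bigD1 j) //= (negbTE H) mul0r.
by move=> al _; rewrite /dotf psi_sum.
Qed.

(** Orthogonality turns a second moment over all frequencies into a count of congruences.
    Frequencies modulo [Q] replace the integral over a torus, so all sums stay finite. *)
Lemma energy_fourier (I : finType) (A : pred I) (v : I -> 'I_k -> int) :
  \sum_(al : {ffun 'I_k -> 'I_Q}) cabs (\sum_(i | A i) psi Q (dotf al (v i))) ^+ 2
  = Q%:R ^+ k * #|[set p : I * I | [&& A p.1, A p.2 & [forall j, (Q%:Z %| v p.1 j - v p.2 j)%Z]]]|%:R.
Proof.
apply: (@complexI R); rewrite rmorph_sum /=.
rewrite (eq_bigr (fun al => \sum_(p : I * I | A p.1 && A p.2)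
   psi Q (dotf al (fun j => v p.1 j - v p.2 j)))); last first.
  move=> al _; rewrite sqr_cabs rmorph_sum big_distrlr /= pair_big /=.
  apply: eq_bigr => -[i i'] _ /=; rewrite -psiN -psiD; congr psi.
  by rewrite /dotf -sumrB; apply: eq_bigr => j _; rewrite mulrBr.
rewrite exchange_big /= (eq_bigr _ (fun p _ => psi_orthf _)).
rewrite -big_mkcondr /= sumr_const rmorphM rmorphXn /= !rmorph_nat mulr_natr.
congr (_ *+ _); apply: eq_card => p; rewrite !inE unfold_in /= andbA //.
Qed.

End Psi.

Arguments psi : simpl never.
Arguments cabs : simpl never.

Lemma dvdn_fact_fact j k : (j <= k)%N -> (j`! %| k`!)%N.
Proof. by move=> jk; rewrite -(bin_fact jk) mulnCA dvdn_mulr. Qed.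

(** * Systems of power sum congruences *)

Section Newton.
Implicit Types (xs ys : seq int).

(** The coefficients are the signed elementary symmetric functions. In this reversed form the
    coefficient of degree j carries the symmetric function of degree j, whatever the number of
    factors. *)
Definition recpoly xs : {poly int} := \prod_(x <- xs) (1 - x *: 'X).

Definition psum xs (j : nat) : int := \sum_(x <- xs) x ^+ j.

Lemma recpoly_cons x xs : recpoly (x :: xs) = (1 - x *: 'X) * recpoly xs.
Proof. by rewrite /recpoly big_cons. Qed.

Lemma coef_recpoly_cons x xs j :
  (recpoly (x :: xs))`_j.+1 = (recpoly xs)`_j.+1 - x * (recpoly xs)`_j.
Proof. by rewrite recpoly_cons mulrBl mul1r coefB -scalerAl coefZ coefXM. Qed.

Lemma coef0_recpoly xs : (recpoly xs)`_0 = 1.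
Proof.
elim: xs => [|x xs IH]; first by rewrite /recpoly big_nil coef1.
by rewrite recpoly_cons mulrBl mul1r coefB -scalerAl coefZ coefXM mulr0 subr0.
Qed.

Lemma coef_recpoly_gt xs j : (size xs < j)%N -> (recpoly xs)`_j = 0.
Proof.
elim: xs j => [|x xs IH] [|j] //= H; first by rewrite /recpoly big_nil coef1.
by rewrite coef_recpoly_cons !IH ?mulr0 ?subr0 // ltnW.
Qed.

Lemma horner_recpoly xs (y : int) :
  \prod_(x <- xs) (y - x) = \sum_(j < (size xs).+1) (recpoly xs)`_j * y ^+ (size xs - j).
Proof.
elim: xs => [|x xs IH]; first by rewrite big_nil big_ord1 coef0_recpoly.
rewrite big_cons IH /= [RHS]big_ord_recl coef0_recpoly mul1r subn0.
under [X in _ = _ + X]eq_bigr => j _ do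
  rewrite lift0 coef_recpoly_cons subSS mulrBl.
rewrite sumrB [X in _ = _ + (X - _)]big_ord_recr /= coef_recpoly_gt // mul0r addr0.
rewrite mulrBl addrA; congr (_ - _).
  rewrite big_ord_recl coef0_recpoly mul1r subn0 mulrDr exprS; congr (_ + _).
  rewrite mulr_sumr; apply: eq_bigr => j _.
  rewrite lift0 mulrCA -exprS -subSn ?ltn_ord // subSS //.
by rewrite mulr_sumr; apply: eq_bigr => j _; rewrite mulrA.
Qed.

(** The logarithmic derivative of the product generates the power sums, here truncated at order [k]
    and with the denominator cleared. *)
Lemma newton_series xs k :
  exists g, 'X * (recpoly xs)^`() +
     recpoly xs * (\sum_(m < k) psum xs m.+1 *: 'X^(m.+1)) = 'X^(k.+1) * g.
Proof.
elim: xs => [|x xs [g Hg]].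
  exists 0; rewrite /recpoly big_nil derivC mulr0 add0r mul1r mulr0.
  by apply: big1 => m _; rewrite /psum big_nil scale0r.
have H1 : 'X * (1 - x *: 'X)^`() +
     (1 - x *: 'X) * (\sum_(m < k) x ^+ m.+1 *: 'X^(m.+1)) = 'X^(k.+1) * (- x ^+ k.+1)%:P.
  elim: k {g Hg} => [|k IH].
    rewrite big_ord0 mulr0 addr0 derivB derivC derivZ derivX sub0r !expr1.
    by rewrite -mul_polyC mulr1 polyCN.
  rewrite big_ord_recr /= mulrDr addrA IH -!mul_polyC !polyCN !exprS.
  by rewrite !polyCM; ring.
exists ((- x ^+ k.+1)%:P * recpoly xs + (1 - x *: 'X) * g).
rewrite recpoly_cons derivM.
have -> : \sum_(m < k) psum (x :: xs) m.+1 *: 'X^(m.+1) =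
  \sum_(m < k) x ^+ m.+1 *: 'X^(m.+1) + \sum_(m < k) psum xs m.+1 *: 'X^(m.+1).
  by rewrite -big_split /=; apply: eq_bigr => m _; rewrite /psum big_cons scalerDl.
rewrite [RHS]mulrDr [X in _ = X + _]mulrA -H1 [X in _ = _ + X]mulrCA -Hg; ring.
Qed.

Lemma newton_coef xs k j : (j < k)%N ->
  (recpoly xs)`_j.+1 *+ j.+1 =
  - \sum_(m < j.+1) psum xs m.+1 * (recpoly xs)`_(j - m).
Proof.
move=> jk; have [g Hg] := newton_series xs k.
have := congr1 (fun p : {poly int} => p`_j.+1) Hg.
rewrite coefD coefXM /= coef_deriv coefXnM ltnS jk [recpoly xs * _]mulrC coefM big_ord_recl /=.
have c m : (\sum_(m < k) psum xs m.+1 *: 'X^(m.+1))`_m =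
    if (0 < m <= k)%N then psum xs m else 0.
  rewrite coef_sum; case: m => [|m] /=.
    by apply: big1 => i _; rewrite coefZ coefXn mulr0.
  case: ltnP => mk.
    rewrite (bigD1 (Ordinal mk)) //= coefZ coefXn eqxx mulr1 big1 ?addr0 // => i ni.
    rewrite coefZ coefXn eqSS; case: eqP => [e|]; rewrite ?mulr0 //.
    by case/negP: ni; apply/eqP/val_inj.
  apply: big1 => i _; rewrite coefZ coefXn eqSS gtn_eqF ?mulr0 //.
  exact: leq_trans (ltn_ord i) mk.
rewrite c mul0r add0r => /eqP; rewrite addr_eq0 => /eqP ->; congr (- _).
apply: eq_bigr => m _; rewrite /bump leq0n add1n subSS c /=.
by rewrite (leq_trans (ltn_ord m) jk).
Qed.

(** Newton's identity gives j times the j-th coefficient in terms of the earlier ones, so each step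
    of the induction costs a factor j, in total j!. *)
Lemma recpoly_cong (M : int) xs ys k :
  (forall j, (0 < j <= k)%N -> (M %| psum xs j - psum ys j)%Z) ->
  forall j, (j <= k)%N -> (M %| j`!%:Z * ((recpoly xs)`_j - (recpoly ys)`_j))%Z.
Proof.
move=> H j; elim/ltn_ind: j => -[|j] IH jk.
  by rewrite !coef0_recpoly subrr mulr0 dvdz0.
have -> : (j.+1)`!%:Z * ((recpoly xs)`_j.+1 - (recpoly ys)`_j.+1) =
  ((recpoly xs)`_j.+1 *+ j.+1 - (recpoly ys)`_j.+1 *+ j.+1) * j`!%:Z.
  by rewrite factS PoszM -mulrnBl -[in RHS]mulr_natr natz; move: (j`!) => f; ring.
rewrite !(newton_coef _ jk) opprK.
rewrite addrC -sumrB big_distrl /=; apply: rpred_sum => m _.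
set a := psum ys _; set a' := psum xs _.
set e := (recpoly ys)`__; set e' := (recpoly xs)`__.
have -> : (a * e - a' * e') * j`! = - ((a' - a) * e * j`!%:Z) - (a' * (j`!%:Z * (e' - e))).
  by move: (j`!) => f; ring.
have jm : (j - m <= j)%N by exact: leq_subr.
apply: rpredB.
  rewrite rpredN -mulrA dvdz_mulr // H // (leq_trans (ltn_ord m)) //.
rewrite dvdz_mull //.
have : ((j - m)`! %| j`!)%N by apply: dvdn_fact_fact.
case/dvdnP => c ->; rewrite PoszM -mulrA dvdz_mull //.
by apply: IH; rewrite ?ltnS // (leq_trans jm) // ltnW.
Qed.

(** The product over [ys] vanishes at [y]. Subtracting it from the product over [xs] leaves only
    differences of coefficients, to which [recpoly_cong] applies. *)
Lemma prod_diff_dvd (M : int) xs ys k :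
  size xs = k -> size ys = k ->
  (forall j, (0 < j <= k)%N -> (M %| psum xs j - psum ys j)%Z) ->
  forall y, y \in ys -> (M %| k`!%:Z * \prod_(x <- xs) (y - x))%Z.
Proof.
move=> sx sy H y yin.
have : \prod_(x <- ys) (y - x) = 0.
  by apply/eqP; rewrite prodf_seq_eq0; apply/hasP; exists y => //=; rewrite subrr.
rewrite !horner_recpoly sx sy => E.
rewrite -[\sum_(_ < _) _]subr0 -[X in _ - X]E -sumrB mulr_sumr; apply: rpred_sum => j _.
rewrite -mulrBl mulrA dvdz_mulr //.
have jk : (j <= k)%N by rewrite -ltnS ltn_ord.
have : (j`! %| k`!)%N by apply: dvdn_fact_fact.
case/dvdnP => c ->; rewrite PoszM -mulrA dvdz_mull //.
exact: (recpoly_cong H).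
Qed.

End Newton.

Section Valuation.

Lemma logn_fact_le p n : prime p -> (logn p n`! <= n)%N.
Proof.
move=> pp; rewrite logn_fact //.
(* The extra quotient is a buffer: as p >= 2, it is at least twice the next one, so it pays for the
   new summand and for the new buffer. *)
have H m : (\sum_(1 <= k < m.+1) n %/ p ^ k + n %/ p ^ m <= n)%N.
  elim: m => [|m IH]; first by rewrite big_geq // expn0 divn1.
  rewrite big_nat_recr //=; apply: leq_trans IH; rewrite -addnA leq_add2l addnn -mul2n.
  rewrite expnSr divnMA; apply: leq_trans (leq_trunc_div _ p).
  by rewrite mulnC leq_mul2l prime_gt1 // orbT.
exact: leq_trans (leq_addr _ _) (H n).
Qed.

Lemma dvdn_pfactor_mulr p n a d : prime p -> (0 < a)%N ->
  (p ^ n %| a * d)%N -> (p ^ (n - logn p a) %| d)%N.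
Proof.
move=> pp a0; case: (posnP d) => [->|d0]; first by rewrite dvdn0.
by rewrite !pfactor_dvdn ?muln_gt0 ?a0 // lognM // leq_subLR.
Qed.

End Valuation.

(** * Solutions of power sum congruences in fixed residue classes *)

Section Counting.

Lemma logn_prod_le p (I : finType) (A : pred I) (F : I -> nat) m :
  (forall i, A i -> (0 < F i)%N && (logn p (F i) <= m)%N) ->
  (0 < \prod_(i | A i) F i)%N && (logn p (\prod_(i | A i) F i) <= m * #|A|)%N.
Proof.
move=> H; suff : (0 < \prod_(i | A i) F i)%N &&
   (logn p (\prod_(i | A i) F i) <= \sum_(i | A i) m)%N.
  by rewrite sum_nat_const mulnC.
elim/big_rec2: _ => [|i x y Ai /andP[y0 yx]]; first by rewrite logn1.
have /andP[F0 Fm] := H i Ai; rewrite muln_gt0 F0 y0 lognM //=.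
by rewrite leq_add.
Qed.

(* Newton's identities give [q ^ n %| k`! * \prod_l (y i - x l)]; the factors
   with [l != i] have valuation less than [k]. *)
Lemma fiber_congruent (q k : nat) n (x y c : 'I_k -> int) :
  prime q ->
  (forall i l, i != l -> ~~ ((q ^ k)%:Z %| c i - c l)%Z) ->
  (forall i, ((q ^ k)%:Z %| x i - c i)%Z) ->
  (forall i, ((q ^ k)%:Z %| y i - c i)%Z) ->
  (forall j, (0 < j <= k)%N ->
     ((q ^ n)%:Z %| \sum_i x i ^+ j - \sum_i y i ^+ j)%Z) ->
  forall i, ((q ^ (n - (k + k * k)))%:Z %| y i - x i)%Z.
Proof.
move=> pq cneq xc yc H i.
have E z j : psum (map z (enum 'I_k)) j = \sum_i z i ^+ j.
  by rewrite /psum big_map big_enum.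
have := @prod_diff_dvd (q ^ n)%:Z (map x (enum 'I_k)) (map y (enum 'I_k)) k.
have sz (z : 'I_k -> int) : size [seq z i | i <- enum 'I_k] = k.
  by rewrite size_map; exact: size_enum_ord.
move=> /(_ (sz x) (sz y)).
move=> /(_ _ (y i)) H'.
have {H'} : ((q ^ n)%:Z %| k`!%:Z * \prod_(x0 <- [seq x i | i <- enum 'I_k]) (y i - x0))%Z.
  apply: H'; last by rewrite map_f ?mem_enum.
  by move=> j Hj; rewrite !E; apply: H.
rewrite big_map big_enum /= (bigD1 i) //= mulrCA mulrC.
set pr : int := \prod_(_ < _ | _) _.
rewrite -mulrA [X in (_ %| X)%Z]mulrC !dvdzE !abszM /= => Hd.
have ep : `|pr|%N = (\prod_(l < k | l != i) `|y i - x l|)%N.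
  exact: (big_morph (fun z : int => `|z|%N) abszM (erefl _)).
set a := (`|pr| * k`!)%N in Hd *.
have Hnd l : l != i -> ~~ (q ^ k %| `|y i - x l|)%N.
  move=> li; apply: contra (cneq _ _ li) => H1.
  have : ((q ^ k)%:Z %| y i - x l)%Z by rewrite dvdzE.
  move=> H2; have := rpredB (rpredB (yc i) H2) (xc l).
  by have -> : y i - c i - (y i - x l) - (x l - c l) = c l - c i by ring.
have /andP[p0 pl] : (0 < \prod_(l < k | l != i) `|y i - x l|)%N &&
   (logn q (\prod_(l < k | l != i) `|y i - x l|) <= k * #|predC1 i|)%N.
  apply: logn_prod_le => l /Hnd H1; have y0 : (0 < `|y i - x l|)%N.
    by case: posnP H1 => // ->; rewrite dvdn0.
  rewrite y0 /= leqNgt; apply: contra H1 => H1.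
  by rewrite pfactor_dvdn // ltnW.
have a0 : (0 < a)%N by rewrite /a ep muln_gt0 p0 fact_gt0.
rewrite mulnAC -/a in Hd; apply: dvdn_trans (dvdn_pfactor_mulr pq a0 Hd).
apply: dvdn_exp2l; apply: leq_sub2l.
rewrite /a ep lognM ?fact_gt0 // addnC; apply: leq_add; first exact: logn_fact_le.
apply: leq_trans pl _; rewrite leq_mul2l; apply/orP; right.
by apply: leq_trans (max_card _) _; rewrite card_ord.
Qed.

(** A q-adic form of Linnik's lemma. The congruence of degree j + 1 is known modulo [p ^ j.+1];
    prescribing its remaining digits lifts every congruence to the modulus [p ^ k], which costs the
    first product. Then [fiber_congruent] fixes all but the top digits of each variable, and these
    cost the second factor. *)
Lemma card_residue_solutions (q k b w : nat) (c : 'I_k -> nat) (a : int)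
    (h : 'I_k -> int) :
  prime q -> (b <= w * k)%N ->
  (forall i l, i != l -> ~~ ((q ^ k)%:Z %| (c i)%:Z - (c l)%:Z)%Z) ->
  (#|[set x : {ffun 'I_k -> 'I_(q ^ b)} |
      [forall i, ((q ^ k)%:Z %| ((x i)%:Z - (c i)%:Z)%R)%Z] &&
      [forall j : 'I_k, (((q ^ w) ^ j.+1)%:Z %|
          (\sum_i ((x i)%:Z - a) ^+ j.+1 - h j)%R)%Z]]|
   <= (\prod_(j < k) (q ^ w) ^ (k - j.+1)) * (q ^ (k + k * k)) ^ k)%N.
Proof.
move=> pq bwk cneq; set p := (q ^ w)%N; set Z := [set x | _].
have q0 : (0 < q)%N by exact: prime_gt0.
have p0 : (0 < p)%N by rewrite expn_gt0 q0.
(* The number of base q digits of each variable that the lifted congruences determine; k + k * k is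
   the loss in [fiber_congruent]. The truncated subtraction is harmless, as only
   [b <= E + (k + k * k)] is used. *)
pose E := (w * k - (k + k * k))%N.
pose dig (x : {ffun 'I_k -> 'I_(q ^ b)}) (j : 'I_k) : int :=
  modz (divz (\sum_i ((x i)%:Z - a) ^+ j.+1 - h j) (p ^ j.+1)%N) (p ^ (k - j.+1))%N.
have pj m : (0 < p ^ m)%N by rewrite expn_gt0 p0.
have dig_ge x j : 0 <= dig x j.
  by apply: modz_ge0; rewrite -lt0n.
have dig_lt x j : dig x j < (p ^ (k - j.+1))%:Z.
  by apply: ltz_pmod; rewrite ltz_nat.
have dl x j : (`|dig x j| < p ^ (k - j.+1))%N.
  by rewrite -ltz_nat gez0_abs.
have dl2 x j : (`|dig x j| < p ^ k)%N.
  by apply: leq_trans (dl x j) _; rewrite leq_pexp2l // leq_subr.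
have gl (x : 'I_(q ^ b)) : (x %/ q ^ E < q ^ (k + k * k))%N.
  rewrite ltn_divLR ?expn_gt0 ?q0 // -expnD; apply: leq_trans (ltn_ord x) _.
  by rewrite leq_exp2l ?prime_gt1 // (leq_trans bwk) // -leq_subLR.
pose phi (x : {ffun 'I_k -> 'I_(q ^ b)}) :=
  ([ffun j => Ordinal (dl2 x j)] : {ffun 'I_k -> 'I_(p ^ k)},
   [ffun i => Ordinal (gl (x i))] : {ffun 'I_k -> 'I_(q ^ (k + k * k))}).
have inj : {in Z &, injective phi}.
  move=> x y; rewrite !inE => /andP[/forallP xc /forallP xd] /andP[/forallP yc /forallP yd].
  move=> e; have /ffunP e1 : (phi x).1 = (phi y).1 by rewrite e.
  have /ffunP e2 : (phi x).2 = (phi y).2 by rewrite e.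
  have H : forall j, (0 < j <= k)%N ->
     ((q ^ (w * k))%:Z %| \sum_i ((x i)%:Z - a) ^+ j - \sum_i ((y i)%:Z - a) ^+ j)%Z.
    case=> // j /= jk; have := e1 (Ordinal jk); rewrite !ffunE => /(congr1 val) /=.
    have := yd (Ordinal jk); have := xd (Ordinal jk); rewrite /dig /=.
    set sx := \sum_i _; set sy := \sum_i _; set hh := h _ => d1 d2.
    move=> /(congr1 Posz); rewrite !gez0_abs; try by apply: modz_ge0; rewrite -lt0n.
    move/eqP; rewrite eqz_mod_dvd => H.
    have -> : sx - sy = ((sx - hh) - (sy - hh)) by ring.
    rewrite -(divzK d1) -(divzK d2) -mulrBl.
    have -> : (q ^ (w * k))%:Z = (p ^ (k - j.+1))%:Z * (p ^ j.+1)%:Z.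
      by rewrite -PoszM -expnD subnK // /p -expnM.
    by rewrite dvdz_mul.
  apply/ffunP => i; apply: val_inj => /=.
  have key : ((q ^ E)%:Z %| ((y i)%:Z - a) - ((x i)%:Z - a))%Z.
    apply: (@fiber_congruent q k (w * k) (fun i => (x i)%:Z - a)
      (fun i => (y i)%:Z - a) (fun i => (c i)%:Z - a)) => //.
    - by move=> i' l il; rewrite opprB addrA subrK; apply: cneq.
    - by move=> i'; rewrite opprB addrA subrK; apply: xc.
    - by move=> i'; rewrite opprB addrA subrK; apply: yc.
  move: key; rewrite opprB addrA subrK -eqz_mod_dvd !modz_nat => /eqP[e3].
  have := e2 i; rewrite !ffunE => /(congr1 val) /= e4.
  by rewrite (divn_eq (x i) (q ^ E)) e4 -e3 -divn_eq.
rewrite -(card_in_imset inj).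
pose F := family (fun j : 'I_k => [pred d : 'I_(p ^ k) | (d < p ^ (k - j.+1))%N]).
have sub : phi @: Z \subset [pred u | (u.1 \in F) && (u.2 \in predT)].
  apply/fintype.subsetP => u /imsetP[x _ ->]; rewrite !inE andbT.
  by apply/familyP => j; rewrite !ffunE inE /= dl.
apply: leq_trans (subset_leq_card sub) _.
have -> : #|[pred u | (u.1 \in F) && (u.2 \in @predT {ffun 'I_k -> 'I_(q ^ (k + k * k))})]| = (#|F| * #|@predT {ffun 'I_k -> 'I_(q ^ (k + k * k))}|)%N.
  exact: cardX.
rewrite card_ffun !card_ord leq_mul2r; apply/orP; right.
rewrite card_family foldrE big_map big_enum /= leq_prod // => j _.
rewrite -[X in (_ <= X)%N]card_ord.
pose wd (d : 'I_(p ^ (k - j.+1))) := widen_ord (leq_pexp2l p0 (leq_subr j.+1 k)) d.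
have wdI : injective wd by move=> d d' /(congr1 val) /= ?; apply: val_inj.
rewrite -(fintype.card_image wdI).
apply: subset_leq_card; apply/fintype.subsetP => d H; have dj : (d < p ^ (k - j.+1))%N := H.
by apply/fintype.imageP; exists (Ordinal dj) => //; apply: val_inj.
Qed.

End Counting.

(** * The q-adic mean value theorem *)

Section Representations.

Lemma card_pairE (I J : finType) (P : I -> J -> bool) :
  #|[set p : I * J | P p.1 p.2]| = (\sum_i #|[pred j | P i j]|)%N.
Proof.
rewrite cardsE -sum1_card.
under [RHS]eq_bigr => i _ do rewrite -sum1_card.
by rewrite pair_big_dep /=; apply: eq_bigl => p; rewrite unfold_in /= unfold_in.
Qed.

Lemma sum_uniq_pred1 (T : eqType) (S : seq T) (F : T -> nat) v : uniq S ->
  (\sum_(u <- S | u == v) F u = if v \in S then F v else 0)%N.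
Proof.
move=> US; case: ifP => vS.
  rewrite big_mkcond (bigD1_seq v) //= eqxx big1 ?addn0 // => u /negbTE uv.
  by rewrite uv.
by rewrite big1_seq // => u /andP[/eqP -> uS]; rewrite uS in vS.
Qed.

(** With r the representation function of [g], the left side is the sum of r(u) r(phi u). By 2xy <=
    x^2 + y^2 and the injectivity of [phi] it is at most the sum of r(u)^2. *)
Lemma card_fiber_shift (I : finType) (T : eqType) (g : I -> T) (phi : T -> T) :
  injective phi ->
  (#|[set p : I * I | g p.2 == phi (g p.1)]| <= #|[set p : I * I | g p.2 == g p.1]|)%N.
Proof.
move=> phiI; pose r u := #|[pred i | g i == u]|; pose S := undup (codom g).
have gS i : g i \in S by rewrite mem_undup codom_f.
have US : uniq S by exact: undup_uniq.
have cnt (ps : T -> T) :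
    #|[set p : I * I | g p.2 == ps (g p.1)]| = (\sum_(u <- S) r u * r (ps u))%N.
  rewrite (card_pairE (fun i j => g j == ps (g i))) -/r.
  rewrite (eq_bigr (fun i => \sum_(u <- S | u == g i) r (ps u))%N); last first.
    by move=> i _; rewrite sum_uniq_pred1 // gS.
  rewrite (exchange_big_dep predT) //=; apply: eq_bigr => u _.
  rewrite sum_nat_const; congr (_ * _)%N; apply: eq_card => i.
  by rewrite !unfold_in /= eq_sym.
rewrite (cnt phi) (cnt id) /=.
have H1 : (\sum_(u <- S) r (phi u) * r (phi u) <= \sum_(v <- S) r v * r v)%N.
  have E u : (r (phi u) * r (phi u) = \sum_(v <- S | v == phi u) r v * r v)%N.
    rewrite sum_uniq_pred1 //; case: ifPn => // uS.
    suff -> : r (phi u) = 0%N by [].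
    apply/eqP; rewrite -leqn0 leqNgt; apply: contra uS => H; have [i1] := elimT fintype.card_gt0P H.
    by rewrite inE => /eqP <-.
  rewrite (eq_bigr _ (fun u _ => E u)) (exchange_big_dep predT) //=.
  apply: leq_sum => v _.
  have [[u0 [_ H]]|H] := pselect (exists u0, u0 \in S /\ v == phi u0); last first.
    rewrite big1_seq // => u /andP[vu uS]; case: H; by exists u.
  rewrite (eq_bigl (fun u => u == u0)); last first.
    by move=> u; rewrite (eqP H) (inj_eq phiI) eq_sym.
  by rewrite sum_uniq_pred1 //; case: ifP.
have H2 : (\sum_(u <- S) 2 * (r u * r (phi u)) <=
    \sum_(u <- S) (r u * r u + r (phi u) * r (phi u)))%N.
  by apply: leq_sum => u _; rewrite !mulnn (nat_Cauchy (r u) (r (phi u))).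
move: H2; rewrite -big_distrr big_split /= => H2.
by rewrite -(leq_pmul2l (isT : 0 < 2)%N) (leq_trans H2) // mul2n -addnn leq_add2l.
Qed.

Variable k : nat.

Definition vsum s P (x : {ffun 'I_s -> 'I_P}) : 'I_k -> int :=
  fun j => \sum_i (x i)%:Z ^+ j.+1.

Definition vino s P : nat :=
  #|[set p : {ffun 'I_s -> 'I_P} * {ffun 'I_s -> 'I_P} |
     [forall j, vsum p.2 j == vsum p.1 j]]|.

Lemma card_vsum_shift s P (D : 'I_k -> int) :
  (#|[set p : {ffun 'I_s -> 'I_P} * {ffun 'I_s -> 'I_P} |
     [forall j, vsum p.2 j == (vsum p.1 j + D j)%R]]| <= vino s P)%N.
Proof.
pose g (x : {ffun 'I_s -> 'I_P}) : {ffun 'I_k -> int} := [ffun j => vsum x j].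
pose phi (u : {ffun 'I_k -> int}) : {ffun 'I_k -> int} := [ffun j => u j + D j].
have phiI : injective phi.
  by move=> u v /ffunP H; apply/ffunP => j; have := H j; rewrite !ffunE => /addIr.
have E (D' : 'I_k -> int) (ps : {ffun 'I_k -> int} -> {ffun 'I_k -> int}) :
  (forall u j, ps u j = u j + D' j) -> forall x y : {ffun 'I_s -> 'I_P},
  [forall j, vsum y j == vsum x j + D' j] = (g y == ps (g x)).
  move=> Hps x y; apply/forallP/eqP => [H|/ffunP H j].
    by apply/ffunP => j; rewrite Hps !ffunE; apply/eqP.
  by have := H j; rewrite Hps !ffunE => ->.
have -> : vino s P = #|[set p : {ffun 'I_s -> 'I_P} * {ffun 'I_s -> 'I_P} | g p.2 == g p.1]|.
  apply: eq_card => p; rewrite !inE -(E (fun=> 0) id) //; last by move=> *; rewrite addr0.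
  by apply: eq_forallb => j; rewrite addr0.
apply: leq_trans (card_fiber_shift g phiI).
apply: subset_leq_card; apply/fintype.subsetP => p; rewrite !inE.
by rewrite (E D phi) // => u j; rewrite ffunE.
Qed.

(** Translation invariance of the Vinogradov system: by the binomial theorem the translated power
    sums are combinations of the original ones of no larger degree. *)
Lemma psum_shift (I : finType) (x y : I -> int) (a : int) n :
  (forall j, (0 < j <= n)%N -> \sum_i x i ^+ j = \sum_i y i ^+ j) ->
  forall j, (j <= n)%N -> \sum_i (x i - a) ^+ j = \sum_i (y i - a) ^+ j.
Proof.
move=> H j jn; have E (z : I -> int) : \sum_i (z i - a) ^+ j =
   \sum_(l < j.+1) (((- a) ^+ l) *+ 'C(j, l)) * \sum_i z i ^+ (j - l).
  under eq_bigr => i _ do rewrite exprDn.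
  rewrite exchange_big /=; apply: eq_bigr => l _; rewrite mulr_sumr.
  by apply: eq_bigr => i _; rewrite mulrC mulrnAl.
rewrite !E; apply: eq_bigr => l _; congr (_ * _).
(* Degree zero is not among the hypotheses, but there both sums merely count the variables. *)
case: (posnP (j - l)%N) => [->|lj]; last first.
  by apply: H; rewrite lj /=; apply: leq_trans jn; apply: leq_subr.
by apply: eq_bigr => i _; rewrite !expr0.
Qed.

End Representations.

Lemma Posz_expn m n : (m ^ n)%N%:Z = m%:Z ^+ n.
Proof. by elim: n => [|n IH] //; rewrite expnS exprS PoszM IH. Qed.

Section MixedEnergy.
Variables (q k b w : nat).
Hypotheses (pq : prime q) (wb : (w <= b)%N).
Let p := (q ^ w)%N.

(** Writing y = a + p y', the power sums of degree j + 1 become multiples of [p ^ j.+1]. So [D j]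
    must be one as well, and after division a shifted system on the shorter side remains. *)
Lemma card_class_pairs s (a : nat) (D : 'I_k -> int) :
  (#|[set yy : {ffun 'I_s -> 'I_(q ^ b)} * {ffun 'I_s -> 'I_(q ^ b)} |
      [&& [forall i, (yy.1 i %% p == a)%N], [forall i, (yy.2 i %% p == a)%N] &
       [forall j : 'I_k, (\sum_i ((yy.2 i)%:Z - a%:Z) ^+ j.+1 ==
                         \sum_i ((yy.1 i)%:Z - a%:Z) ^+ j.+1 + D j)%R]]]|
   <= if [forall j : 'I_k, ((p ^ j.+1)%N%:Z %| D j)%Z] then vino k s (q ^ (b - w)) else 0)%N.
Proof.
have q0 : (0 < q)%N by exact: prime_gt0.
have p0 : (0 < p)%N by rewrite expn_gt0 q0.
set Z := [set yy | _].
have ylt (y : 'I_(q ^ b)) : (y %/ p < q ^ (b - w))%N.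
  by rewrite ltn_divLR // -expnD subnK.
pose f (y : {ffun 'I_s -> 'I_(q ^ b)}) : {ffun 'I_s -> 'I_(q ^ (b - w))} :=
  [ffun i => Ordinal (ylt (y i))].
have cls (y : {ffun 'I_s -> 'I_(q ^ b)}) (j : 'I_k) : [forall i, (y i %% p == a)%N] ->
   \sum_i ((y i)%:Z - a%:Z) ^+ j.+1 = (p ^ j.+1)%N%:Z * vsum (f y) j.
  move=> /forallP H; rewrite /vsum mulr_sumr; apply: eq_bigr => i _.
  rewrite /f ffunE /= Posz_expn -exprMn.
  congr (_ ^+ _); have := divn_eq (y i) p; rewrite (eqP (H i)) => {1}->.
  by rewrite PoszD addrK PoszM mulrC.
have pjz (j : 'I_k) : (p ^ j.+1)%N%:Z != 0 by rewrite -lt0n expn_gt0 p0.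
case: (set_0Vmem Z) => [->|[yy0]]; first by rewrite cards0.
rewrite inE => /and3P[h1 h2 /forallP h3].
have HD (j : 'I_k) : ((p ^ j.+1)%N%:Z %| D j)%Z.
  have := h3 j; rewrite !cls // => /eqP E.
  have -> : D j = (p ^ j.+1)%N%:Z * (vsum (f yy0.2) j - vsum (f yy0.1) j).
    by rewrite mulrBr E; ring.
  by rewrite dvdz_mulr.
have -> : [forall j : 'I_k, ((p ^ j.+1)%N%:Z %| D j)%Z] by apply/forallP.
pose D' (j : 'I_k) := divz (D j) (p ^ j.+1)%N.
apply: leq_trans (card_vsum_shift _ _ D').
pose F (yy : {ffun 'I_s -> 'I_(q ^ b)} * {ffun 'I_s -> 'I_(q ^ b)}) := (f yy.1, f yy.2).
have fI (y y' : {ffun 'I_s -> 'I_(q ^ b)}) : [forall i, (y i %% p == a)%N] ->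
   [forall i, (y' i %% p == a)%N] -> f y = f y' -> y = y'.
  move=> /forallP H /forallP H' /ffunP E; apply/ffunP => i; apply: val_inj => /=.
  have := E i; rewrite !ffunE => /(congr1 val) /= E1.
  by rewrite (divn_eq (y i) p) E1 (eqP (H i)) -(eqP (H' i)) -divn_eq.
have FI : {in Z &, injective F}.
  move=> [y1 y2] [y3 y4]; rewrite !inE /= => /and3P[a1 a2 _] /and3P[a3 a4 _] E.
  by congr (_, _); apply: fI => //; [exact: (congr1 fst E)|exact: (congr1 snd E)].
rewrite -(card_in_imset FI); apply: subset_leq_card; apply/fintype.subsetP => u.
case/imsetP => yy yyZ ->; move: yyZ; rewrite !inE => /and3P[a1 a2 /forallP a3].
apply/forallP => j; have := a3 j; rewrite !cls // /D' -{1}(divzK (HD j)).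
by rewrite [X in _ + X]mulrC -mulrDr => /eqP/(mulfI (pjz j)) ->.
Qed.

Hypothesis (bwk : (b <= w * k)%N).

Definition res_bound := ((\prod_(j < k) p ^ (k - j.+1)) * (q ^ (k + k * k)) ^ k)%N.

(** After translation by [a] the s-blocks only contribute multiples of [p ^ j.+1], so the two
    k-blocks satisfy power sum congruences. The first k-block is free, the second is counted by
    [card_residue_solutions], and for given k-blocks the s-blocks are counted by
    [card_class_pairs]. *)
Lemma card_mixed_energy s (a : nat) (c : 'I_k -> nat) :
  (forall i l, i != l -> ~~ ((q ^ k)%:Z %| (c i)%:Z - (c l)%:Z)%Z) ->
  (#|[set xx : ({ffun 'I_k -> 'I_(q ^ b)} * {ffun 'I_s -> 'I_(q ^ b)}) *
              ({ffun 'I_k -> 'I_(q ^ b)} * {ffun 'I_s -> 'I_(q ^ b)}) |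
      [&& [forall i, (xx.1.1 i %% q ^ k == c i)%N] && [forall i, (xx.1.2 i %% p == a)%N],
          [forall i, (xx.2.1 i %% q ^ k == c i)%N] && [forall i, (xx.2.2 i %% p == a)%N] &
       [forall j : 'I_k, (vsum xx.1.1 j + vsum xx.1.2 j ==
                         vsum xx.2.1 j + vsum xx.2.2 j)%R]]]|
   <= (q ^ b) ^ k * res_bound * vino k s (q ^ (b - w)))%N.
Proof.
move=> cneq; set Z := [set xx | _].
pose X := {ffun 'I_k -> 'I_(q ^ b)}; pose Y := {ffun 'I_s -> 'I_(q ^ b)}.
(* Regroups a pair of solutions so that the two k-blocks stand together and the two s-blocks stand
   together. *)
pose sw (u : (X * Y) * (X * Y)) := ((u.1.1, u.2.1), (u.1.2, u.2.2)).
have swI : injective sw by move=> [[? ?] [? ?]] [[? ?] [? ?]] [-> -> -> ->].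
pose sh n (x : {ffun 'I_n -> 'I_(q ^ b)}) (j : 'I_k) : int :=
  \sum_i ((x i)%:Z - a%:Z) ^+ j.+1.
pose D (xx : X * X) (j : 'I_k) : int := sh k xx.1 j - sh k xx.2 j.
pose Rl (xx : X * X) (yy : Y * Y) : bool :=
  [forall i, (xx.2 i %% q ^ k == c i)%N] &&
  [&& [forall i, (yy.1 i %% p == a)%N], [forall i, (yy.2 i %% p == a)%N] &
       [forall j : 'I_k, (sh s yy.2 j == sh s yy.1 j + D xx j)%R]].
have sub : sw @: Z \subset [set u : (X * X) * (Y * Y) | Rl u.1 u.2].
  apply/fintype.subsetP => u /imsetP[[[x1 y1] [x2 y2]] uZ ->]; move: uZ.
  rewrite !inE /= => /and3P[/andP[h1 h2] /andP[h3 h4] /forallP h5].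
  rewrite /Rl /= h3 h2 h4 /=; apply/forallP => j.
  pose z (x : X) (y : Y) (i : 'I_k + 'I_s) : int :=
     match i with inl i => (x i)%:Z | inr i => (y i)%:Z end.
  have := @psum_shift _ (z x1 y1) (z x2 y2) a%:Z k.
  (* This discharges the premise of [psum_shift] in place, for all k + s variables at once, indexed
     by the sum type. *)
  have -> : (forall j, (0 < j <= k)%N -> \sum_i z x1 y1 i ^+ j = \sum_i z x2 y2 i ^+ j) <-> True.
    split=> // _ [|n] //= nk; rewrite !big_sumType /=.
    by have := h5 (Ordinal nk) => /eqP.
  move=> /(_ I j.+1 (ltn_ord j)); rewrite !big_sumType /= => E.
  have E' : sh k x1 j + sh s y1 j = sh k x2 j + sh s y2 j := E.
  by apply/eqP; apply: (addrI (sh k x2 j)); rewrite -E' /D /=; ring.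
rewrite -(card_imset _ swI); apply: leq_trans (subset_leq_card sub) _.
rewrite card_pairE.
pose good (xx : X * X) := [forall i, (xx.2 i %% q ^ k == c i)%N] &&
   [forall j : 'I_k, ((p ^ j.+1)%N%:Z %| D xx j)%Z].
apply: (@leq_trans (\sum_xx if good xx then vino k s (q ^ (b - w)) else 0)%N).
  apply: leq_sum => xx _; rewrite /good /Rl; case: [forall i, _] => /=; last by rewrite card0.
  by rewrite -cardsE; apply: card_class_pairs.
rewrite -big_mkcond /= sum_nat_const leq_mul2r; apply/orP; right.
pose G (x1 x2 : X) := good (x1, x2).
have -> : #|good| = #|[set xx : X * X | G xx.1 xx.2]|.
  by apply: eq_card => -[x1 x2]; rewrite inE.
rewrite card_pairE.
apply: (@leq_trans (\sum_(x1 : X) res_bound)%N); last first.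
  by rewrite sum_nat_const card_ffun !card_ord.
apply: leq_sum => x1 _.
apply: leq_trans (card_residue_solutions a (fun j => sh k x1 j) pq bwk cneq).
rewrite -cardsE; apply: subset_leq_card; apply/fintype.subsetP => x2.
rewrite !inE /G /good /= => /andP[/forallP H1 /forallP H2]; apply/andP; split.
  apply/forallP => i; have := H1 i => /eqP <-.
  by rewrite -eqz_mod_dvd !modz_nat modn_mod.
apply/forallP => j; have := H2 j; rewrite /D /= -rpredN opprB.
by [].
Qed.

End MixedEnergy.

Section Pigeonhole.
Variable R : realType.

(** Call a class big if it carries at least [T / (2 K)]. With [k] big classes, an injective choice
    of them bounds [T ^+ (2 * k)] and gives the first term. Otherwise the small classes carry at
    most [T / 2], so one of fewer than [k] big classes carries at least [T / (2 k)]. *)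
Lemma pigeonhole_powers (k K s : nat) (t : 'I_K -> R) (T : R) :
  (0 < k)%N -> (0 < K)%N -> (forall c, 0 <= t c) -> 0 <= T -> T <= \sum_c t c ->
  T ^+ (2 * (s + k)) <=
   (2 * K%:R) ^+ (2 * k) *
     \sum_(c : {ffun 'I_k -> 'I_K} | injectiveb c) (\prod_i t (c i) ^+ 2) * T ^+ (2 * s)
   + (2 * k%:R) ^+ (2 * (s + k)) * \sum_c t c ^+ (2 * (s + k)).
Proof.
move=> k0 K0 t0 T0 Tt.
pose Big := [pred c | T <= 2 * K%:R * t c].
have kR : 0 <= 2 * k%:R :> R by rewrite mulr_ge0.
have KR : 0 < K%:R :> R by rewrite ltr0n.
have S1 : 0 <= (2 * K%:R) ^+ (2 * k) * \sum_(c : {ffun 'I_k -> 'I_K} | injectiveb c) (\prod_i t (c i) ^+ 2) * T ^+ (2 * s).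
  apply: mulr_ge0; first by rewrite exprn_ge0 ?mulr_ge0.
  by apply: sumr_ge0 => c _; rewrite mulr_ge0 ?exprn_ge0 // prodr_ge0 // => i _; rewrite exprn_ge0.
have S2 : 0 <= (2 * k%:R) ^+ (2 * (s + k)) * \sum_c t c ^+ (2 * (s + k)).
  by rewrite mulr_ge0 ?exprn_ge0 // sumr_ge0 // => c _; rewrite exprn_ge0.
case: (leqP k #|Big|) => HB.
  apply: (@le_trans _ _ ((2 * K%:R) ^+ (2 * k) * \sum_(c : {ffun 'I_k -> 'I_K} | injectiveb c) (\prod_i t (c i) ^+ 2) * T ^+ (2 * s))); last by rewrite lerDl.
  pose c0 : {ffun 'I_k -> 'I_K} := [ffun i => enum_val (widen_ord HB i)].
  have c0I : injectiveb c0.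
    by apply/injectiveP => i j; rewrite !ffunE => /enum_val_inj /(congr1 val) /= ?; apply: val_inj.
  have cB i : T <= 2 * K%:R * t (c0 i).
    by have := enum_valP (widen_ord HB i); rewrite ffunE.
  rewrite (bigD1 c0) //= mulrDr; apply: (@le_trans _ _ ((2 * K%:R) ^+ (2 * k) * (\prod_i t (c0 i) ^+ 2 * T ^+ (2 * s)))); last first.
    rewrite lerDl mulr_ge0 ?exprn_ge0 ?mulr_ge0 //.
    apply: sumr_ge0 => c _; rewrite mulr_ge0 ?exprn_ge0 // prodr_ge0 // => i _; exact: exprn_ge0.
  rewrite mulnDr exprD mulrA [X in X <= _]mulrC; apply: ler_wpM2r; first by rewrite exprn_ge0.
  have -> : (2 * K%:R) ^+ (2 * k) * \prod_i t (c0 i) ^+ 2 = \prod_(i < k) ((2 * K%:R * t (c0 i)) ^+ 2).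
    under [RHS]eq_bigr => i _ do rewrite exprMn.
    by rewrite [RHS]big_split /= prodr_const card_ord -exprM.
  have -> : T ^+ (2 * k) = \prod_(i < k) T ^+ 2 by rewrite big_const card_ord iter_mulr mulr1 -exprM.
  apply: ler_prod => i _; rewrite exprn_ge0 //=.
  by rewrite lerXn2r ?nnegrE // mulr_ge0 // mulr_ge0.
apply: (@le_trans _ _ ((2 * k%:R) ^+ (2 * (s + k)) * \sum_c t c ^+ (2 * (s + k)))); last by rewrite lerDr.
have [cm _ Hm] := @arg_maxP _ _ 'I_K (Ordinal K0) predT t isT.
have Tm : T <= 2 * k%:R * t cm.
  have H1 : \sum_(c | Big c) t c <= k%:R * t cm.
    apply: (@le_trans _ _ (\sum_(c | Big c) t cm)); first by apply: ler_sum => c _; exact: Hm.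
    by rewrite sumr_const -[X in X <= _]mulr_natl ler_wpM2r // ler_nat ltnW.
  have H2 : \sum_(c | ~~ Big c) t c <= T / 2.
    apply: (@le_trans _ _ (\sum_(c : 'I_K) T / (2 * K%:R))).
      rewrite big_mkcond /=; apply: ler_sum => c _; case: ifP => Bc.
        by rewrite ler_pdivlMr ?mulr_gt0 // mulrC; apply: ltW; rewrite ltNge.
      by rewrite divr_ge0 // mulr_ge0 // ltW.
    rewrite sumr_const card_ord -[X in X <= _]mulr_natl.
    by rewrite le_eqVlt; apply/orP; left; apply/eqP; field; rewrite gt_eqF.
  move: Tt; rewrite (bigID Big) /= => Tt; lra.
have H3 : T ^+ (2 * (s + k)) <= (2 * k%:R * t cm) ^+ (2 * (s + k)).
  by rewrite lerXn2r ?nnegrE // mulr_ge0.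
apply: le_trans H3 _; rewrite exprMn; apply: ler_wpM2l; first by rewrite exprn_ge0.
rewrite (bigD1 cm) //= lerDl sumr_ge0 // => c _; exact: exprn_ge0.
Qed.

End Pigeonhole.

(** * Exponential sums attached to the power sum system *)

Section Fourier.
Variables (R : realType) (k P Q : nat).
Hypothesis Q0 : (0 < Q)%N.
Local Notation psi := (@psi R Q).

Definition pw (x : nat) : 'I_k -> int := fun j => x%:Z ^+ j.+1.

Definition wsum (B : pred nat) (al : {ffun 'I_k -> 'I_Q}) : R[i] :=
  \sum_(x < P | B x) psi (dotf al (pw x)).

Lemma prod_wsum n (B : 'I_n -> pred nat) al :
  \prod_i wsum (B i) al =
  \sum_(x : {ffun 'I_n -> 'I_P} | [forall i, B i (x i)]) psi (dotf al (vsum x)).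
Proof.
rewrite /wsum bigA_distr_big_dep /=.
apply: eq_big => [x|x _].
  by apply/familyP/forallP.
rewrite -psi_sum; congr (psi _); rewrite /dotf exchange_big /=.
by apply: eq_bigr => j _; rewrite /vsum mulr_sumr.
Qed.

Lemma wsum_pow n (B : pred nat) al :
  wsum B al ^+ n =
  \sum_(x : {ffun 'I_n -> 'I_P} | [forall i, B (x i)]) psi (dotf al (vsum x)).
Proof. by rewrite -(prod_wsum (fun=> B)) prodr_const card_ord. Qed.

Lemma wsum_classes m al : (0 < m)%N ->
  wsum predT al = \sum_(c < m) wsum (fun x => x %% m == c)%N al.
Proof.
move=> m0; rewrite /wsum (partition_big (fun x : 'I_P => Ordinal (ltn_pmod x m0)) predT) //=.
Qed.

Lemma vsum_bounds n (x : {ffun 'I_n -> 'I_P}) (j : 'I_k) :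
  0 <= vsum x j <= (n * P ^ k)%N%:Z.
Proof.
rewrite /vsum; apply/andP; split.
  by apply: sumr_ge0 => i _; rewrite exprn_ge0.
apply: (@le_trans _ _ (\sum_(i < n) (P ^ k)%N%:Z)).
  apply: ler_sum => i _; rewrite -Posz_expn lez_nat.
  apply: (@leq_trans (P ^ j.+1)); first by rewrite leq_exp2r // ltnW.
  by rewrite leq_pexp2l // (leq_ltn_trans _ (ltn_ord (x i))).
by rewrite sumr_const card_ord PoszM mulrC -[X in X <= _]mulr_natr natz.
Qed.

Lemma eq_mod_large (u v : int) : 0 <= u < Q%:Z -> 0 <= v < Q%:Z ->
  (Q%:Z %| u - v)%Z = (u == v).
Proof.
move=> Hu Hv; rewrite -eqz_mod_dvd !modz_small //.
Qed.

End Fourier.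

Section Recursion.
Variables (R : realType) (q k b w s : nat).
Hypotheses (pq : prime q) (k0 : (0 < k)%N) (wb : (w <= b)%N) (kb : (k <= b)%N).
Hypotheses (bwk : (b <= w * k)%N) (s0 : (0 < s)%N).
Let P := (q ^ b)%N.
Let K := (q ^ k)%N.
Let p := (q ^ w)%N.
(** Larger than every power sum that occurs, so that congruence modulo [Q] is equality. *)
Let Q := ((k + s) * P ^ k).+1.

Let Q0 : (0 < Q)%N. Proof. by []. Qed.
Let q0 : (0 < q)%N. Proof. exact: prime_gt0. Qed.
Let K0 : (0 < K)%N. Proof. by rewrite expn_gt0 q0. Qed.
Let p0 : (0 < p)%N. Proof. by rewrite expn_gt0 q0. Qed.

Let vb n (x : {ffun 'I_n -> 'I_P}) (j : 'I_k) : (n <= k + s)%N -> 0 <= vsum x j < Q%:Z.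
Proof.
move=> ns; have /andP[-> H] := vsum_bounds x j; apply: le_lt_trans H _.
by rewrite ltz_nat /Q ltnS leq_mul2r ns orbT.
Qed.

Local Notation wsum B al := (@wsum R k P Q B al).

Lemma energy_wsum n (B : pred nat) : (n <= k + s)%N ->
  \sum_(al : {ffun 'I_k -> 'I_Q}) cabs (wsum B al) ^+ (2 * n) =
  Q%:R ^+ k * #|[set xx : {ffun 'I_n -> 'I_P} * {ffun 'I_n -> 'I_P} |
     [&& [forall i, B (xx.1 i)], [forall i, B (xx.2 i)] &
         [forall j : 'I_k, vsum xx.2 j == vsum xx.1 j]]]|%:R.
Proof.
move=> ns; rewrite (eq_bigr (fun al => cabs (\sum_(x : {ffun 'I_n -> 'I_P} | [forall i, B (x i)]) psi R Q (dotf al (vsum x))) ^+ 2)); last first.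
  by move=> al _; rewrite -wsum_pow cabsX -exprM mulnC.
rewrite energy_fourier //; congr (_ * _%:R); apply: eq_card => xx; rewrite !inE.
congr [&& _, _ & _]; apply: eq_forallb => j.
by rewrite eq_mod_large ?vb // eq_sym.
Qed.

Lemma energy_wsum_all n : (n <= k + s)%N ->
  \sum_(al : {ffun 'I_k -> 'I_Q}) cabs (wsum predT al) ^+ (2 * n) =
  Q%:R ^+ k * (vino k n P)%:R.
Proof.
move=> ns; rewrite energy_wsum //; congr (_ * _%:R); apply: eq_card => xx.
rewrite !inE; have H (x : {ffun 'I_n -> 'I_P}) : [forall i, @predT nat (x i)] by apply/forallP.
by rewrite !H.
Qed.

Lemma energy_wsum_class (c : nat) :
  \sum_(al : {ffun 'I_k -> 'I_Q}) cabs (wsum (fun x => x %% K == c)%N al) ^+ (2 * (s + k)) <=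
  Q%:R ^+ k * (vino k (s + k) (q ^ (b - k)))%:R.
Proof.
rewrite energy_wsum; last by rewrite addnC.
rewrite ler_wpM2l ?exprn_ge0 // ler_nat.
have := @card_class_pairs q k b k pq kb (s + k) c (fun=> 0).
have -> : [forall j : 'I_k, (((q ^ k) ^ j.+1)%N%:Z %| 0)%Z] by apply/forallP => j; rewrite dvdz0.
apply: leq_trans; apply: subset_leq_card; apply/fintype.subsetP => xx.
rewrite !inE => /and3P[-> -> /forallP H] /=; apply/forallP => j; rewrite addr0.
apply/eqP; apply: (@psum_shift _ (fun i => (xx.2 i)%:Z) (fun i => (xx.1 i)%:Z) _ k) => //.
by case=> // n nk; have /eqP := H (Ordinal nk).
Qed.

Lemma energy_mixed (a : nat) (c : 'I_k -> nat) :
  (forall i l, i != l -> ~~ (K%:Z %| (c i)%:Z - (c l)%:Z)%Z) ->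
  \sum_(al : {ffun 'I_k -> 'I_Q})
    \prod_i cabs (wsum (fun x => x %% K == c i)%N al) ^+ 2 *
     cabs (wsum (fun x => x %% p == a)%N al) ^+ (2 * s) <=
  Q%:R ^+ k * (P ^ k * res_bound q k w * vino k s (q ^ (b - w)))%:R.
Proof.
move=> cneq.
pose X := {ffun 'I_k -> 'I_P}; pose Y := {ffun 'I_s -> 'I_P}.
pose A (u : X * Y) := [forall i, (u.1 i %% K == c i)%N] && [forall i, (u.2 i %% p == a)%N].
pose v (u : X * Y) (j : 'I_k) : int := vsum u.1 j + vsum u.2 j.
rewrite (eq_bigr (fun al => cabs (\sum_(u | A u) psi R Q (dotf al (v u))) ^+ 2)); last first.
  move=> al _; rewrite mulnC exprM prodrXl -exprMn -cabsX -cabs_prod -cabsM.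
  rewrite (@prod_wsum R k P Q k (fun i x => x %% K == c i)%N) wsum_pow big_distrlr /= pair_big /=.
  congr (cabs _ ^+ 2); apply: eq_bigr => u _; rewrite -psiD; congr (psi R Q _).
  by rewrite /dotf -big_split; apply: eq_bigr => j _; rewrite mulrDr.
have vvb u j : 0 <= v u j < Q%:Z.
  have /andP[a1 a2] := vsum_bounds u.1 j; have /andP[b1 b2] := vsum_bounds u.2 j.
  rewrite /v addr_ge0 //=; apply: le_lt_trans (lerD a2 b2) _.
  by rewrite -PoszD ltz_nat -mulnDl /Q ltnS.
rewrite energy_fourier // ler_wpM2l ?exprn_ge0 // ler_nat.
apply: leq_trans (card_mixed_energy pq wb bwk s a cneq).
apply: subset_leq_card; apply/fintype.subsetP => xx.
rewrite !inE => /and3P[a1 a2 /forallP H]; apply/and3P; split => //; apply/forallP => j.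
by have := H j; rewrite eq_mod_large.
Qed.

(* The first term counts solutions in which [k] variables are distinct modulo
   [q ^ k], the second the case where most variables share one residue class,
   which rescales to side [q ^ (b - k)]. *)
Lemma vino_recursion :
  (vino k (s + k) P <=
   (2 * K) ^ (2 * k) * (K ^ k * (p ^ (2 * s) * (P ^ k * res_bound q k w * vino k s (q ^ (b - w)))))
   + (2 * k) ^ (2 * (s + k)) * (K * vino k (s + k) (q ^ (b - k))))%N.
Proof.
rewrite -(ler_nat R) -(ler_pM2l (_ : 0 < Q%:R ^+ k :> R)); last first.
  by rewrite exprn_gt0 // ltr0n.
rewrite -energy_wsum_all; last by rewrite addnC.
pose t (al : {ffun 'I_k -> 'I_Q}) (c : 'I_K) := cabs (wsum (fun x => x %% K == c)%N al).
pose U (al : {ffun 'I_k -> 'I_Q}) (a : 'I_p) := cabs (wsum (fun x => x %% p == a)%N al).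
pose T al := cabs (wsum predT al).
have T0 al : 0 <= T al by exact: cabs_ge0.
have H1 al : T al ^+ (2 * (s + k)) <=
   (2 * K%:R) ^+ (2 * k) *
     \sum_(c : {ffun 'I_k -> 'I_K} | injectiveb c) (\prod_i t al (c i) ^+ 2) * T al ^+ (2 * s)
   + (2 * k%:R) ^+ (2 * (s + k)) * \sum_c t al c ^+ (2 * (s + k)).
  apply: pigeonhole_powers => //; first by move=> c; exact: cabs_ge0.
  by rewrite /T (wsum_classes R P al K0) cabs_sum.
(* Hölder over the classes modulo [p] puts the remaining [2 * s] variables into a single class, as
   [energy_mixed] requires. *)
have H2 al : T al ^+ (2 * s) <= p%:R ^+ (2 * s).-1 * \sum_a U al a ^+ (2 * s).
  have -> : (2 * s)%N = (2 * s).-1.+1 by rewrite prednK // muln_gt0.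
  have UT : T al <= \sum_a U al a by rewrite /T (wsum_classes R P al p0) cabs_sum.
  apply: le_trans (_ : (\sum_a U al a) ^+ (2 * s).-1.+1 <= _).
    by rewrite lerXn2r ?nnegrE ?sumr_ge0 // => a _; exact: cabs_ge0.
  have := @power_mean R 'I_p predT (U al) (2 * s).-1 (fun a _ => cabs_ge0 _).
  by rewrite card_ord.
apply: le_trans (ler_sum _ (fun al _ => H1 al)) _.
rewrite big_split /= natrD mulrDr; apply: lerD; last first.
  rewrite -mulr_sumr exchange_big /= !natrM natrX natrM mulrCA; apply: ler_wpM2l.
    by rewrite exprn_ge0 // mulr_ge0.
  apply: (@le_trans _ _ (\sum_(c < K) Q%:R ^+ k * (vino k (s + k) (q ^ (b - k)))%:R)).
    by apply: ler_sum => c _; apply: energy_wsum_class.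
  by rewrite sumr_const card_ord -[X in X <= _]mulr_natl mulrCA.
rewrite -mulr_sumr exchange_big /= natrM natrX natrM [X in _ <= X]mulrCA; apply: ler_wpM2l.
  by rewrite exprn_ge0 // mulr_ge0.
set E := Q%:R ^+ k * (P ^ k * res_bound q k w * vino k s (q ^ (b - w)))%:R : R.
have E0 : 0 <= E by rewrite mulr_ge0 ?exprn_ge0.
apply: (@le_trans _ _ (\sum_(c : {ffun 'I_k -> 'I_K} | injectiveb c) p%:R ^+ (2 * s) * E)).
  apply: ler_sum => c /injectiveP cI.
  have cneq i l : i != l -> ~~ (K%:Z %| (c i)%:Z - (c l)%:Z)%Z.
    move=> il; rewrite eq_mod_large ?ltz_nat ?ltn_ord //.
    apply: contra il => /eqP[e]; apply/eqP/cI; exact: val_inj.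
  apply: (@le_trans _ _ (\sum_al p%:R ^+ (2 * s).-1 * \sum_a (\prod_i t al (c i) ^+ 2 * U al a ^+ (2 * s)))).
    apply: ler_sum => al _; rewrite -mulr_sumr mulrCA; apply: ler_wpM2l => //.
    by apply: prodr_ge0 => i _; rewrite exprn_ge0 // cabs_ge0.
  rewrite -mulr_sumr exchange_big /=.
  have -> : p%:R ^+ (2 * s) * E = p%:R ^+ (2 * s).-1 * \sum_(a < p) E.
    rewrite sumr_const card_ord -[E *+ p]mulr_natl mulrA -exprSr prednK //.
    by rewrite muln_gt0.
  apply: ler_wpM2l; first by rewrite exprn_ge0.
  by apply: ler_sum => a _; apply: energy_mixed.
rewrite sumr_const -[X in X <= _]mulr_natl.
rewrite [X in _ <= X](_ : _ = (K ^ k)%:R * (p%:R ^+ (2 * s) * E)); last first.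
  by rewrite /E !natrM [(p ^ _)%:R]natrX; ring.
apply: ler_wpM2r; first by rewrite mulr_ge0 // exprn_ge0.
rewrite ler_nat; apply: leq_trans (max_card _) _.
by rewrite card_ffun !card_ord.
Qed.

End Recursion.

Lemma sum_sub_ord k : (2 * \sum_(j < k) (k - j.+1) = k * (k - 1))%N.
Proof.
elim: k => [|k IH]; first by rewrite big_ord0.
rewrite big_ord_recl /=; under eq_bigr => j _ do rewrite /bump leq0n add1n subSS.
by rewrite mulnDr IH; case: k {IH} => [|k] //; lia.
Qed.

(** Serves to absorb the factor (2k)^(2S) of the recursion into q^(kS), which is possible as q >=
    3. *)
Lemma four_sqr_le_pow3 k : (4 <= k)%N -> ((2 * k) ^ 2 <= 3 ^ k)%N.
Proof.
move=> k4; rewrite -(subnK k4); elim: (k - 4)%N => [|n IH] //.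
rewrite addSn [(3 ^ _)%N]expnS; apply: (@leq_trans (3 * (2 * (n + 4)) ^ 2)%N).
  by rewrite -!mulnn; nia.
by rewrite leq_mul2l.
Qed.

(** With x = 1/k, Bernoulli gives (1 + x)^k >= 2, while (1 - x)^k (1 + x)^k <= 1. *)
Lemma one_sub_inv_pow_le (R : realType) k : (0 < k)%N -> (1 - k%:R^-1) ^+ k <= 2^-1 :> R.
Proof.
move=> k0; set x : R := k%:R^-1.
have kR : 0 < k%:R :> R by rewrite ltr0n.
have x0 : 0 < x by rewrite invr_gt0.
have x1 : x <= 1 by rewrite invf_le1 // ler1n.
have B n : 1 + n%:R * x <= (1 + x) ^+ n.
  elim: n => [|n IH]; first by rewrite mul0r addr0 expr0.
  rewrite exprS; apply: le_trans (ler_wpM2l _ IH); last by lra.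
  rewrite -natr1; have : 0 <= n%:R :> R by []. by nra.
have H1 : (1 - x) ^+ k * (1 + x) ^+ k <= 1.
  rewrite -exprMn exprn_ile1 //; nra.
have H2 := B k; rewrite divff ?gt_eqF // in H2.
have H3 : 0 <= (1 - x) ^+ k by rewrite exprn_ge0 // subr_ge0.
by nra.
Qed.

(** * The mean value theorem with explicit constants *)

Section Vinogradov.
Variables (R : realType) (q k : nat).
Hypotheses (pq : prime q) (q3 : (3 <= q)%N) (k8 : (8 <= k)%N).
Local Notation a := (q%:R : R).
Local Notation kR := (k%:R : R).

Let a0 : 0 < a. Proof. by rewrite ltr0n prime_gt0. Qed.
Let a1 : 1 <= a. Proof. by rewrite ler1n prime_gt0. Qed.

Lemma powR_nat n : (q ^ n)%:R = a `^ n%:R.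
Proof. by rewrite powR_mulrn ?natrX // (ltW a0). Qed.

Lemma powRqD (x y : R) : a `^ (x + y) = a `^ x * a `^ y.
Proof. by rewrite powRD //; apply/implyP => _; rewrite gt_eqF. Qed.

Lemma powRq_half (x y : R) : x + 1 <= y -> a `^ x <= a `^ y / 2.
Proof.
move=> xy; rewrite ler_pdivlMr //; apply: le_trans (ler_powR a1 xy).
rewrite powRqD powRr1 ?(ltW a0) // ler_wpM2l ?powR_ge0 // (ler_nat R 2).
exact: prime_gt1.
Qed.

(* The excess of the exponent over the optimal one after [t] recursion steps. *)
Definition eta t : R := kR * (kR + 1) / 2 * (1 - kR^-1) ^+ t.

Let kR8 : 8 <= kR. Proof. by rewrite (ler_nat R 8). Qed.

Lemma eta_bounds t : 0 <= eta t <= kR * (kR + 1) / 2.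
Proof.
have k1 : 0 < kR^-1 by rewrite invr_gt0; have := kR8; lra.
have k2 : kR^-1 <= 1 by rewrite invf_le1; have := kR8; lra.
have H0 : 0 <= kR * (kR + 1) / 2 by have := kR8; nra.
rewrite /eta mulr_ge0 //= ?exprn_ge0 ?subr_ge0 //.
by apply: ler_piMr => //; rewrite exprn_ile1 //; lra.
Qed.

Lemma etaS t : eta t.+1 = eta t - eta t / kR.
Proof. by rewrite /eta exprSr mulrA mulrBr mulr1. Qed.

Lemma vino_trivial s P : (vino k s P <= P ^ (2 * s))%N.
Proof.
apply: leq_trans (max_card _) _; rewrite card_prod card_ffun !card_ord.
by rewrite -expnD addnn mul2n.
Qed.

(** Induction on [t] and, inside, strong induction on [b]. The first term of [vino_recursion] is
    bounded with [t] steps and side exponent b - w, the second with the same number of variables and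
    side exponent b - k. The summand 2 k^3 per step pays for all factors independent of [b]. *)
Lemma vino_bound t b :
  (vino k (k ^ 2 + k * t) (q ^ b))%:R <=
  a `^ (2 * kR ^+ 3 * (t%:R + 1)
        + b%:R * (2 * (kR ^+ 2 + kR * t%:R) - kR * (kR + 1) / 2 + eta t)).
Proof.
(* For [b' <= k] the additive constant covers the excess of the trivial count; for [t' = 0] the
   initial value of [eta] cancels the term k (k + 1) / 2. *)
have triv t' b' : (b' <= k)%N \/ t' = 0%N ->
  (vino k (k ^ 2 + k * t') (q ^ b'))%:R <=
  a `^ (2 * kR ^+ 3 * (t'%:R + 1)
        + b'%:R * (2 * (kR ^+ 2 + kR * t'%:R) - kR * (kR + 1) / 2 + eta t')).
  move=> H; apply: le_trans (_ : ((q ^ b') ^ (2 * (k ^ 2 + k * t')))%:R <= _).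
    by rewrite ler_nat vino_trivial.
  rewrite -expnM powR_nat; apply: ler_powR => //.
  rewrite !(natrM, natrD, natrX); have /andP[e0 e1] := eta_bounds t'.
  have t0 : 0 <= t'%:R :> R by []. have b0 : 0 <= b'%:R :> R by [].
  case: H => [bk|t0'].
    have bk' : b'%:R <= kR by rewrite ler_nat.
    suff : b'%:R * (kR * (kR + 1) / 2) <= 2 * kR ^+ 3.
      have p1 : 0 <= kR ^+ 3 * t'%:R by rewrite mulr_ge0 // exprn_ge0.
      have p2 : 0 <= b'%:R * eta t' by rewrite mulr_ge0.
      by lra.
    have := kR8; move=> k8'.
    have h0 : 0 <= kR * (kR + 1) / 2 by rewrite divr_ge0 // mulr_ge0 //; lra.
    apply: le_trans (ler_wpM2r h0 bk') _.
    have : 0 <= kR ^+ 2 * (kR - 8) by rewrite mulr_ge0 ?sqr_ge0 //; lra.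
    have : 0 <= kR ^+ 2 by exact: sqr_ge0.
    rewrite !exprS expr0; lra.
  have -> : eta t' = kR * (kR + 1) / 2 by rewrite /eta t0' expr0 mulr1.
  rewrite t0' !mulr0; have : 0 <= kR ^+ 3 by rewrite exprn_ge0 //.
  nra.
elim: t b => [|t IHt] b; first by apply: triv; right.
elim/ltn_ind: b => b IHb; case: (leqP b k) => [bk|kb]; first by apply: triv; left.
have k0 : (0 < k)%N by apply: leq_trans k8.
(* The ceiling of b / k, the least [w] with b <= w k. *)
set w := ((b + k - 1) %/ k)%N.
have bwk : (b <= w * k)%N.
  have := divn_eq (b + k - 1) k; have := ltn_pmod (b + k - 1) k0; rewrite -/w; lia.
have wkb : (w * k <= b + k)%N.
  have := leq_trunc_div (b + k - 1) k; rewrite -/w; lia.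
have wb : (w <= b)%N by nia.
have s0 : (0 < k ^ 2 + k * t)%N by rewrite addn_gt0 expn_gt0 k0.
have := vino_recursion R pq k0 wb (ltnW kb) bwk s0.
have -> : (k ^ 2 + k * t + k = k ^ 2 + k * t.+1)%N by rewrite mulnS; lia.
rewrite -(ler_nat R) => /le_trans; apply.
set S := (k ^ 2 + k * t.+1)%N; set s := (k ^ 2 + k * t)%N.
have SR : S%:R = kR ^+ 2 + kR * (t%:R + 1) by rewrite natrD natrX natrM -natr1.
have sR : s%:R = kR ^+ 2 + kR * t%:R by rewrite natrD natrX natrM.
have t0 : 0 <= t%:R :> R by [].
have /andP[e0 e1] := eta_bounds t; have k8' := kR8.
have ek : 0 <= eta t / kR by rewrite divr_ge0.
rewrite natrD.
set X := _ + b%:R * _.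
(* Each term is to be at most half of the bound; since q >= 2, one spare unit in the exponent gives
   this factor. *)
suff [HA HB] : ((2 * q ^ k) ^ (2 * k) *
    ((q ^ k) ^ k * ((q ^ w) ^ (2 * s) * ((q ^ b) ^ k * res_bound q k w * vino k s (q ^ (b - w))))))%:R
     <= a `^ X / 2 /\
   ((2 * k) ^ (2 * S) * (q ^ k * vino k S (q ^ (b - k))))%:R <= a `^ X / 2.
  by rewrite [a `^ X]splitr; exact: lerD.
have bwR : b%:R <= w%:R * kR by rewrite -natrM ler_nat.
have wkR : w%:R * kR <= b%:R + kR by rewrite -natrM -natrD ler_nat.
split.
  apply: (@le_trans _ _ (a `^ (2 * kR * (kR + 1) + kR ^+ 2 + w%:R * (2 * s%:R) + b%:R * kR
     + (w%:R * (kR * (kR - 1) / 2) + (kR + kR ^+ 2) * kR) +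
     (2 * kR ^+ 3 * (t%:R + 1)
        + (b%:R - w%:R) * (2 * s%:R - kR * (kR + 1) / 2 + eta t))))).
    have L1 : ((2 * q ^ k) ^ (2 * k))%:R <= a `^ (2 * kR * (kR + 1)).
      have -> : 2 * kR * (kR + 1) = ((k.+1 * (2 * k))%N)%:R :> R.
        by rewrite !natrM -natr1; ring.
      rewrite -powR_nat ler_nat [X in (_ <= X)%N]expnM leq_exp2r ?muln_gt0 // expnS leq_mul2r.
      by rewrite prime_gt1 // orbT.
    have L6 := IHt (b - w)%N.
    rewrite -/s in L6.
    have L5 : ((q ^ k) ^ k * (q ^ w) ^ (2 * s) * (q ^ b) ^ k * res_bound q k w)%:R =
       a `^ (kR ^+ 2 + w%:R * (2 * s%:R) + b%:R * kR
     + (w%:R * (kR * (kR - 1) / 2) + (kR + kR ^+ 2) * kR)).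
      rewrite /res_bound -!expnM; under eq_bigr => j _ do rewrite -expnM.
      rewrite -expn_sum -!expnD powR_nat; congr (_ `^ _).
      rewrite -big_distrr /=.
      have E : (\sum_(j < k) (k - j.+1))%:R = kR * (kR - 1) / 2 :> R.
        by have := congr1 (fun n => n%:R : R) (sum_sub_ord k); rewrite !natrM natrB //; lra.
      rewrite !(natrD, natrM) E.
      move: (w%:R : R) (k%:R : R) (b%:R : R) (t%:R : R) => W X0 B0 T0. by ring.
    rewrite [X in X <= _](_ : _ = ((2 * q ^ k) ^ (2 * k))%:R *
       (((q ^ k) ^ k * (q ^ w) ^ (2 * s) * (q ^ b) ^ k * res_bound q k w)%:R *
        (vino k s (q ^ (b - w)))%:R)); last by rewrite -!natrM !mulnA.
    rewrite [X in _ <= a `^ X](_ : _ = 2 * kR * (kR + 1) + ((kR ^+ 2 + w%:R * (2 * s%:R) + b%:R * kR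
     + (w%:R * (kR * (kR - 1) / 2) + (kR + kR ^+ 2) * kR)) + (2 * kR ^+ 3 * (t%:R + 1)
        + (b%:R - w%:R) * (2 * s%:R - kR * (kR + 1) / 2 + eta t)))); last by ring.
    rewrite !(powRqD (2 * kR * (kR + 1))) powRqD; apply: ler_pM => //.
    rewrite L5; apply: ler_wpM2l; first exact: powR_ge0.
    by apply: le_trans L6 _; rewrite sR natrB.
  (* Rounding [w] up costs at most k^2, as w k <= b + k. The inequality w k >= b lowers b [eta] by
     at least b [eta] / k, which is the step from [t] to [t.+1]. A surplus of k^3 - 5 k^2 - 2 k is
     left. *)
  apply: powRq_half; rewrite /X etaS sR -[t.+1%:R]natr1.
  set e := eta t / kR; have ee : eta t = e * kR by rewrite /e mulfVK // gt_eqF //; lra.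
  have f5 : 0 <= kR * e by rewrite mulr_ge0.
  rewrite ee in e0 e1 *.
  have em : 0 <= (kR + 1) / 2 - e.
    rewrite subr_ge0 -(ler_pM2r (_ : 0 < kR)); [|lra].
    by apply: le_trans e1 _; lra.
  have f1 : 0 <= (b%:R + kR - w%:R * kR) * ((kR - 1) / 2).
    by rewrite mulr_ge0 ?subr_ge0 // divr_ge0 //; lra.
  have f2 : 0 <= (b%:R + kR - w%:R * kR) * ((kR + 1) / 2 - e).
    by rewrite mulr_ge0 // subr_ge0.
  have f3 : 0 <= kR ^+ 2 * (kR - 8) by rewrite mulr_ge0 ?sqr_ge0 //; lra.
  have f4 : 0 <= kR * (kR - 8) by rewrite mulr_ge0 //; lra.
  move: k8' f1 f2 f3 f4 f5; clear; clearbody e.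
  move: (w%:R : R) (b%:R : R) (t%:R : R) e (k%:R : R) => W B0 T0 e' X0 *.
  lra.
apply: (@le_trans _ _ (a `^ (kR * S%:R + kR + (2 * kR ^+ 3 * (t.+1%:R + 1)
        + (b%:R - kR) * (2 * (kR ^+ 2 + kR * t.+1%:R) - kR * (kR + 1) / 2 + eta t.+1))))).
  have L1 : ((2 * k) ^ (2 * S) * q ^ k)%:R <= a `^ (kR * S%:R + kR).
    have -> : kR * S%:R + kR = ((k * S + k)%N)%:R :> R by rewrite natrD natrM.
    rewrite -powR_nat ler_nat expnD leq_mul2r !expnM; apply/orP; right.
    rewrite leq_exp2r; last by rewrite /S addn_gt0 expn_gt0 k0.
    apply: leq_trans (four_sqr_le_pow3 _) _; first exact: leq_trans k8.
    by rewrite leq_exp2r.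
  have L2 := IHb (b - k)%N _.
  rewrite mulnA natrM powRqD; apply: ler_pM => //.
  apply: le_trans (L2 _) _; first by rewrite ltn_subrL k0 (leq_trans _ kb).
  by rewrite natrB // ltnW.
(* Shortening the side by [k] lowers the exponent by about 2 k S, while the cost is k S + k. This
   works because S exceeds k (k + 1) / 2 amply, the reason for starting from k^2 variables. *)
apply: powRq_half; rewrite /X SR -[t.+1%:R]natr1.
have /andP[e0' e1'] := eta_bounds t.+1.
have f1 : 0 <= kR * eta t.+1 by rewrite mulr_ge0.
have f2 : 0 <= kR * (kR * t%:R) by rewrite !mulr_ge0.
have f3 : 0 <= kR ^+ 2 * (kR - 8) by rewrite mulr_ge0 ?sqr_ge0 //; lra.
have f4 : 0 <= kR * (kR - 8) by rewrite mulr_ge0 //; lra.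
rewrite !exprS expr0 in f3 f4 *.
lra.
Qed.

(** Ten k steps multiply the initial excess by (1 - 1/k)^(10 k) <= 2^(-10), and they bring the
    number of variables to k^2 + 10 k^2. *)
Lemma vino_mean_value b :
  (vino k (11 * k ^ 2) (q ^ b))%:R <=
  a `^ (21 * kR ^+ 4 + b%:R * (22 * kR ^+ 2 - kR * (kR + 1) / 2 + kR ^+ 2 / 1024)).
Proof.
have := vino_bound (10 * k) b; have -> : (k ^ 2 + k * (10 * k) = 11 * k ^ 2)%N.
  by rewrite -!mulnn; lia.
move/le_trans; apply; apply: ler_powR => //; rewrite natrM.
have k8' := kR8.
have he : eta (10 * k) <= kR ^+ 2 / 1024.
  rewrite /eta mulnC exprM.
  have H0 : 0 <= (1 - kR^-1) ^+ k.
    by rewrite exprn_ge0 // subr_ge0 invf_le1; lra.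
  have k0 : (0 < k)%N by apply: leq_trans k8.
  have H1 : ((1 - kR^-1) ^+ k) ^+ 10 <= (2^-1) ^+ 10.
    by rewrite lerXn2r ?nnegrE // one_sub_inv_pow_le.
  have h0 : 0 <= kR * (kR + 1) / 2 by rewrite divr_ge0 // mulr_ge0 //; lra.
  apply: le_trans (ler_wpM2l h0 H1) _; rewrite !exprS expr0.
  have : 0 <= kR * (kR - 8) by rewrite mulr_ge0 //; lra.
  lra.
apply: lerD.
  have : 0 <= kR ^+ 3 * (kR - 8) by rewrite mulr_ge0 // ?exprn_ge0 //; lra.
  have : 0 <= kR ^+ 3 by rewrite exprn_ge0.
  rewrite !exprS expr0; lra.
apply: ler_wpM2l => //; lra.
Qed.

End Vinogradov.

(** * Bilinear polynomial sums *)

Section Bilinear.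
Variables (R : realType) (q g k s b : nat) (N : 'I_k -> int).
Hypotheses (pq : prime q) (s0 : (0 < s)%N).
Let M := (q ^ g)%N.
Let P := (q ^ b)%N.
Local Notation psi := (@psi R M).

Let q0 : (0 < q)%N. Proof. exact: prime_gt0. Qed.
Let M0 : (0 < M)%N. Proof. by rewrite expn_gt0 q0. Qed.
Let P0 : (0 < P)%N. Proof. by rewrite expn_gt0 q0. Qed.

Local Notation Y := {ffun 'I_s -> 'I_P}.

Definition vdiff (p : Y * Y) : 'I_k -> int := fun j => vsum p.1 j - vsum p.2 j.

Definition polsum (th : 'I_k -> int) : R[i] :=
  \sum_(y < P) psi (\sum_j th j * y%:Z ^+ j.+1).

Lemma polsum_pow th :
  (cabs (polsum th) ^+ (2 * s))%:C = \sum_(p : Y * Y) psi (\sum_j th j * vdiff p j).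
Proof.
have E : polsum th ^+ s = \sum_(x : Y) psi (\sum_j th j * vsum x j).
  rewrite -[LHS]/(_ ^+ s) -[in LHS](card_ord s) -prodr_const bigA_distr_bigA.
  apply: eq_bigr => x _; rewrite -psi_sum; congr (psi _).
  by rewrite exchange_big /=; apply: eq_bigr => j _; rewrite /vsum mulr_sumr.
rewrite mulnC exprM -cabsX sqr_cabs E rmorph_sum big_distrlr /= pair_big.
apply: eq_bigr => p _; rewrite -psiN -psiD; congr (psi _).
by rewrite -sumrB; apply: eq_bigr => j _; rewrite /vdiff mulrBr.
Qed.

Definition bilsum : R :=
  \sum_(z < P) cabs (\sum_(y < P) psi (\sum_j N j * y%:Z ^+ j.+1 * z%:Z ^+ j.+1)).

(** Adding [off j] makes the differences of power sums nonnegative, so that difference vectors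
    become indices in a finite box with sides [2 * off j], inside the uniform cube of side [B]. *)
Let off (j : 'I_k) := (s * P ^ j.+1)%N.

Lemma vdiff_bounds p j : 0 <= vdiff p j + (off j)%:Z < (2 * off j)%N%:Z.
Proof.
have H (x : Y) : 0 <= vsum x j < (off j)%:Z.
  rewrite /vsum sumr_ge0 /=; last by move=> i _; rewrite exprn_ge0.
  apply: (@lt_le_trans _ _ (\sum_(i < s) (P ^ j.+1)%N%:Z)); last first.
    by rewrite sumr_const card_ord /off PoszM mulrC -[X in X <= _]mulr_natr natz.
  have Hi (i : 'I_s) : (x i)%:Z ^+ j.+1 < (P ^ j.+1)%N%:Z.
    by rewrite -Posz_expn ltz_nat ltn_exp2r.
  apply: ltr_sum; last by move=> i _; exact: Hi.
  by apply/hasP; exists (Ordinal s0); rewrite ?mem_index_enum.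
have /andP[a1 a2] := H p.1; have /andP[b1 b2] := H p.2.
by rewrite /vdiff; apply/andP; split; lia.
Qed.

Let B := (2 * s * P ^ k).+1.
Local Notation L := {ffun 'I_k -> 'I_B}.

Let inbox : pred L := family (fun j : 'I_k => [pred l : 'I_B | (l < 2 * off j)%N]).

Let off_B (j : 'I_k) n : (n < 2 * off j)%N -> (n < B)%N.
Proof.
move=> H; apply: leq_trans H _; rewrite /off /B mulnA; apply: leqW.
by rewrite leq_mul2l leq_pexp2l // orbT.
Qed.

Let Lam (p : Y * Y) : L := [ffun j => inord `|vdiff p j + (off j)%:Z|].

Let LamE p j : (Lam p j)%:Z = vdiff p j + (off j)%:Z.
Proof.
have /andP[h1 h2] := vdiff_bounds p j; rewrite ffunE inordK ?gez0_abs //.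
by rewrite -/B (off_B (j := j)) // -ltz_nat gez0_abs.
Qed.

Let Lam_box p : inbox (Lam p).
Proof.
apply/familyP => j; rewrite inE -ltz_nat LamE.
by have /andP[_ ->] := vdiff_bounds p j.
Qed.

Let mult (l : L) := #|[pred p | Lam p == l]|.

Let unoff (l : L) (j : 'I_k) : int := (l j)%:Z - (off j)%:Z.

Let unoffK p j : unoff (Lam p) j = vdiff p j.
Proof. by rewrite /unoff LamE addrK. Qed.

Let sum_Lam (F : L -> R) : \sum_p F (Lam p) = \sum_(l | inbox l) (mult l)%:R * F l.
Proof.
rewrite (partition_big Lam inbox) //=; apply: eq_bigr => l _.
rewrite (eq_bigr (fun=> F l)); last by move=> p /eqP ->.
by rewrite sumr_const -[LHS]mulr_natl.
Qed.

Let mult_le l : (mult l <= vino k s P)%N.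
Proof.
apply: leq_trans (card_vsum_shift s P (fun j => - unoff l j)).
rewrite /mult -cardsE; apply: subset_leq_card; apply/fintype.subsetP => p.
rewrite !inE => /eqP E; apply/forallP => j.
by rewrite -E unoffK /vdiff opprB addrC subrK.
Qed.

(** The sum of squares counts quadruples of blocks with equal difference vectors. Two blocks are
    free, and the other two then solve a shifted Vinogradov system. *)
Let mult_sq : \sum_(l | inbox l) (mult l)%:R ^+ 2 <= (P ^ (2 * s))%:R * (vino k s P)%:R :> R.
Proof.
rewrite (eq_bigr (fun l => (mult l)%:R * (mult l)%:R)) => [|l _]; last by rewrite expr2.
rewrite -(sum_Lam (fun l => (mult l)%:R)) -natr_sum -natrM ler_nat.
pose sw (u : (Y * Y) * (Y * Y)) := ((u.1.2, u.2.2), (u.1.1, u.2.1)).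
have swI : injective sw by move=> [[? ?] [? ?]] [[? ?] [? ?]] [-> -> -> ->].
have -> : (\sum_p mult (Lam p) = #|[set u : (Y * Y) * (Y * Y) | Lam u.2 == Lam u.1]|)%N.
  by rewrite (card_pairE (fun p p' => Lam p' == Lam p)).
rewrite -(card_imset _ swI).
pose Rl (u v : Y * Y) := [forall j : 'I_k, vsum v.2 j == vsum v.1 j + (vsum u.2 j - vsum u.1 j)].
apply: (@leq_trans #|[set u : (Y * Y) * (Y * Y) | Rl u.1 u.2]|).
  apply: subset_leq_card; apply/fintype.subsetP => u /imsetP[[[x x'] [u1 u2]] H ->].
  move: H; rewrite !inE /= => /eqP H; apply/forallP => j /=.
  have := congr1 (fun l => unoff l j) H; rewrite !unoffK /vdiff /= => H'.
  by apply/eqP; lia.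
rewrite card_pairE; apply: (@leq_trans (\sum_(u : Y * Y) vino k s P)%N).
  by apply: leq_sum => u _; rewrite -cardsE; apply: card_vsum_shift.
by rewrite sum_nat_const card_prod card_ffun !card_ord -expnD addnn mul2n.
Qed.

Let inner (j : 'I_k) (mu : int) : R := cabs (\sum_(l < 2 * off j) psi (N j * l%:Z * mu)).

Let Hj (j : 'I_k) : R := \sum_(l < 2 * off j) inner j (l%:Z - (off j)%:Z).

Let box_prod (S : comNzRingType) (F : 'I_k -> nat -> S) :
  \sum_(l | inbox l) \prod_j F j (l j) = \prod_j \sum_(l < 2 * off j) F j l.
Proof.
rewrite (eq_bigr (fun j => \sum_(l < B | (l < 2 * off j)%N) F j l)) => [|j _]; last first.
  apply: big_ord_widen; case E : (2 * off j)%N => [|n] //.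
  by apply: (@off_B j); rewrite E.
by rewrite (bigA_distr_big_dep (fun j => [pred l : 'I_B | (l < 2 * off j)%N])).
Qed.

Let dual (l : 'I_k -> int) : R[i] := polsum (fun j => N j * l j).

(** The sum over the whole box is opened first and factors over the degrees into geometric sums.
    Only then are the pairs of blocks grouped by their difference vector, each with multiplicity at
    most [vino k s P]. *)
Let dual_moment :
  \sum_(l | inbox l) cabs (dual (unoff l)) ^+ (2 * s) <= (vino k s P)%:R * \prod_j Hj j.
Proof.
have E : (\sum_(l | inbox l) cabs (dual (unoff l)) ^+ (2 * s))%:C =
   \sum_p \prod_j \sum_(l < 2 * off j) psi (N j * (l%:Z - (off j)%:Z) * vdiff p j).
  rewrite rmorph_sum /= (eq_bigr _ (fun l _ => polsum_pow _)) exchange_big /=.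
  apply: eq_bigr => p _.
  rewrite -(box_prod (fun j l => psi (N j * (l%:Z - (off j)%:Z) * vdiff p j))).
  by apply: eq_bigr => l _; rewrite psi_sum.
have E1 (j : 'I_k) (mu : int) :
    cabs (\sum_(l < 2 * off j) psi (N j * (l%:Z - (off j)%:Z) * mu)) = inner j mu.
  rewrite /inner (eq_bigr (fun l : 'I__ => psi (N j * l%:Z * mu) * psi (- (N j * (off j)%:Z * mu)))).
    by rewrite -mulr_suml cabsM cabs_psi mulr1.
  by move=> l _; rewrite -psiD; congr (psi _); ring.
have S0 : 0 <= \sum_(l | inbox l) cabs (dual (unoff l)) ^+ (2 * s).
  by apply: sumr_ge0 => l _; rewrite exprn_ge0 // cabs_ge0.
rewrite -(cabs_real S0) E; apply: le_trans (cabs_sum _ _ _) _.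
rewrite (eq_bigr (fun p => \prod_j inner j (unoff (Lam p) j))); last first.
  move=> p _; rewrite cabs_prod; apply: eq_bigr => j _; by rewrite E1 unoffK.
rewrite (sum_Lam (fun l => \prod_j inner j (unoff l j))).
apply: (@le_trans _ _ (\sum_(l | inbox l) (vino k s P)%:R * \prod_j inner j (unoff l j))).
  apply: ler_sum => l _; apply: ler_wpM2r; last by rewrite ler_nat mult_le.
  by apply: prodr_ge0 => j _; exact: cabs_ge0.
rewrite -mulr_sumr ler_wpM2l // /Hj /unoff.
by rewrite (box_prod (fun j l => inner j (l%:Z - (off j)%:Z))).
Qed.

(** Hölder twice, with exponent 2s in [z] and then 2s for the resulting sum over difference vectors.
    Each time a range of side [P] is replaced by a box of difference vectors, until both arguments
    of the bilinear form run over boxes and the geometric sums [Hj] appear. *)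
Lemma bilsum_bound_H :
  bilsum ^+ (4 * s ^ 2) <=
  (P ^ (8 * s ^ 2 - 4 * s))%:R * (vino k s P)%:R ^+ 2 * \prod_j Hj j.
Proof.
pose V : R := \sum_(p : Y * Y) cabs (dual (vdiff p)).
have V0 : 0 <= V by apply: sumr_ge0 => p _; exact: cabs_ge0.
have W0 : 0 <= bilsum by apply: sumr_ge0 => p _; exact: cabs_ge0.
have step1 : bilsum ^+ (2 * s) <= (P ^ (2 * s - 1))%:R * V.
  have e2s : (2 * s)%N = (2 * s - 1).+1 by rewrite subn1 prednK // muln_gt0.
  pose T (z : 'I_P) := polsum (fun j => N j * z%:Z ^+ j.+1).
  have -> : bilsum = \sum_z cabs (T z).
    apply: eq_bigr => z _; congr cabs; apply: eq_bigr => y _; congr (psi _).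
    by apply: eq_bigr => j _; rewrite mulrAC.
  rewrite {1}e2s; apply: le_trans (power_mean _ _) _; first by move=> *; exact: cabs_ge0.
  rewrite card_ord natrX; apply: ler_wpM2l; first by rewrite exprn_ge0.
  rewrite -e2s.
  have S0 : 0 <= \sum_z cabs (T z) ^+ (2 * s).
    by apply: sumr_ge0 => z _; rewrite exprn_ge0 // cabs_ge0.
  rewrite -(cabs_real S0) rmorph_sum /= (eq_bigr _ (fun z _ => polsum_pow _)) exchange_big /=.
  apply: le_trans (cabs_sum _ _ _) _; rewrite le_eqVlt; apply/orP; left; apply/eqP.
  apply: eq_bigr => p _; congr cabs; apply: eq_bigr => z _; congr (psi _).
  by apply: eq_bigr => j _; rewrite mulrAC.
have step2 : V ^+ s <= (P ^ (2 * s * (s - 1)))%:R * \sum_(p : Y * Y) cabs (dual (vdiff p)) ^+ s.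
  have es : s = (s - 1).+1 by rewrite subn1 prednK.
  rewrite {1}es; apply: le_trans (power_mean _ _) _; first by move=> *; exact: cabs_ge0.
  rewrite -es card_prod card_ffun !card_ord -expnD addnn -mul2n -natrX -expnM //.
(* Cauchy-Schwarz separates the multiplicities from the dual sums; each of the two factors brings
   one mean value. *)
have step3 : (\sum_(p : Y * Y) cabs (dual (vdiff p)) ^+ s) ^+ 2 <=
   (P ^ (2 * s))%:R * (vino k s P)%:R * ((vino k s P)%:R * \prod_j Hj j).
  have -> : \sum_(p : Y * Y) cabs (dual (vdiff p)) ^+ s =
      \sum_(l | inbox l) (mult l)%:R * cabs (dual (unoff l)) ^+ s.
    rewrite -(sum_Lam (fun l => cabs (dual (unoff l)) ^+ s)).
    by apply: eq_bigr => p _; congr (cabs (polsum _) ^+ s); apply/funext => j; rewrite unoffK.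
  apply: le_trans (cauchy_sum _ _ _) _; apply: ler_pM.
  - by apply: sumr_ge0 => l _; apply: sqr_ge0.
  - by apply: sumr_ge0 => l _; apply: sqr_ge0.
  - exact: mult_sq.
  apply: le_trans dual_moment; rewrite le_eqVlt; apply/orP; left; apply/eqP.
  by apply: eq_bigr => l _; rewrite -exprM mulnC.
have -> : bilsum ^+ (4 * s ^ 2) = (bilsum ^+ (2 * s)) ^+ (2 * s).
  by rewrite -exprM; congr (_ ^+ _); rewrite -mulnn; lia.
apply: (@le_trans _ _ (((P ^ (2 * s - 1))%:R * V) ^+ (2 * s))).
  rewrite lerXn2r ?nnegrE ?exprn_ge0 ?mulr_ge0 //.
have H0 : 0 <= \prod_j Hj j.
  by apply: prodr_ge0 => j _; apply: sumr_ge0 => l _; exact: cabs_ge0.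
have step4 : V ^+ (2 * s) <= (P ^ (4 * s * (s - 1)))%:R *
    ((P ^ (2 * s))%:R * (vino k s P)%:R * ((vino k s P)%:R * \prod_j Hj j)).
  rewrite [V ^+ _](_ : _ = (V ^+ s) ^+ 2); last by rewrite -exprM mulnC.
  apply: le_trans (_ : ((P ^ (2 * s * (s - 1)))%:R * \sum_(p : Y * Y) cabs (dual (vdiff p)) ^+ s) ^+ 2 <= _).
    rewrite lerXn2r ?nnegrE ?exprn_ge0 ?mulr_ge0 //.
    by apply: sumr_ge0 => p _; rewrite exprn_ge0 // cabs_ge0.
  rewrite exprMn -natrX -expnM.
  have -> : (2 * s * (s - 1) * 2 = 4 * s * (s - 1))%N by lia.
  exact: ler_wpM2l.
rewrite exprMn; apply: le_trans (ler_wpM2l _ step4) _; first by rewrite exprn_ge0.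
have nX e : (P ^ e)%:R = P%:R ^+ e :> R by exact: natrX.
rewrite !nX -exprM.
have -> : (8 * s ^ 2 - 4 * s = (2 * s - 1) * (2 * s) + (4 * s * (s - 1) + 2 * s))%N.
  by rewrite -mulnn; case: (s) s0 => // s' _; nia.
rewrite !(exprD P%:R) le_eqVlt; apply/orP; left; apply/eqP.
move: (\prod_j Hj j) ((vino k s P)%:R : R) (P%:R ^+ (2 * s) : R).
move: (P%:R ^+ ((2 * s - 1) * (2 * s)) : R) (P%:R ^+ (4 * s * (s - 1)) : R) => a1 a2 a3 a4 a5.
by ring.
Qed.

Let Hj_le j : Hj j <= (2 * off j)%:R ^+ 2.
Proof.
rewrite /Hj; apply: (@le_trans _ _ (\sum_(l < 2 * off j) (2 * off j)%:R)).
  apply: ler_sum => l _; apply: le_trans (cabs_sum _ _ _) _.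
  by rewrite (eq_bigr (fun=> 1)) ?sumr_const ?card_ord // => i' _; rewrite cabs_psi.
by rewrite sumr_const card_ord -[X in X <= _]mulr_natr expr2.
Qed.

(** The coefficient has exact denominator q^(g - v), which divides the length of the summation
    range. So the inner geometric sum is complete: it vanishes unless this power divides [mu], which
    holds for a proportion q^(v - g) of the values. *)
Let Hj_good j v u : N j = (q ^ v)%N%:Z * u -> ~~ (q%:Z %| u)%Z -> (v <= g)%N ->
  (g - v <= b * j.+1)%N -> Hj j * (q ^ (g - v))%:R <= (2 * off j)%:R ^+ 2.
Proof.
move=> Nj qu vg gb; set E := (q ^ (g - v))%N.
have E0 : (0 < E)%N by rewrite expn_gt0 q0.
have EO : (E %| off j)%N by rewrite /off dvdn_mull // -expnM dvdn_exp2l.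
have MN : M%:Z = (q ^ v)%N%:Z * E%:Z by rewrite -PoszM -expnD subnKC.
have qv : (q ^ v)%N%:Z != 0 by rewrite -lt0n expn_gt0 q0.
have cop : coprimez E%:Z u.
  rewrite /E Posz_expn coprimezXl // coprimezE /= prime_coprime //.
have innerE mu : inner j mu = if (E%:Z %| mu)%Z then (2 * off j)%:R else 0.
  rewrite /inner; set z := psi (N j * mu).
  have Ez (l : 'I_(2 * off j)) : psi (N j * l%:Z * mu) = z ^+ l.
    by rewrite /z -psiMn mulrAC.
  rewrite (eq_bigr _ (fun l _ => Ez l)).
  have dv : (M%:Z %| N j * mu)%Z = (E%:Z %| mu)%Z.
    by rewrite MN Nj -mulrA dvdz_mul2l // Gauss_dvdzr.
  case: ifP => H.
    rewrite (eq_bigr (fun=> 1)); last by move=> l _; rewrite /z psi_dvd ?dv // expr1n.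
    by rewrite sumr_const card_ord cabs_nat.
  suff -> : \sum_(l < 2 * off j) z ^+ l = 0 by rewrite cabs0.
  have : z != 1 by apply: psi_neq1 => //; rewrite dv H.
  rewrite -subr_eq0 => /mulfI; apply; rewrite mulr0 -subrX1 /z -psiMn psi_dvd ?subrr //.
  rewrite mulrAC dvdz_mulr // MN Nj -mulrA dvdz_mul2l // dvdz_mull //.
  by rewrite dvdzE /= dvdn_mull.
rewrite /Hj (eq_bigr _ (fun l _ => innerE _)) -big_mkcond /= sumr_const.
rewrite -[X in X * _]mulr_natr -mulrA expr2; apply: ler_wpM2l => //.
rewrite -natrM ler_nat.
have EO2 : (E %| 2 * off j)%N by rewrite dvdn_mull.
have lt (l : 'I_(2 * off j)) : (l %/ E < 2 * off j %/ E)%N.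
  by rewrite ltn_divLR // divnK.
pose f (l : 'I_(2 * off j)) := Ordinal (lt l).
have fI : {in [pred l : 'I_(2 * off j) | (E%:Z %| l%:Z - (off j)%:Z)%Z] &, injective f}.
  have cE (l : 'I_(2 * off j)) : (E%:Z %| l%:Z - (off j)%:Z)%Z -> (E %| l)%N.
    move=> H; have : (E%:Z %| (off j)%:Z)%Z by [].
    by move=> H2; have := rpredD H H2; rewrite subrK.
  move=> l l'; rewrite !inE => /cE H /cE H' /(congr1 val) /= e; apply: val_inj => /=.
  by rewrite -(divnK H) e divnK.
rewrite -leq_divRL //; have H1 := fintype.card_in_image fI.
apply: (@leq_trans #|[pred l : 'I_(2 * off j) | (E%:Z %| l%:Z - (off j)%:Z)%Z]|); first by [].
by rewrite -H1; apply: leq_trans (max_card _) _; rewrite card_ord.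
Qed.

(** Degrees outside [G] are bounded trivially; each degree in [G] gains the factor of [Hj_good]. *)
Lemma bilsum_bound (G : pred 'I_k) (v : 'I_k -> nat) (u : 'I_k -> int) :
  (forall j, G j -> [/\ N j = (q ^ v j)%N%:Z * u j, ~~ (q%:Z %| u j)%Z,
     (v j <= g)%N & (g - v j <= b * j.+1)%N]) ->
  bilsum ^+ (4 * s ^ 2) * (q ^ \sum_(j | G j) (g - v j))%:R <=
  (P ^ (8 * s ^ 2 - 4 * s))%:R * (vino k s P)%:R ^+ 2 *
    \prod_(j < k) (2 * s * P ^ j.+1)%:R ^+ 2.
Proof.
move=> HG; have c0 : 0 <= (P ^ (8 * s ^ 2 - 4 * s))%:R * (vino k s P)%:R ^+ 2 :> R.
  by rewrite mulr_ge0 // exprn_ge0.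
apply: le_trans (_ : (P ^ (8 * s ^ 2 - 4 * s))%:R * (vino k s P)%:R ^+ 2 * \prod_j Hj j * (q ^ \sum_(j | G j) (g - v j))%:R <= _).
  by apply: ler_wpM2r => //; exact: bilsum_bound_H.
rewrite -mulrA; apply: ler_wpM2l => //.
rewrite expn_sum natr_prod [X in _ * X <= _]big_mkcond -big_split /=; apply: ler_prod => j _.
have h0 : 0 <= Hj j by apply: sumr_ge0 => l _; exact: cabs_ge0.
rewrite -mulnA -/(off j); case: ifP => Gj; last by rewrite mulr1 h0 Hj_le.
have [h1 h2 h3 h4] := HG _ Gj.
by rewrite mulr_ge0 //= (Hj_good h1).
Qed.

End Bilinear.

(** * Sums over short intervals *)

Section Lifting.
Variable q : nat.
Hypotheses (pq : prime q) (q3 : (3 <= q)%N).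

Definition ord_val := logn q (2 ^ (q - 1) - 1).

(** Only the linear term of the binomial expansion matters modulo q^(r+2): for 1 < i < q the
    coefficient is divisible by q, and for i = q one has r q >= r + 2 because q >= 3. *)
Lemma lift_pow (r u : nat) : (0 < r)%N -> ~~ (q %| u)%N ->
  exists2 v, ((1 + q ^ r * u) ^ q = 1 + q ^ r.+1 * v)%N & ~~ (q %| v)%N.
Proof.
move=> r0 qu; have q0 : (0 < q)%N by exact: prime_gt0.
have : (q ^ r.+2 %| \sum_(2 <= i < q.+1) 'C(q, i) * (1 ^ (q - i) * (q ^ r * u) ^ i))%N.
  rewrite big_seq; apply: dvdn_sum => i; rewrite mem_index_iota => /andP[i2 iq].
  rewrite exp1n mul1n expnMn mulnA dvdn_mulr // -expnM.
  move: iq; rewrite ltnS leq_eqVlt => /orP[/eqP ->|iq].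
    by rewrite dvdn_mull // dvdn_exp2l //; nia.
  have i0 : (0 < i < q)%N by rewrite iq andbT; lia.
  case/dvdnP: (prime_dvd_bin pq i0) => c ->.
  by rewrite -mulnA dvdn_mull // -expnS dvdn_exp2l //; nia.
case/dvdnP=> c E; exists (u + q * c)%N; last by rewrite dvdn_addl // dvdn_mulr.
rewrite expnDn -(big_mkord predT (fun i => 'C(q, i) * (1 ^ (q - i) * (q ^ r * u) ^ i))%N).
rewrite big_ltn // big_ltn // E bin0 bin1 !exp1n !expn0 !expn1 !mul1n mulnDr.
by rewrite !expnS; nia.
Qed.

Lemma ord_val_spec : (0 < ord_val)%N /\
  exists2 u, (2 ^ (q - 1) = 1 + q ^ ord_val * u)%N & ~~ (q %| u)%N.
Proof.
have q0 : (0 < q)%N by exact: prime_gt0.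
have x0 : (0 < 2 ^ (q - 1) - 1)%N.
  by rewrite subn_gt0 -{1}(expn0 2) ltn_exp2l // subn_gt0; lia.
have dq : (q %| 2 ^ (q - 1) - 1)%N.
  have := fermat_little 2 pq => /eqP.
  rewrite eqn_mod_dvd; last by rewrite -{1}(expn1 2) leq_exp2l // ltnW // ltnW.
  have -> : (2 ^ q - 2 = 2 * (2 ^ (q - 1) - 1))%N.
    by rewrite mulnBr muln1 -expnS subn1 prednK.
  rewrite Gauss_dvdr // prime_coprime // gtnNdvd //.
split; first by rewrite /ord_val -pfactor_dvdn // expn1.
have [u cu E] := pfactor_coprime pq x0.
exists u; last by rewrite -prime_coprime.
by rewrite mulnC -/ord_val -E subnKC // expn_gt0.
Qed.

Lemma ord_val_lift r : (ord_val <= r)%N ->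
  exists2 u, (2 ^ ((q - 1) * q ^ (r - ord_val)) = 1 + q ^ r * u)%N & ~~ (q %| u)%N.
Proof.
have [e0 [u0 E0 qu0]] := ord_val_spec.
move=> er; rewrite -{2}(subnKC er); elim: (r - ord_val)%N => [|d [u E qu]].
  by exists u0; rewrite // expn0 muln1 addn0.
have rd0 : (0 < ord_val + d)%N by rewrite addn_gt0 e0.
have [v Ev qv] := lift_pow rd0 qu; exists v => //.
by rewrite expnS mulnCA mulnC expnM E Ev addnS.
Qed.

End Lifting.

(** * Powers of 1 + w as polynomials in the exponent *)

Section BinomialPolynomial.
Implicit Types (c j k : nat).

(* [binpoly c j] is the polynomial ['C(c X, j)], which has integer coefficients
   as soon as [j`!] divides [c]. *)
Definition binpoly c j : {poly int} :=
  if j is j'.+1 then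
    ((c %/ j`!)%N%:Z) *: ('X * \prod_(1 <= i < j) (c%:Z *: 'X - (i%:Z)%:P))
  else 1.

Lemma horner_binpoly c j (X : nat) : (j`! %| c)%N ->
  (binpoly c j).[X%:Z] = ('C(c * X, j))%N%:Z.
Proof.
move=> jc; have jz : (j`!)%:Z != 0 by rewrite -lt0n fact_gt0.
case: j jc jz => [|j] jc jz; first by rewrite /binpoly hornerC bin0.
apply: (mulIf jz); rewrite -[RHS]PoszM bin_ffact ffact_prod.
have prodE m : (\prod_(i < m) (c * X - i))%N%:Z = \prod_(i < m) (c%:Z * X%:Z - i%:Z).
  elim: m => [|m IH]; first by rewrite !big_ord0.
  rewrite !big_ord_recr /= PoszM IH.
  (* When c X < m, truncated and integer subtraction differ in the later factors, but both products
     contain the zero factor with index c X. *)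
  case: (leqP m (c * X)) => mc; first by rewrite -subzn // PoszM.
  rewrite [X in X * _ = _](_ : _ = 0) ?[X in _ = X * _](_ : _ = 0) ?mul0r //.
    by rewrite (bigD1 (Ordinal mc)) //= PoszM subrr mul0r.
  by rewrite (bigD1 (Ordinal mc)) //= PoszM subrr mul0r.
rewrite prodE big_ord_recl subr0 /= hornerZ hornerM hornerX horner_prod.
have -> : \prod_(1 <= i < j.+1) (c%:Z *: 'X - i%:Z%:P).[X%:Z] =
   \prod_(i < j) (c%:Z * X%:Z - (bump 0 i)%:Z).
  rewrite big_add1 big_mkord; apply: eq_bigr => i _.
  by rewrite hornerD hornerN hornerC hornerZ hornerX /bump leq0n add1n.
set Pi := \prod_(_ < _) _.
have cE : c%:Z = (c %/ j.+1`!)%N%:Z * (j.+1`!)%:Z by rewrite -PoszM divnK.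
rewrite [X in _ = X * _ * _]cE.
by move: Pi ((c %/ j.+1`!)%N%:Z) ((j.+1`!)%:Z) (X%:Z) => x1 x2 x3 x4; ring.
Qed.

Lemma binpoly_coef c j :
  (forall i, (j < i)%N -> (binpoly c j)`_i = 0) /\
  (binpoly c j)`_j = if j is j'.+1 then (c %/ j`! * c ^ j')%N%:Z else 1.
Proof.
case: j => [|j] /=.
  by split=> [[|i]|] //; rewrite coef1.
pose F m : {poly int} := 'X * \prod_(1 <= i < m.+1) (c%:Z *: 'X - (i%:Z)%:P).
have H m : (forall i, (m.+1 < i)%N -> (F m)`_i = 0) /\ (F m)`_m.+1 = (c ^ m)%N%:Z.
  elim: m => [|m [IH1 IH2]].
    rewrite /F big_geq // mulr1; split=> [i i1|]; last by rewrite coefX eqxx expn0.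
    by rewrite coefX gtn_eqF.
  have E : F m.+1 = c%:Z *: (F m * 'X) - m.+1%:Z *: F m.
    rewrite /F big_nat_recr //= mulrA mulrBr -scalerAr; congr (_ - _).
    by rewrite mulrC mul_polyC.
  split=> [i im|]; rewrite E coefB !coefZ coefMX.
    case: i im => // i im /=; rewrite IH1 // IH1 ?mulr0 ?subr0 //.
    exact: ltnW im.
  by rewrite /= IH2 IH1 // mulr0 subr0 expnS PoszM.
have [H1 H2] := H j; split=> [i ij|]; rewrite coefZ -/(F j).
  by rewrite H1 ?mulr0.
by rewrite H2 -PoszM.
Qed.

(** The binomial series of (1 + w)^(c X), truncated after w^k and read as a polynomial in X. *)
Definition powpoly c k (w : nat) : {poly int} :=
  \sum_(j < k.+1) (w%:Z ^+ j) *: binpoly c j.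

Lemma powpoly_horner k (w X M : nat) : (M %| w ^ k.+1)%N ->
  (M%:Z %| ((1 + w) ^ (k`! * X))%N%:Z - (powpoly k`! k w).[X%:Z])%Z.
Proof.
move=> Mw; set n := (k`! * X)%N.
(* The range is padded with vanishing binomial coefficients so that it can be cut at [k] whether or
   not n >= k. *)
have E : ((1 + w) ^ n)%N = (\sum_(j < (n + k).+1) 'C(n, j) * w ^ j)%N.
  rewrite expnDn; under eq_bigr => i _ do rewrite exp1n mul1n.
  rewrite -!(big_mkord predT (fun j => 'C(n, j) * w ^ j)%N).
  rewrite [RHS](@big_cat_nat _ _ _ n.+1) //=; last by rewrite ltnS leq_addr.
  have -> : (\sum_(n.+1 <= i < (n + k).+1) 'C(n, i) * w ^ i = 0)%N.
    by rewrite big_nat big1 // => j /andP[nj _]; rewrite bin_small // mul0n.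
  by rewrite addn0.
rewrite E -(big_mkord predT (fun j => 'C(n, j) * w ^ j)%N).
rewrite (@big_cat_nat _ _ _ k.+1) //=; last by rewrite ltnS leq_addl.
rewrite PoszD big_mkord.
have -> : (powpoly k`! k w).[X%:Z] = (\sum_(i < k.+1) 'C(n, i) * w ^ i)%N%:Z.
  rewrite /powpoly horner_sum (big_morph Posz PoszD (erefl _)); apply: eq_bigr => j _.
  rewrite hornerZ horner_binpoly; first by rewrite PoszM Posz_expn mulrC.
  by apply: dvdn_fact_fact; rewrite -ltnS.
rewrite [X in (_ %| X - _)%Z]addrC addrK dvdzE /= big_nat; apply: dvdn_sum => j /andP[kj _].
by rewrite dvdn_mull //; apply: dvdn_trans Mw _; apply: dvdn_exp2l.
Qed.

(** Terms of index below j + 1 have too small a degree, that of index j + 1 gives the main term, and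
    the later ones carry a further factor [w]. As [w] is divisible by q^r, the valuation of the
    coefficient can be read off the main term. *)
Lemma powpoly_coef k (w j : nat) : (j < k)%N ->
  (w%:Z ^+ j.+2 %| (powpoly k`! k w)`_j.+1 -
      w%:Z ^+ j.+1 * (k`! %/ j.+1`! * k`! ^ j)%N%:Z)%Z.
Proof.
move=> jk; rewrite /powpoly coef_sum.
have jk1 : (j.+1 < k.+1)%N by [].
have [_ Ej] := binpoly_coef k`! j.+1.
rewrite (bigD1 (Ordinal jk1)) //= coefZ Ej [X in (_ %| X - _)%Z]addrC addrK.
apply: rpred_sum => i ij; rewrite coefZ.
have [il|il|e] := ltngtP i j.+1.
- by have [Ei _] := binpoly_coef k`! i; rewrite Ei // mulr0 dvdz0.
- by rewrite dvdz_mulr // dvdz_exp2l.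
by case/eqP: ij; apply: val_inj.
Qed.

Lemma powpoly_coef_gt c k w i : (k < i)%N -> (powpoly c k w)`_i = 0.
Proof.
move=> ki; rewrite coef_sum big1 // => j _; have [Ej _] := binpoly_coef c j.
by rewrite coefZ Ej ?mulr0 // (leq_ltn_trans _ ki) // -ltnS.
Qed.

Lemma powpoly_coef0 c k w : (powpoly c k w)`_0 = 1.
Proof.
rewrite coef_sum big_ord_recl expr0 scale1r coef1 /= big1 ?addr0 // => j _.
by rewrite coefZ /binpoly /= coefZ coefXM !mulr0.
Qed.

End BinomialPolynomial.

Lemma int_pfactor (q m : nat) (x : int) : prime q -> ~~ ((q ^ m)%N%:Z %| x)%Z ->
  exists f d, [/\ (f < m)%N, x = (q ^ f)%N%:Z * d & ~~ (q%:Z %| d)%Z].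
Proof.
move=> pq nx; have x0 : (0 < `|x|)%N.
  by case: posnP nx => // /eqP; rewrite absz_eq0 => /eqP ->; rewrite dvdz0.
have [d cd E] := pfactor_coprime pq x0; set f := logn q `|x| in E.
have dx : ((q ^ f)%N%:Z %| x)%Z by rewrite dvdzE /= E dvdn_mull.
have qf : (0 < q ^ f)%N by rewrite expn_gt0 prime_gt0.
exists f, (divz x (q ^ f)%N); split.
- rewrite ltnNge; apply: contra nx => mf; rewrite dvdzE /= E dvdn_mull //.
  exact: dvdn_exp2l.
- by rewrite mulrC divzK.
rewrite dvdzE /=; have -> : `|divz x (q ^ f)%N|%N = d.
  apply/eqP; rewrite -(eqn_pmul2r qf) -E.
  by have := congr1 absz (divzK dx); rewrite abszM /= => ->.
by rewrite -prime_coprime.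
Qed.

Lemma sqr_le_pow3 k : (100 <= k)%N -> (2 * (11 * k ^ 2) <= 3 ^ k)%N.
Proof.
move=> k100; have k2 : (2 <= k)%N by apply: leq_trans k100.
apply: (@leq_trans (3 ^ 2 * (2 * (k - 2)) ^ 2)); first by rewrite -!mulnn; nia.
rewrite -[X in (_ <= 3 ^ X)%N](subnKC k2) expnD leq_mul2l four_sqr_le_pow3 ?orbT //.
by lia.
Qed.

Lemma sum_linear k r m :
  (\sum_(j < m) (k + r * j.+1) * 2 = 2 * (k * m) + r * (m * m.+1))%N.
Proof.
elim: m => [|m IH]; first by rewrite big_ord0; lia.
by rewrite big_ord_recr /= IH; nia.
Qed.

Lemma sqr_le_gain k : (100 <= k)%N -> (k ^ 2 <= 64 * (k %/ 8 * (k %/ 4 - 3)))%N.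
Proof.
move=> k100; rewrite -mulnn.
have h1 : (k - 7 <= 8 * (k %/ 8))%N by lia.
have h2 : (k - 15 <= 4 * (k %/ 4 - 3))%N by lia.
have := leq_mul h1 h2; have h3 : (k * k <= 2 * ((k - 7) * (k - 15)))%N by nia.
by nia.
Qed.

(** The terms r s^2 cancel, with s = 11 k^2, and so do all other main terms of order r k^2. There
    remain the excess r k^2 / 512 and the required saving 484 r k^2 / 6^6, together less than r k^2
    / 64 <= e. The terms without r fit into the 484 k^4 provided by the 1 in 1 - D. *)
Lemma gain_exponent (R : realType) (e r k D : R) :
  0 <= r -> 100 <= k -> r * k ^+ 2 <= 64 * e -> D * (6 ^+ 6 * k ^+ 2) = r ->
  r * (8 * (11 * k ^+ 2) ^+ 2 - 4 * (11 * k ^+ 2)) +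
  2 * (21 * k ^+ 4 + r * (22 * k ^+ 2 - k * (k + 1) / 2 + k ^+ 2 / 1024)) +
  (2 * k ^+ 2 + r * (k * (k + 1))) <=
  (2 * r + (1 - D)) * (4 * (11 * k ^+ 2) ^+ 2) + e.
Proof.
move=> r0 H100 H1 H2.
have f1 : 0 <= k ^+ 2 * (k - 100) by rewrite mulr_ge0 ?sqr_ge0 //; lra.
have f2 : 0 <= k ^+ 3 * (k - 100) by rewrite mulr_ge0 ?exprn_ge0 //; lra.
have f3 : 0 <= k ^+ 2 by exact: sqr_ge0.
have f4 : 0 <= k ^+ 3 by rewrite exprn_ge0 //; lra.
have H3 : D * (6 ^+ 6 * k ^+ 2) * k ^+ 2 = r * k ^+ 2 by rewrite H2.
have f5 : 0 <= r * k ^+ 2 by rewrite mulr_ge0.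
rewrite !exprS !expr0 in f1 f2 f3 f4 f5 H1 H3 *.
lra.
Qed.

(** Moving the window by one place exchanges two terms. *)
Lemma shift_sum (R : realType) (G : nat -> R[i]) (m L h : nat) :
  (forall i, cabs (G i) <= 1) ->
  cabs (\sum_(i < L) G (m + i)%N - \sum_(i < L) G (m + i + h)%N) <= (2 * h)%:R.
Proof.
move=> G1; elim: h => [|h IH].
  by under [X in _ - X]eq_bigr => i _ do rewrite addn0; rewrite subrr cabs0.
have E : \sum_(i < L) G (m + i + h.+1)%N =
   \sum_(i < L) G (m + i + h)%N + (G (m + L + h)%N - G (m + h)%N).
  elim: (L) => [|L' IHL]; first by rewrite !big_ord0 addn0 subrr addr0.
  by rewrite !big_ord_recr /= IHL -!addnA addSn !addnS; ring.
rewrite E opprD addrA; apply: le_trans (cabsB _ _) _.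
have -> : (2 * h.+1)%:R = (2 * h)%:R + 2 :> R by rewrite mulnS addnC natrD.
apply: lerD => //; apply: le_trans (cabsB _ _) _.
by have := G1 (m + L + h)%N; have := G1 (m + h)%N; lra.
Qed.

Lemma fact_le_pow3 k : (k`! <= 3 ^ (k ^ 2))%N.
Proof.
apply: (@leq_trans (k ^ k)).
  rewrite fact_prod big_add1 big_mkord -[X in (_ <= _ ^ X)%N](card_ord k) -prod_nat_const.
  by apply: leq_prod => i _.
by rewrite -mulnn expnM; case: k => // k; rewrite leq_exp2r // ltnW // ltn_expl.
Qed.

(** * The saving over an interval *)

Section ShortSums.
Variables (R : realType) (q g r k : nat) (a a' : int) (n n' : nat).
Hypotheses (pq : prime q) (q3 : (3 <= q)%N).
Hypotheses (er : (ord_val q < r)%N) (k100 : (100 <= k)%N) (kr : (4 * k ^ 2 <= r)%N).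
Hypotheses (gk : (r * (k - 1) < g)%N) (kg : (g <= r * k)%N).
Local Notation b := (q%:R : R).
Let P := (q ^ r)%N.
Let M := (q ^ g)%N.
Local Notation psi := (@psi R M).

(* Up to a factor independent of [m], the coefficient of degree [i] of the
   polynomial obtained by shifting [m] in [phase]. *)
Definition twist m i : int :=
  a * (2 ^ (m * n))%N%:Z * n%:Z ^+ i - a' * (2 ^ (m * n'))%N%:Z * n'%:Z ^+ i.

(** For a single phase this is coprimality to q. For a difference, eliminating one of the two
    exponentials from consecutive values leaves the factor n - n'. *)
Hypothesis twistP : forall m i, (0 < i)%N ->
  ~~ (((q ^ (r %/ 4).+1)%N%:Z %| twist m i)%Z && ((q ^ (r %/ 4).+1)%N%:Z %| twist m i.+1)%Z).

Definition phase m : R[i] :=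
  psi (a * (2 ^ (m * n))%N%:Z - a' * (2 ^ (m * n'))%N%:Z).

Definition step := (k`! * ((q - 1) * q ^ (r - ord_val q)))%N.

Let q0 : (0 < q)%N. Proof. exact: prime_gt0. Qed.
Let P0 : (0 < P)%N. Proof. by rewrite expn_gt0 q0. Qed.
Let M0 : (0 < M)%N. Proof. by rewrite expn_gt0 q0. Qed.

Let w := (2 ^ ((q - 1) * q ^ (r - ord_val q)) - 1)%N.

Let wE : exists2 u, w = (q ^ r * u)%N & ~~ (q %| u)%N.
Proof.
have [u E qu] := ord_val_lift pq q3 (ltnW er); exists u => //.
by rewrite /w E addKn.
Qed.

Let w1 : (1 + w = 2 ^ ((q - 1) * q ^ (r - ord_val q)))%N.
Proof. by rewrite /w subnKC // expn_gt0. Qed.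

Let B i : int := (powpoly k`! k w)`_i.

Let coef m (j : 'I_k) : int := B j.+1 * twist m j.+1.

Let powM (x X : nat) : (M%:Z %| (2 ^ (step * X))%N%:Z - \sum_(i < k.+1) B i * X%:Z ^+ i)%Z.
Proof.
have [u uE _] := wE.
have dw : (M %| w ^ k.+1)%N.
  by rewrite uE expnMn dvdn_mulr // /M -expnM dvdn_exp2l //; nia.
have := powpoly_horner X dw; rewrite w1 -expnM.
have -> : ((q - 1) * q ^ (r - ord_val q) * (k`! * X) = step * X)%N.
  by rewrite /step; move: k`! => f; lia.
rewrite (@horner_coef_wide _ k.+1) //.
by apply/leq_sizeP => i ki; apply: powpoly_coef_gt.
Qed.

Let phase_shift m (y z : nat) :
  phase (m + step * (y * z)) = phase m * psi (\sum_j coef m j * y%:Z ^+ j.+1 * z%:Z ^+ j.+1).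
Proof.
rewrite /phase -psiD; apply: (@psi_eq R M _ _ M0).
have E0 (x X : nat) : (2 ^ ((m + step * (y * z)) * x) = 2 ^ (m * x) * 2 ^ (step * (y * z * x)))%N.
  by rewrite -expnD; congr (_ ^ _)%N; rewrite mulnDl -!mulnA.
rewrite !E0 // !PoszM.
have H1 := powM 0 (y * z * n); have H2 := powM 0 (y * z * n').
have := rpredB (dvdz_mull (a * (2 ^ (m * n))%N%:Z) H1) (dvdz_mull (a' * (2 ^ (m * n'))%N%:Z) H2).
case/dvdzP=> t0 Ht0; apply/dvdzP; exists t0; rewrite -Ht0 {t0 Ht0}.
rewrite !mulrBr !big_ord_recl /= /B !powpoly_coef0 !expr0 !mulr1.
rewrite !mulrDr !mulr1 !mulrA.
set s3 := \sum_(_ < k) _; set s1 := \sum_(_ < k) _; set s2 := \sum_(_ < k) _.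
suff -> : s3 = a * (2 ^ (m * n))%N%:Z * s1 - a' * (2 ^ (m * n'))%N%:Z * s2.
  by ring.
rewrite /s1 /s2 /s3 !mulr_sumr -sumrB; apply: eq_bigr => j _.
rewrite /bump leq0n add1n /coef /twist -/(B _) !PoszM !exprMn.
by move: (B _) (y%:Z ^+ _) (z%:Z ^+ _) (n%:Z ^+ _) (n'%:Z ^+ _) => x1 x2 x3 x4 x5; ring.
Qed.

(** The power of [w] contributes exactly r (j + 1). The factorial factor contributes at most k^2 <=
    r / 4, the reason for requiring 4 k^2 <= r, and [twist] at most r / 4. The error term of
    [powpoly_coef] has an extra q^r and so cannot disturb this. *)
Let coef_val m (j : 'I_k) : ~~ ((q ^ (r %/ 4).+1)%N%:Z %| twist m j.+1)%Z ->
  exists v u, [/\ coef m j = (q ^ v)%N%:Z * u, ~~ (q%:Z %| u)%Z,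
     (r * j.+1 <= v)%N & (v <= r * j.+1 + r %/ 4 + r %/ 4)%N].
Proof.
move=> ht; have [f2 [d2 [f2e E2 qd2]]] := int_pfactor pq ht.
set kap := (k`! %/ j.+1`! * k`! ^ j)%N.
have kap0 : (0 < kap)%N.
  rewrite muln_gt0 expn_gt0 fact_gt0 /= andbT divn_gt0 ?fact_gt0 //.
  by apply: dvdn_leq; rewrite ?fact_gt0 // dvdn_fact_fact.
have [d1 cd1 E1] := pfactor_coprime pq kap0; set f1 := logn q kap in E1.
have f1le : (f1 <= k * k)%N.
  rewrite /f1; apply: (@leq_trans (logn q (k`! ^ j.+1))).
    apply: dvdn_leq_log => //; first by rewrite expn_gt0 fact_gt0.
    rewrite expnS dvdn_mul //; apply/dvdnP; exists j.+1`!; rewrite mulnC divnK //.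
    exact: dvdn_fact_fact.
  by rewrite lognX leq_mul // logn_fact_le.
have f1r : (f1 <= r %/ 4)%N by rewrite leq_divRL // (leq_trans _ kr) // -mulnn mulnC leq_mul2l f1le.
have f1r' : (f1 < r)%N.
  apply: leq_ltn_trans f1r _; apply: ltn_Pdiv => //; lia.
have [u uE qu] := wE.
have /dvdzP[t Et] := powpoly_coef w (ltn_ord j).
have EB : B j.+1 = (q ^ (r * j.+1 + f1))%N%:Z *
   (u%:Z ^+ j.+1 * d1%:Z + (q ^ (r - f1))%N%:Z * (u%:Z ^+ j.+2 * t)).
  rewrite -/kap -/(B _) in Et.
  have -> : B j.+1 = w%:Z ^+ j.+1 * kap%:Z + t * w%:Z ^+ j.+2 by rewrite -Et addrC subrK.
  rewrite uE (PoszM (q ^ r)%N u) !exprMn E1 (PoszM d1) -!Posz_expn.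
  have e1 : (q ^ (r * j.+1 + f1))%N%:Z = ((q ^ r) ^ j.+1)%N%:Z * (q ^ f1)%N%:Z.
    by rewrite -PoszM -expnM -expnD.
  have e2 : ((q ^ r) ^ j.+2)%N%:Z = ((q ^ r) ^ j.+1)%N%:Z * ((q ^ f1)%N%:Z * (q ^ (r - f1))%N%:Z).
    by rewrite -!PoszM -expnD subnKC 1?ltnW // -expnSr.
  rewrite e1 e2; ring.
exists (r * j.+1 + f1 + f2)%N.
exists ((u%:Z ^+ j.+1 * d1%:Z + (q ^ (r - f1))%N%:Z * (u%:Z ^+ j.+2 * t)) * d2).
split; last by rewrite -!addnA leq_add2l leq_add // -ltnS.
- have e3 : (q ^ (r * j.+1 + f1 + f2))%N%:Z = (q ^ (r * j.+1 + f1))%N%:Z * (q ^ f2)%N%:Z.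
    by rewrite -PoszM -expnD.
  rewrite /coef EB E2 e3; set X := _ + _ * (_ * t).
  by move: X ((q ^ (r * j.+1 + f1))%N%:Z) ((q ^ f2)%N%:Z) => x1 x2 x3; ring.
- rewrite dvdzE abszM /= Euclid_dvdM // negb_or; apply/andP; split; last by move: qd2; rewrite dvdzE.
  have H : (q%:Z %| (q ^ (r - f1))%N%:Z * (u%:Z ^+ j.+2 * t))%Z.
    rewrite dvdz_mulr // dvdzE /= dvdn_exp // subn_gt0 //.
  have -> : (q %| `|(u%:Z ^+ j.+1 * d1%:Z + (q ^ (r - f1))%N%:Z * (u%:Z ^+ j.+2 * t))%R|)%N =
     (q%:Z %| u%:Z ^+ j.+1 * d1%:Z + (q ^ (r - f1))%N%:Z * (u%:Z ^+ j.+2 * t))%Z by rewrite dvdzE.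
  rewrite rpredDr // dvdzE abszM abszX /= Euclid_dvdM // Euclid_dvdX // negb_or negb_and qu /=.
  by rewrite -prime_coprime.
by rewrite -addnA leq_addr.
Qed.

Let sel_lt (t : 'I_(k %/ 8)) (c : bool) : ((k + 1) %/ 2 + 2 * t - 1 + c < k)%N.
Proof. by have := ltn_ord t; case: c => /=; lia. Qed.

(* One element of each pair of consecutive indices is nondegenerate by [twistP];
   the indices stay near [k / 2] so that both [g - v j] and [v j] are large. *)
Let sel m (t : 'I_(k %/ 8)) : 'I_k :=
  Ordinal (sel_lt t ((q ^ (r %/ 4).+1)%N%:Z %| twist m ((k + 1) %/ 2 + 2 * t))%Z).

Let sel_inj m : injective (sel m).
Proof.
move=> t t' /(congr1 val) /=; set c := (X in (_ + nat_of_bool X)%N); set c' := (X in _ = (_ + nat_of_bool X)%N).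
by move=> H; apply: val_inj => /=; move: H; case: c; case: c' => /=; lia.
Qed.

Let sel_good m t : ~~ ((q ^ (r %/ 4).+1)%N%:Z %| twist m (sel m t).+1)%Z.
Proof.
rewrite /sel /=; set i := ((k + 1) %/ 2 + 2 * t)%N.
have i0 : (0 < i)%N by rewrite /i; lia.
have := twistP m i0; case: (boolP ((q ^ (r %/ 4).+1)%N%:Z %| twist m i)%Z) => H /=.
  by rewrite addn1 subn1 prednK.
by move=> _; rewrite addn0 subn1 prednK.
Qed.

(** For a selected degree i = j + 1 >= k / 2, the valuation is at least r i >= g / 2, whence g - v
    <= r i, the completeness condition of [Hj_good]. Since i is at most about 3k / 4, and v exceeds
    r i by at most r / 2, at least r (k / 4 - 3) of g remains. *)
Let gain m : exists (G : pred 'I_k) (v : 'I_k -> nat) (u : 'I_k -> int),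
  (forall j, G j -> [/\ coef m j = (q ^ v j)%N%:Z * u j, ~~ (q%:Z %| u j)%Z,
     (v j <= g)%N & (g - v j <= r * j.+1)%N]) /\
  (k %/ 8 * (r * (k %/ 4 - 3)) <= \sum_(j | G j) (g - v j))%N.
Proof.
pose G : pred 'I_k := fun j => j \in [set sel m t | t : 'I_(k %/ 8)].
have H (j : 'I_k) : exists vu : nat * int, G j ->
   [/\ coef m j = (q ^ vu.1)%N%:Z * vu.2, ~~ (q%:Z %| vu.2)%Z,
     (r * j.+1 <= vu.1)%N & (vu.1 <= r * j.+1 + r %/ 4 + r %/ 4)%N].
  case: (boolP (G j)) => [/imsetP[t _ ->]|_]; last by exists (0%N, 0).
  by have [v [u Hvu]] := coef_val (sel_good m t); exists (v, u).
have [f Hf] := fin_all_exists H.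
have jG (j : 'I_k) : G j -> (k <= 2 * j.+1)%N /\ (j.+1 <= (k + 1) %/ 2 + k %/ 4)%N.
  case/imsetP=> t _ ->; have := ltn_ord t; rewrite /sel /=.
  by case: (_ %| _)%Z => /=; lia.
have gv (j : 'I_k) : G j -> ((f j).1 <= g)%N /\ (r * (k %/ 4 - 3) <= g - (f j).1)%N.
  move=> Gj; have [_ _ _ h4] := Hf j Gj; have [_ jk] := jG j Gj.
  have h5 : (r * j.+1 <= r * ((k + 1) %/ 2 + k %/ 4))%N by rewrite leq_mul2l jk orbT.
  have h6 : (r * ((k + 1) %/ 2 + k %/ 4) + r * (k %/ 4 - 3) + r <= r * (k - 1))%N.
    by rewrite -!mulnDr -{2}(muln1 r) -mulnDr leq_mul2l; apply/orP; right; lia.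
  by split; lia.
exists G, (fun j => (f j).1), (fun j => (f j).2); split=> [j Gj|].
  have [h1 h2 h3 h4] := Hf j Gj; have [jk _] := jG j Gj.
  have [h5 _] := gv j Gj; split => //.
  rewrite leq_subLR; apply: leq_trans kg _.
  apply: (@leq_trans (r * (2 * j.+1))); first by rewrite leq_mul2l jk orbT.
  by rewrite mul2n -addnn mulnDr leq_add2r.
apply: (@leq_trans (\sum_(j | G j) r * (k %/ 4 - 3))).
  by rewrite sum_nat_const leq_mul2r /G card_imset ?card_ord ?leqnn ?orbT //; apply: sel_inj.
by apply: leq_sum => j Gj; have [] := gv j Gj.
Qed.

(** The spare factor q pays for the part of the mean value bound that is independent of r; 6^6 is a
    round number above what [gain_exponent] needs. *)
Definition short_gain : R := b `^ (1 - r%:R / (6 ^+ 6 * k%:R ^+ 2)).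

Let b1 : 1 <= b. Proof. by rewrite ler1n. Qed.
Let b0 : 0 < b. Proof. by rewrite ltr0n. Qed.

Let bilsum_le m : bilsum R q g r (coef m) <= (P ^ 2)%:R * short_gain.
Proof.
have [G [v [u [HG HE]]]] := gain m.
set s := (11 * k ^ 2)%N; have s0 : (0 < s)%N by rewrite muln_gt0 expn_gt0 (leq_trans _ k100).
have k8 : (8 <= k)%N by apply: leq_trans k100.
set kR : R := k%:R; have kR100 : 100 <= kR by rewrite (ler_nat R 100).
have sR : s%:R = 11 * kR ^+ 2 by rewrite /s natrM natrX.
have := bilsum_bound R pq s0 HG.
set W := bilsum R q g r (coef m); set E := \sum_(j | _) _ => HW.
have W0 : 0 <= W by apply: sumr_ge0 => z _; exact: cabs_ge0.
have t0 : 0 <= (P ^ 2)%:R * short_gain by rewrite mulr_ge0 // powR_ge0.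
have s4 : (0 < 4 * s ^ 2)%N by rewrite muln_gt0 expn_gt0 s0.
rewrite -(ler_pXn2r s4) ?nnegrE //.
have E0 : 0 < (q ^ E)%:R :> R by rewrite ltr0n expn_gt0 q0.
rewrite -(ler_pM2r E0); apply: le_trans HW _.
have Vb := vino_mean_value R pq q3 k8 r.
have Vb2 : (vino k s (q ^ r))%:R ^+ 2 <= b `^ (2 * (21 * kR ^+ 4 + r%:R * (22 * kR ^+ 2 - kR * (kR + 1) / 2 + kR ^+ 2 / 1024))).
  rewrite [2 * _]mulrC powRrM (powR_mulrn 2) ?powR_ge0 //.
  by rewrite lerXn2r ?nnegrE ?powR_ge0.
have Pb : \prod_(j < k) (2 * s * (q ^ r) ^ j.+1)%:R ^+ 2 <= b `^ (2 * kR ^+ 2 + r%:R * (kR * (kR + 1))).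
  have H2s : (2 * s <= q ^ k)%N.
    apply: (@leq_trans (3 ^ k)); first exact: sqr_le_pow3.
    by rewrite leq_exp2r // (leq_trans _ k8).
  have -> : 2 * kR ^+ 2 + r%:R * (kR * (kR + 1)) = (\sum_(j < k) (k + r * j.+1) * 2)%:R.
    by rewrite sum_linear natrD !natrM -[k.+1%:R]natr1 expr2.
  rewrite -(powR_nat R q) expn_sum natr_prod; apply: ler_prod => j _.
  rewrite exprn_ge0 //= -natrX ler_nat expnM leq_exp2r // expnD expnM.
  by rewrite leq_mul2r H2s orbT.
apply: (@le_trans _ _ (b `^ (r%:R * (8 * s%:R ^+ 2 - 4 * s%:R)) * b `^ (2 * (21 * kR ^+ 4 + r%:R * (22 * kR ^+ 2 - kR * (kR + 1) / 2 + kR ^+ 2 / 1024))) * b `^ (2 * kR ^+ 2 + r%:R * (kR * (kR + 1))))).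
  apply: ler_pM => //; first by apply: prodr_ge0 => j _; rewrite exprn_ge0.
  apply: ler_pM => //.
  rewrite -expnM (powR_nat R q); apply: ler_powR => //.
  rewrite natrM natrB ?natrM ?natrX //.
  by rewrite -mulnn mulnA leq_mul // (leq_trans _ (leq_pmulr 8 s0)).
have -> : ((P ^ 2)%:R * short_gain) ^+ (4 * s ^ 2) * (q ^ E)%:R =
   b `^ ((2 * r%:R + (1 - r%:R / (6 ^+ 6 * kR ^+ 2))) * (4 * s%:R ^+ 2) + E%:R).
  rewrite (powRqD pq) -(powR_nat R q E); congr (_ * _).
  rewrite powRrM (_ : 4 * s%:R ^+ 2 = (4 * s ^ 2)%:R); last by rewrite natrM natrX.
  rewrite (powR_mulrn (4 * s ^ 2)) ?powR_ge0 //; congr (_ ^+ _).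
  by rewrite (powRqD pq) -expnM (powR_nat R q) natrM [2 * _]mulrC.
rewrite -!(powRqD pq); apply: ler_powR => //.
have HE2 : r%:R * kR ^+ 2 <= 64 * E%:R.
  rewrite -[r%:R * kR ^+ 2](_ : (r * k ^ 2)%:R = _); last by rewrite natrM natrX.
  rewrite -[64 * _](_ : (64 * E)%:R = _); last by rewrite natrM.
  rewrite ler_nat; apply: leq_trans (leq_mul (leqnn 64) HE).
  rewrite [X in (_ <= _ * X)%N]mulnCA [X in (_ <= X)%N]mulnCA leq_mul2l.
  by rewrite sqr_le_gain ?orbT.
set D := r%:R / _; have HD : D * (6 ^+ 6 * kR ^+ 2) = r%:R.
  by rewrite /D divfK // gt_eqF // mulr_gt0 ?exprn_gt0 //; lra.
by rewrite sR; exact: gain_exponent.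
Qed.

(** One q^r each for k! and for the period, two for P^2, and a last q for the factor 2. *)
Let step_bound : (2 * (step * P ^ 2) <= q ^ (4 * r + 1))%N.
Proof.
have h1 : (k`! <= q ^ r)%N.
  apply: leq_trans (fact_le_pow3 k) _; apply: (@leq_trans (q ^ (k ^ 2))).
    by rewrite leq_exp2r // expn_gt0 (leq_trans _ k100).
  rewrite leq_exp2l ?prime_gt1 //; apply: leq_trans kr; exact: leq_pmull.
have h2 : ((q - 1) * q ^ (r - ord_val q) <= q ^ r)%N.
  have [e0 _] := ord_val_spec pq q3.
  apply: (@leq_trans (q * q ^ (r - ord_val q))); first by rewrite leq_mul2r leq_subr orbT.
  rewrite -expnS leq_exp2l ?prime_gt1 //; lia.
have -> : (4 * r + 1 = 1 + (r + r + r * 2))%N by lia.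
rewrite !expnD expn1 /P -expnM; apply: leq_mul; first exact: prime_gt1.
by rewrite leq_mul2r /step leq_mul ?orbT.
Qed.

(** The sum is averaged over the shifts step y z. As q divides [step], the periodic weight is
    unchanged and each point contributes a bilinear sum; replacing the sum by its shifts costs twice
    the largest shift. The weight serves to sieve out multiples of q. *)
Lemma short_sum (wgt : nat -> R[i]) (m L : nat) :
  (forall i, cabs (wgt i) <= 1) -> (forall i, wgt (i + q)%N = wgt i) ->
  cabs (\sum_(i < L) wgt (m + i)%N * phase (m + i)) <=
  L%:R * short_gain + (q ^ (4 * r + 1))%:R.
Proof.
move=> w_le wq; set S := \sum_(i < L) _.
have wqM i c : wgt (i + q * c)%N = wgt i.
  elim: c => [|c IH]; first by rewrite muln0 addn0.
  by rewrite mulnSr addnA wq.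
have qstep : (q %| step)%N.
  rewrite /step dvdn_mull // dvdn_mull // dvdn_exp // subn_gt0 //.
pose h (y z : 'I_P) := (step * (y * z))%N.
pose Sh (y z : 'I_P) := \sum_(i < L) wgt (m + i + h y z)%N * phase (m + i + h y z).
have Pn : (0 : R) < (P ^ 2)%:R by rewrite ltr0n expn_gt0 P0.
rewrite -(ler_pM2l Pn).
have E : (P ^ 2)%:R * cabs S = cabs (\sum_(z < P) \sum_(y < P) S).
  rewrite (eq_bigr (fun=> P%:R * S)) => [|z _]; last by rewrite sumr_const card_ord mulr_natl.
  by rewrite sumr_const card_ord -[(P%:R * S) *+ P]mulr_natl mulrA -natrM mulnn cabsM cabs_nat.
have E2 : \sum_(z < P) \sum_(y < P) S =
   \sum_(z < P) \sum_(y < P) (S - Sh y z) + \sum_(z < P) \sum_(y < P) Sh y z.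
  rewrite -big_split; apply: eq_bigr => z _; rewrite -big_split; apply: eq_bigr => y _.
  by rewrite /= subrK.
rewrite E E2; apply: le_trans (cabsD _ _) _; rewrite addrC mulrDr; apply: lerD.
  have -> : \sum_(z < P) \sum_(y < P) Sh y z =
    \sum_(i < L) (wgt (m + i)%N * phase (m + i)) *
       \sum_(z < P) \sum_(y < P) psi (\sum_j coef (m + i) j * y%:Z ^+ j.+1 * z%:Z ^+ j.+1).
    rewrite /Sh; under eq_bigr => z _ do rewrite exchange_big /=.
    rewrite exchange_big /=; apply: eq_bigr => i _; rewrite mulr_sumr; apply: eq_bigr => z _.
    rewrite mulr_sumr; apply: eq_bigr => y _; rewrite phase_shift mulrA; congr (_ * _ * _).
    by rewrite /h; case/dvdnP: qstep => c ->; rewrite -mulnA [(c * _)%N]mulnC -mulnA wqM.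
  apply: le_trans (cabs_sum _ _ _) _.
  apply: (@le_trans _ _ (\sum_(i < L) (P ^ 2)%:R * short_gain)); last first.
    by rewrite sumr_const card_ord -[X in X <= _]mulr_natl mulrCA.
  apply: ler_sum => i _; rewrite cabsM cabsM /phase cabs_psi mulr1.
  apply: le_trans (bilsum_le (m + i)).
  apply: le_trans (_ : 1 * cabs (\sum_(z < P) \sum_(y < P) psi (\sum_j coef (m + i) j * y%:Z ^+ j.+1 * z%:Z ^+ j.+1)) <= _).
    by apply: ler_wpM2r; rewrite ?cabs_ge0.
  by rewrite mul1r; exact: cabs_sum.
apply: le_trans (cabs_sum _ _ _) _.
apply: (@le_trans _ _ (\sum_(z < P) \sum_(y < P) (2 * (step * P ^ 2))%:R)).
  apply: ler_sum => z _; apply: le_trans (cabs_sum _ _ _) _; apply: ler_sum => y _.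
  apply: le_trans (shift_sum (G := fun i => wgt i * phase i) m L (h y z) _) _.
    by move=> i; rewrite cabsM /phase cabs_psi mulr1.
  rewrite ler_nat leq_mul2l leq_mul2l -mulnn; apply/orP; right; apply/orP; right.
  by apply: leq_mul; apply: ltnW.
rewrite (eq_bigr (fun=> P%:R * (2 * (step * P ^ 2))%:R)); last first.
  by move=> z _; rewrite sumr_const card_ord -[LHS]mulr_natl.
rewrite sumr_const card_ord -[X in X <= _]mulr_natl mulrA -natrM mulnn.
by rewrite ler_wpM2l // ler_nat step_bound.
Qed.

End ShortSums.

(** * Vaughan's identity *)

Section Mobius.

Definition mobius (n : nat) : int :=
  if all (fun p => logn p n == 1)%N (primes n) then (-1) ^+ size (primes n) else 0.

Lemma abs_mobius n : `|mobius n| <= 1.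
Proof. by rewrite /mobius; case: ifP; rewrite ?normr0 // normrX normrN1 expr1n. Qed.

Lemma mobius_prime_mul p d : prime p -> (0 < d)%N -> ~~ (p %| d)%N ->
  mobius (p * d) = - mobius d.
Proof.
move=> pp d0 pd; have p0 := prime_gt0 pp.
have pn : p \notin primes d by rewrite mem_primes pp d0.
have perm : perm_eq (primes (p * d)) (p :: primes d).
  apply: uniq_perm; rewrite ?primes_uniq //= ?pn ?primes_uniq // => x.
  by rewrite primesM // inE primes_prime // inE.
rewrite /mobius (perm_all _ perm) (perm_size perm) /=.
have -> : (logn p (p * d) == 1)%N.
  by rewrite lognM // logn_prime // eqxx add1n eqSS -leqn0 leqNgt logn_gt0.
have -> : all (fun r => logn r (p * d) == 1)%N (primes d) = all (fun r => logn r d == 1)%N (primes d).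
  apply: eq_in_all => r rd; rewrite lognM // logn_prime //.
  by case: (eqVneq r p) => // e; rewrite -e rd in pn.
by rewrite /=; case: all; rewrite ?oppr0 // exprS mulN1r.
Qed.

Lemma mobius_sq p d : prime p -> (0 < d)%N -> (p ^ 2 %| d)%N -> mobius d = 0.
Proof.
move=> pp d0; rewrite pfactor_dvdn // => h.
rewrite /mobius; case: ifP => // /allP /(_ p).
by rewrite -logn_gt0 (ltn_trans _ h) // => /(_ isT) /eqP e; rewrite e in h.
Qed.

Lemma divisors_coprime_part p a m : prime p -> (0 < m)%N -> ~~ (p %| m)%N ->
  perm_eq [seq d <- divisors (p ^ a * m) | ~~ (p %| d)%N] (divisors m).
Proof.
move=> pp m0 pm; have pa : (0 < p ^ a * m)%N by rewrite muln_gt0 expn_gt0 prime_gt0.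
apply: uniq_perm; rewrite ?filter_uniq ?divisors_uniq // => d.
rewrite mem_filter -!dvdn_divisors //; apply/andP/idP => [[pd]|dm].
  by rewrite Gauss_dvdr // coprime_sym coprimeXl // prime_coprime.
split; last by rewrite dvdn_mull.
by apply: contra pm => /dvdn_trans; apply.
Qed.

(** With p the least prime factor, divisors divisible by p^2 contribute nothing, and those exactly
    divisible by p cancel against those prime to p. *)
Lemma sum_mobius n : (0 < n)%N -> \sum_(d <- divisors n) mobius d = (n == 1)%N%:R.
Proof.
move=> n0; case: eqP => [->|n1]; first by rewrite big_seq1.
have n2 : (1 < n)%N by case: n n0 n1 => [|[|]].
set p := pdiv n; have pp : prime p by exact: pdiv_prime.
have [m cm E] := pfactor_coprime pp n0; set a := logn p n in E.
have a0 : (0 < a)%N by rewrite logn_gt0 mem_primes pp n0 pdiv_dvd.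
have m0 : (0 < m)%N by move: n0; rewrite E muln_gt0 => /andP[].
have pm : ~~ (p %| m)%N by rewrite -prime_coprime.
rewrite E mulnC (bigID (fun d => p %| d)%N) /= -[X in _ + X]big_filter.
rewrite (perm_big _ (divisors_coprime_part a pp m0 pm)) /=.
have q0 : (0 < p ^ a * m)%N by rewrite muln_gt0 expn_gt0 prime_gt0.
have -> : \sum_(d <- divisors (p ^ a * m) | (p %| d)%N) mobius d =
   \sum_(d <- [seq d <- divisors (p ^ a * m) | (p %| d) && ~~ (p ^ 2 %| d)]%N) mobius d.
  rewrite big_filter big_mkcondr /= [LHS]big_seq_cond [RHS]big_seq_cond.
  apply: eq_bigr => d /andP[dd pd]; case: ifP => // /negbT; rewrite negbK.
  by apply: mobius_sq => //; move: dd; rewrite -dvdn_divisors // => /dvdn_gt0 ->.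
have perm : perm_eq [seq d <- divisors (p ^ a * m) | (p %| d) && ~~ (p ^ 2 %| d)]%N
   [seq (p * d)%N | d <- divisors m].
  apply: uniq_perm; rewrite ?filter_uniq ?divisors_uniq //.
    rewrite map_inj_uniq ?divisors_uniq // => x y /eqP.
    by rewrite eqn_pmul2l ?prime_gt0 // => /eqP.
  move=> d; rewrite mem_filter -dvdn_divisors //; apply/andP/mapP.
    case=> /andP[/dvdnP[c ->]]; rewrite expnS expn1 mulnC dvdn_pmul2l ?prime_gt0 // => pc.
    rewrite -[a]prednK // expnS -mulnA dvdn_pmul2l ?prime_gt0 // => H.
    exists c => //; rewrite -dvdn_divisors //; move: H.
    by rewrite Gauss_dvdr // coprime_sym coprimeXl // prime_coprime.
  case=> c; rewrite -dvdn_divisors // => cm' ->; split.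
    rewrite dvdn_mulr //= expnS expn1 dvdn_pmul2l ?prime_gt0 //.
    by apply: contra pm => /dvdn_trans; apply.
  by rewrite dvdn_mul // -{1}(expn1 p) dvdn_exp2l.
rewrite (perm_big _ perm) big_map /= [X in X + _]big_seq.
rewrite (eq_bigr (fun d => - mobius d)) => [|d]; last first.
  rewrite -dvdn_divisors // => dm; apply: mobius_prime_mul => //; first exact: dvdn_gt0 dm.
  by apply: contra pm => /dvdn_trans; apply.
by rewrite -big_seq sumrN addNr.
Qed.

End Mobius.

(** * The von Mangoldt function *)

Section Mangoldt.
Variable R : realType.

Definition mangoldt (n : nat) : R :=
  if size (primes n) == 1%N then ln (pdiv n)%:R else 0.

Lemma mangoldt_prime p : prime p -> mangoldt p = ln p%:R.
Proof. by move=> pp; rewrite /mangoldt primes_prime //= pdiv_id. Qed.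

Lemma mangoldt_ge0 n : 0 <= mangoldt n.
Proof.
rewrite /mangoldt; case: ifP => // _; apply: ln_ge0.
by rewrite ler1n pdiv_gt0.
Qed.

Lemma primes1_pow n p : (size (primes n) == 1)%N -> p \in primes n -> n = (p ^ logn p n)%N.
Proof.
case: (posnP n) => [->//|n0]; case E : (primes n) => [|x [|]] //= _.
rewrite inE => /eqP ->; rewrite {1}(prod_prime_decomp n0) prime_decompE E /=.
by rewrite big_seq1.
Qed.

(** Induction on the part of n prime to its least prime factor p. The new divisors that count are p,
    ..., p^a, each with weight log p. *)
Lemma sum_mangoldt n : (0 < n)%N -> \sum_(d <- divisors n) mangoldt d = ln n%:R.
Proof.
elim/ltn_ind: n => n IH n0; have [n1|n1] := leqP n 1.
  have -> : n = 1%N by case: n n0 n1 {IH} => [|[|]].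
  by rewrite big_seq1 /mangoldt /= ln1.
set p := pdiv n; have pp : prime p by exact: pdiv_prime.
have [m cm E] := pfactor_coprime pp n0; set a := logn p n in E.
have a0 : (0 < a)%N by rewrite logn_gt0 mem_primes pp n0 pdiv_dvd.
have m0 : (0 < m)%N by move: n0; rewrite E muln_gt0 => /andP[].
have pm : ~~ (p %| m)%N by rewrite -prime_coprime.
have q0 : (0 < p ^ a * m)%N by rewrite muln_gt0 expn_gt0 prime_gt0.
have mn : (m < n)%N.
  by rewrite E ltn_Pmulr // -{1}(expn0 p) ltn_exp2l // prime_gt1.
rewrite {1}E mulnC (bigID (fun d => p %| d)%N) /= -[X in _ + X]big_filter.
rewrite (perm_big _ (divisors_coprime_part a pp m0 pm)) /= IH //.
have -> : \sum_(d <- divisors (p ^ a * m) | (p %| d)%N) mangoldt d =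
   \sum_(d <- [seq d <- divisors (p ^ a * m) | (p %| d) && (size (primes d) == 1)]%N) ln p%:R.
  rewrite big_filter big_mkcondr /= [LHS]big_seq_cond [RHS]big_seq_cond.
  apply: eq_bigr => d /andP[dd pd]; rewrite /mangoldt; case: ifP => // s1.
  have d0 : (0 < d)%N by move: dd; rewrite -dvdn_divisors // => /dvdn_gt0 ->.
  have pin : p \in primes d by rewrite mem_primes pp d0.
  have -> : pdiv d = p; last by [].
  have d1 : (1 < d)%N by apply: leq_trans (prime_gt1 pp) (dvdn_leq d0 pd).
  have : pdiv d \in primes d by rewrite mem_primes pdiv_prime // d0 pdiv_dvd.
  by move: s1 pin; case: (primes d) => [|x [|]] //= _; rewrite !inE => /eqP -> /eqP.
have perm : perm_eq [seq d <- divisors (p ^ a * m) | (p %| d) && (size (primes d) == 1)]%N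
   [seq (p ^ j.+1)%N | j <- iota 0 a].
  apply: uniq_perm; rewrite ?filter_uniq ?divisors_uniq //.
    rewrite map_inj_uniq ?iota_uniq // => x y /eqP.
    by rewrite eqn_exp2l ?prime_gt1 // => /eqP [].
  move=> d; rewrite mem_filter -dvdn_divisors //; apply/andP/mapP.
    case=> /andP[pd s1] dd; have d0 : (0 < d)%N by apply: dvdn_gt0 dd.
    have pin : p \in primes d by rewrite mem_primes pp d0.
    have Ed := primes1_pow s1 pin; have l0 : (0 < logn p d)%N by rewrite logn_gt0.
    exists (logn p d).-1; last by rewrite prednK.
    rewrite mem_iota add0n prednK //=.
    have : (logn p d <= logn p (p ^ a * m))%N by apply: dvdn_leq_log.
    have -> // : logn p (p ^ a * m) = a.
    by rewrite mulnC logn_Gauss ?pfactorK // prime_coprime.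
  case=> j; rewrite mem_iota add0n /= => ja ->; split.
    by rewrite primesX // primes_prime // dvdn_exp.
  by rewrite dvdn_mulr // dvdn_exp2l.
rewrite (perm_big _ perm) big_map -(subn0 a) -/(index_iota 0 a) big_const_nat subn0 iter_addr addr0.
have pR : 0 < p%:R :> R by rewrite ltr0n prime_gt0.
rewrite [X in _ = ln X%:R]E natrM natrX addrC lnM ?posrE ?ltr0n ?exprn_gt0 //.
by rewrite lnXn // addrC.
Qed.

Lemma mangoldt_le n : (0 < n)%N -> mangoldt n <= ln n%:R.
Proof.
move=> n0; rewrite -sum_mangoldt // (big_rem n) /=; last by rewrite -dvdn_divisors.
by rewrite lerDl sumr_ge0 // => d _; exact: mangoldt_ge0.
Qed.

End Mangoldt.

Section Vaughan.
Variable R : realType.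
Local Notation C := R[i].

Lemma sum_multiples (F : nat -> C) d N : (0 < d)%N ->
  \sum_(1 <= n < N.+1 | (d %| n)%N) F (n %/ d)%N = \sum_(1 <= m < (N %/ d).+1) F m.
Proof.
move=> d0; elim: N => [|N IH]; first by rewrite div0n !big_geq.
rewrite big_mkcond big_nat_recr //= -big_mkcond IH divnS //.
case: (boolP (d %| N.+1)%N) => dN /=; last by rewrite addr0.
by rewrite !add1n [RHS]big_nat_recr /=.
Qed.

Lemma sum_divisors (F : nat -> C) n N : (0 < n <= N)%N ->
  \sum_(d <- divisors n) F d = \sum_(1 <= d < N.+1 | (d %| n)%N) F d.
Proof.
case/andP=> n0 nN; rewrite -[RHS]big_filter; apply: perm_big.
apply: uniq_perm; rewrite ?filter_uniq ?divisors_uniq ?iota_uniq // => d.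
rewrite -dvdn_divisors // mem_filter mem_index_iota; case: (boolP (d %| n)%N) => //= dn.
by rewrite (dvdn_gt0 n0 dn) ltnS (leq_trans _ nN) // dvdn_leq.
Qed.

Lemma hyperbola (F : nat -> nat -> C) N :
  \sum_(1 <= n < N.+1) \sum_(d <- divisors n) F d (n %/ d)%N =
  \sum_(1 <= d < N.+1) \sum_(1 <= m < (N %/ d).+1) F d m.
Proof.
rewrite (eq_big_nat _ _ (F2 := fun n => \sum_(1 <= d < N.+1 | (d %| n)%N) F d (n %/ d)%N)); last first.
  by move=> n; rewrite ltnS => nN; rewrite (sum_divisors _ nN).
rewrite (exchange_big_dep predT) //=; apply: eq_big_nat => d /andP[d0 _].
exact: sum_multiples.
Qed.

Lemma sum_divisors_swap (G : nat -> nat -> C) n : (0 < n)%N ->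
  \sum_(d <- divisors n) \sum_(e <- divisors (n %/ d)) G d e =
  \sum_(e <- divisors n) \sum_(d <- divisors (n %/ e)) G d e.
Proof.
have H (G' : nat -> nat -> C) : (0 < n)%N ->
  \sum_(d <- divisors n) \sum_(e <- divisors (n %/ d)) G' d e =
  \sum_(1 <= d < n.+1) \sum_(1 <= e < n.+1 | (d * e %| n)%N) G' d e.
  move=> n0; have nn : (0 < n <= n)%N by rewrite n0 leqnn.
  rewrite (sum_divisors _ nn).
  rewrite big_mkcond; apply: eq_big_nat => d /andP[d0 dn].
  case: ifP => [dvd|/negbT ndvd]; last first.
    rewrite big1 // => e de; case/negP: ndvd; apply: dvdn_trans de; exact: dvdn_mulr.
  rewrite (@sum_divisors _ _ n); last by rewrite divn_gt0 // dvdn_leq // leq_div.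
  apply: eq_bigl => e; case/dvdnP: dvd => c ->; rewrite mulnK // mulnC dvdn_pmul2r //.
move=> n0; rewrite !H // (exchange_big_dep predT) //=; apply: eq_bigr => e _.
by apply: eq_bigl => d; rewrite mulnC.
Qed.

Variables (f : nat -> C) (U : nat).

Definition lam n : C := (mangoldt R n)%:C.
Definition mu n : C := (mobius n)%:~R.
Definition beta m : C := \sum_(e <- divisors m | (U < e)%N) lam e.

(** [beta] is the convolution of the truncated von Mangoldt function with 1, and convolution with
    the Möbius function undoes the latter. *)
Lemma mu_beta n : (0 < n)%N ->
  \sum_(d <- divisors n) mu d * beta (n %/ d)%N = if (U < n)%N then lam n else 0.
Proof.
move=> n0.
have -> : \sum_(d <- divisors n) mu d * beta (n %/ d)%N =
   \sum_(d <- divisors n) \sum_(e <- divisors (n %/ d)) (if (U < e)%N then mu d * lam e else 0).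
  by apply: eq_bigr => d _; rewrite mulr_sumr big_mkcond.
rewrite sum_divisors_swap //.
have E e : (e \in divisors n) -> \sum_(d <- divisors (n %/ e)) (if (U < e)%N then mu d * lam e else 0) =
   (if (U < n)%N && (e == n) then lam n else 0).
  rewrite -dvdn_divisors // => en; have e0 := dvdn_gt0 n0 en.
  have ne : (0 < n %/ e)%N by rewrite divn_gt0 // dvdn_leq.
  have -> : (e == n) = (n %/ e == 1)%N.
    by rewrite -[RHS](eqn_pmul2r e0) divnK // mul1n eq_sym.
  rewrite andbC; case: (boolP (U < e)%N) => Ue; last first.
    rewrite big1 //; case: eqP => //= H; case: ifP => // Un; case/negP: Ue.
    by have := divnK en; rewrite H mul1n => ->.
  rewrite -mulr_suml -rmorph_sum sum_mobius //.
  case: eqP => [H|_] /=; last by rewrite mul0r.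
  by have := divnK en; rewrite H mul1n => <-; rewrite Ue mul1r.
rewrite big_seq (eq_bigr _ E) -big_seq.
case: ifP => Un /=; last by rewrite big1.
rewrite (bigD1_seq n) ?divisors_uniq //=; last by rewrite -dvdn_divisors.
by rewrite eqxx big1 ?addr0 // => e /negbTE ->.
Qed.

Lemma beta_split m : (0 < m)%N ->
  beta m = (ln m%:R)%:C - \sum_(e <- divisors m | (e <= U)%N) lam e.
Proof.
move=> m0; rewrite -(sum_mangoldt R m0) rmorph_sum /= (bigID (fun e => e <= U)%N) /=.
by rewrite addrC addrK; apply: eq_bigl => e; rewrite ltnNge.
Qed.

(** In [mu_beta], small d are expanded by [beta_split], which gives smooth inner sums. For d > U
    both variables are large where it matters, since [beta] vanishes up to U. A single parameter
    cuts both variables. *)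
Lemma vaughan N :
  \sum_(1 <= n < N.+1 | (U < n)%N) lam n * f n =
    \sum_(1 <= d < N.+1 | (d <= U)%N) mu d * \sum_(1 <= m < (N %/ d).+1) (ln m%:R)%:C * f (d * m)%N
  - \sum_(1 <= d < N.+1 | (d <= U)%N) mu d * \sum_(1 <= e < (N %/ d).+1 | (e <= U)%N)
       lam e * \sum_(1 <= l < (N %/ d %/ e).+1) f (d * (e * l))%N
  + \sum_(1 <= d < N.+1 | ~~ (d <= U)%N) mu d * \sum_(1 <= m < (N %/ d).+1) beta m * f (d * m)%N.
Proof.
have -> : \sum_(1 <= n < N.+1 | (U < n)%N) lam n * f n =
   \sum_(1 <= n < N.+1) \sum_(d <- divisors n) mu d * (beta (n %/ d)%N * f (d * (n %/ d))%N).
  rewrite big_mkcond; apply: eq_big_nat => n /andP[n0 _].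
  rewrite (_ : (if _ then _ else _) = (if (U < n)%N then lam n else 0) * f n); last first.
    by case: ifP => // _; rewrite mul0r.
  rewrite -mu_beta // mulr_suml [LHS]big_seq [RHS]big_seq; apply: eq_bigr => d.
  by rewrite -dvdn_divisors // => dn; rewrite mulrA [(d * _)%N]mulnC divnK.
rewrite (hyperbola (fun d m => mu d * (beta m * f (d * m)%N))).
rewrite (bigID (fun d => d <= U)%N) /=; congr (_ + _); last first.
  by apply: eq_bigr => d _; rewrite mulr_sumr.
rewrite -sumrB; apply: eq_bigr => d _; rewrite -mulrBr -mulr_sumr; congr (_ * _).
rewrite (eq_big_nat _ _ (F2 := fun m => (ln m%:R)%:C * f (d * m)%N -
   \sum_(e <- divisors m) (if (e <= U)%N then lam e * f (d * (e * (m %/ e)))%N else 0))); last first.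
  move=> m /andP[m0 _]; rewrite beta_split // mulrBl mulr_suml big_mkcond; congr (_ - _).
  rewrite [LHS]big_seq [RHS]big_seq; apply: eq_bigr => e.
  rewrite -dvdn_divisors // => em; case: ifP => // _.
  by rewrite [(e * _)%N]mulnC divnK.
rewrite sumrB; congr (_ - _).
rewrite (hyperbola (fun e l => if (e <= U)%N then lam e * f (d * (e * l))%N else 0)).
rewrite [RHS]big_mkcond; apply: eq_bigr => e _; case: ifP => eU; last by rewrite big1.
by rewrite mulr_sumr.
Qed.

End Vaughan.

(** * Type I and type II sums *)

Section Abel.
Variable R : realType.

(** Partial summation by induction: the partial sum minus [w j] times the unweighted one is bounded
    by the total drop of [w] so far times [B]. *)
Lemma abel_decreasing (w : nat -> R) (c : nat -> R[i]) (B : R) K :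
  (forall m, (0 < m < K)%N -> w m.+1 <= w m) -> (0 < K)%N -> 0 <= w K ->
  (forall j, (j <= K)%N -> cabs (\sum_(1 <= m < j.+1) c m) <= B) ->
  cabs (\sum_(1 <= m < K.+1) (w m)%:C * c m) <= w 1%N * B.
Proof.
move=> wd K0 wK SB; pose S j := \sum_(1 <= m < j.+1) c m.
have H j : (0 < j <= K)%N ->
   cabs (\sum_(1 <= m < j.+1) (w m)%:C * c m - (w j)%:C * S j) <= (w 1%N - w j) * B.
  elim: j => [//|j IH] jK; case: (posnP j) => [->|j0].
    by rewrite /S !big_nat1 !subrr cabs0 mul0r.
  have jK' : (0 < j <= K)%N by rewrite j0 ltnW.
  rewrite big_nat_recr //= {1}/S [X in _ - _ * X]big_nat_recr //= -/(S j).
  have -> : \sum_(1 <= i < j.+1) (w i)%:C * c i + (w j.+1)%:C * c j.+1 - (w j.+1)%:C * (S j + c j.+1) =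
     (\sum_(1 <= i < j.+1) (w i)%:C * c i - (w j)%:C * S j) + (w j - w j.+1)%:C * S j.
    by rewrite rmorphB /=; ring.
  apply: le_trans (cabsD _ _) _.
  have -> : (w 1%N - w j.+1) * B = (w 1%N - w j) * B + (w j - w j.+1) * B by ring.
  apply: lerD; first exact: IH.
  have wj : 0 <= w j - w j.+1 by rewrite subr_ge0 wd // j0.
  rewrite cabsM cabs_real //; apply: ler_wpM2l => //; apply: SB.
  by case/andP: jK'.
have := H K; rewrite K0 leqnn => /(_ isT) HK.
rewrite -[X in cabs X](subrK ((w K)%:C * S K)); apply: le_trans (cabsD _ _) _.
have -> : w 1%N * B = (w 1%N - w K) * B + w K * B by ring.
apply: lerD => //; rewrite cabsM cabs_real //; apply: ler_wpM2l => //; exact: SB.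
Qed.

Lemma abel_increasing (w : nat -> R) (c : nat -> R[i]) (B : R) K :
  (forall m, (0 < m < K)%N -> w m <= w m.+1) -> 0 <= w 1%N -> 0 <= w K ->
  (forall j, (j <= K)%N -> cabs (\sum_(1 <= m < j.+1) c m) <= B) ->
  cabs (\sum_(1 <= m < K.+1) (w m)%:C * c m) <= 2 * w K * B.
Proof.
move=> wi w0 wK SB; have B0 : 0 <= B by apply: le_trans (cabs_ge0 _) (SB 0%N (leq0n K)).
case: (posnP K) => [K0|K0]; first by rewrite {1}K0 big_geq // cabs0 !mulr_ge0.
have -> : \sum_(1 <= m < K.+1) (w m)%:C * c m =
  (w K)%:C * \sum_(1 <= m < K.+1) c m - \sum_(1 <= m < K.+1) (w K - w m)%:C * c m.
  by rewrite mulr_sumr -sumrB; apply: eq_bigr => m _; rewrite rmorphB /=; ring.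
apply: le_trans (cabsB _ _) _; have -> : 2 * w K * B = w K * B + w K * B by ring.
apply: lerD.
  by rewrite cabsM cabs_real //; apply: ler_wpM2l => //; apply: SB.
apply: le_trans (abel_decreasing (w := fun m => w K - w m) (B := B) _ K0 _ SB) _.
- by move=> m mK; rewrite lerD2l lerN2 wi.
- by rewrite subrr.
by apply: ler_wpM2r => //; rewrite gerBl.
Qed.

Lemma ln_mono (x y : R) : 0 < x -> x <= y -> ln x <= ln y.
Proof. by move=> x0 xy; rewrite ler_ln ?posrE // (lt_le_trans x0). Qed.

Lemma harmonic_le N : \sum_(1 <= d < N.+1) d%:R^-1 <= 1 + ln N%:R :> R.
Proof.
elim: N => [|N IH]; first by rewrite big_geq // ln0 ?addr0.
rewrite big_nat_recr //=; case: (posnP N) => [->|N0].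
  by rewrite big_geq // add0r invr1 ln1 addr0.
apply: le_trans (lerD IH (lexx _)) _; rewrite -addrA lerD2l.
have NR : 0 < N%:R :> R by rewrite ltr0n.
have N1 : 0 < N.+1%:R :> R by rewrite ltr0n.
have Nx : N.+1%:R * N.+1%:R^-1 = 1 :> R by rewrite divff // gt_eqF.
have NN : N.+1%:R = N%:R + 1 :> R by rewrite natr1.
have xp : 0 < N.+1%:R^-1 :> R by rewrite invr_gt0.
have E : N%:R = N.+1%:R * (1 + - N.+1%:R^-1) :> R by rewrite mulrDr mulrN Nx; lra.
have y1 : 0 < 1 + - N.+1%:R^-1 :> R.
  by rewrite -(pmulr_rgt0 _ N1) -E.
have y2 : -1 < - N.+1%:R^-1 :> R by rewrite -subr_gt0 opprK addrC.
(* log(1 - x) <= -x at x = 1/(N+1) bounds the new summand by the increase of the logarithm. *)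
have H := le_ln1Dx y2.
have EL : ln N%:R = ln N.+1%:R + ln (1 + - N.+1%:R^-1) :> R by rewrite {1}E lnM ?posrE.
by rewrite EL -addrA gerDl -lerBrDr sub0r.
Qed.

End Abel.

Lemma block_expand (R : realType) (x y z i D e : R) :
  x * x * y * z <= x * x * y * (y * i + 1) ->
  x * (y ^+ 2 * (x * D + e) + x * (y * z)) <=
  (x * y) ^+ 2 * D + x * y * y * e + ((x * y) ^+ 2 * i + x * y * x).
Proof. lra. Qed.

Lemma count_le (R : realType) U n : \sum_(1 <= d < n.+1 | (d <= U)%N) (1 : R) <= U%:R.
Proof.
rewrite (eq_bigr (fun=> 1%:R)) // -natr_sum ler_nat sum1_count -size_filter.
apply: (@leq_trans (size (iota 1 U))); last by rewrite size_iota.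
apply: uniq_leq_size; first by rewrite filter_uniq // iota_uniq.
move=> d; rewrite mem_filter mem_index_iota mem_iota => /and3P[dU d0 _].
by rewrite d0 add1n ltnS.
Qed.

Section TypeSums.
Variables (R : realType) (q M : nat) (a : int) (N : nat) (X D err : R) (E U : nat).
Hypotheses (pq : prime q) (X1 : 1 <= X) (NX : N%:R <= X).
Hypotheses (D0 : 0 <= D) (err0 : 0 <= err) (E0 : (0 < E)%N) (U0 : (0 < U)%N).
Local Notation psi := (@psi R M).

(** Multiples of q are discarded because nondegeneracy of the phase needs exponents prime to q;
    among primes only p = q is lost. *)
Definition fexp (n : nat) : R[i] :=
  if (q %| n)%N then 0 else psi (a * (2 ^ n)%N%:Z).

Hypothesis linear_sum : forall d K, (0 < d)%N ->
  cabs (\sum_(1 <= l < K.+1) fexp (d * l)) <= K%:R * D + err.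

Hypothesis bilinear_sum : forall n n' m L, ~~ (q %| n)%N -> ~~ (q %| n')%N ->
  ~~ (E%:Z %| n%:Z - n'%:Z)%Z ->
  cabs (\sum_(i < L) psi (a * (2 ^ ((m + i) * n))%N%:Z - a * (2 ^ ((m + i) * n'))%N%:Z))
    <= L%:R * D + err.

Let lg : R := 1 + ln X.

Let lg1 : 1 <= lg. Proof. by rewrite lerDl ln_ge0. Qed.

Let ln_lg n : (0 < n <= N)%N -> 0 <= ln (n%:R : R) <= lg.
Proof.
case/andP=> n0 nN; rewrite ln_ge0 ?ler1n //=; apply: (@le_trans _ _ (ln X)); last by rewrite lerDr.
have nX : n%:R <= X by apply: le_trans NX; rewrite ler_nat.
by apply: ln_mono; rewrite // ltr0n.
Qed.

Let div_le d K : (0 < d)%N -> K%:R <= X -> (K %/ d)%:R <= X / d%:R.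
Proof.
move=> d0 KX; rewrite ler_pdivlMr ?ltr0n // -natrM; apply: le_trans KX.
by rewrite ler_nat leq_trunc_div.
Qed.

Let harmonic_lg n : (n <= N)%N -> \sum_(1 <= d < n.+1) d%:R^-1 <= lg.
Proof.
move=> nN; apply: le_trans (harmonic_le R n) _; rewrite lerD2l.
case: (posnP n) => [->|n0]; first by rewrite ln0 // ln_ge0.
apply: ln_mono; rewrite ?ltr0n //; apply: le_trans NX; by rewrite ler_nat.
Qed.

Let cabs_mu d : cabs (mu R d) <= 1.
Proof.
rewrite /mu; have := abs_mobius d; rewrite -(rmorph_int (@real_complex R)) => H.
apply/cabs_le; rewrite normc_def /= expr0n addr0 sqrtr_sqr lecR.
by rewrite -intr_norm -[1 in X in _ <= X]/((1 : int)%:~R) ler_int.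
Qed.

Let X0 : 0 <= X. Proof. exact: le_trans X1. Qed.

Let sum_weighted n (F : nat -> R) (b c : R) : (n <= N)%N -> 0 <= b -> 0 <= c ->
  (forall d, (0 < d <= n)%N -> (d <= U)%N -> F d <= b / d%:R + c) ->
  \sum_(1 <= d < n.+1 | (d <= U)%N) F d <= b * lg + U%:R * c.
Proof.
move=> nN b0 c0 HF.
apply: (@le_trans _ _ (\sum_(1 <= d < n.+1 | (d <= U)%N) (b / d%:R + c))).
  rewrite big_nat_cond [leRHS]big_nat_cond; apply: ler_sum => d /andP[/andP[d0 dn] dU].
  by apply: HF; rewrite // d0.
rewrite big_split /= -mulr_sumr; apply: lerD.
  apply: ler_wpM2l => //; apply: le_trans (harmonic_lg nN).
  by rewrite big_mkcond; apply: ler_sum => d _; case: ifP; rewrite ?invr_ge0.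
have -> : \sum_(1 <= d < n.+1 | (d <= U)%N) c = (\sum_(1 <= d < n.+1 | (d <= U)%N) 1) * c.
  by rewrite mulr_suml; apply: eq_bigr => d _; rewrite mul1r.
exact: (ler_wpM2r c0 (count_le R U n)).
Qed.

(** Partial summation removes the logarithm. The lengths N / d add up to X log X by the harmonic
    sum, and there are at most U error terms. *)
Lemma type_one_log :
  cabs (\sum_(1 <= d < N.+1 | (d <= U)%N) mu R d *
     \sum_(1 <= m < (N %/ d).+1) (ln m%:R)%:C * fexp (d * m)) <=
  2 * lg * (lg * X * D + U%:R * err).
Proof.
have lg0 : 0 <= lg by apply: le_trans lg1.
apply: le_trans (cabs_sum _ _ _) _.
have -> : 2 * lg * (lg * X * D + U%:R * err) = (2 * lg * (X * D)) * lg + U%:R * (2 * lg * err) by ring.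
apply: sum_weighted => //; try by rewrite !mulr_ge0.
move=> d /andP[d0 dN] dU; rewrite cabsM; apply: le_trans (ler_wpM2r (cabs_ge0 _) (cabs_mu d)) _.
rewrite mul1r; set K := (N %/ d)%N.
have KX : K%:R <= X / d%:R by apply: div_le.
have dR : 0 < d%:R :> R by rewrite ltr0n.
have r0 : 0 <= 2 * lg * (X * D) / d%:R + 2 * lg * err.
  by rewrite addr_ge0 ?divr_ge0 ?mulr_ge0.
case: (posnP K) => [->|K0]; first by rewrite big_geq // cabs0.
have KN : (0 < K <= N)%N by rewrite K0 leq_div.
have /andP[l0 l1] := ln_lg KN.
apply: le_trans (abel_increasing (w := fun m => ln m%:R) (B := K%:R * D + err) _ _ l0 _) _.
- by move=> m /andP[m0 _]; apply: ln_mono; rewrite ?ltr0n // ler_nat.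
- by rewrite ln1.
- move=> j jK; apply: le_trans (linear_sum j d0) _; rewrite lerD2r ler_wpM2r // ler_nat //.
have -> : 2 * lg * (X * D) / d%:R + 2 * lg * err = 2 * lg * (X / d%:R * D + err) by field; rewrite gt_eqF.
apply: ler_pM; rewrite ?mulr_ge0 ?addr_ge0 ?mulr_ge0 //.
  by rewrite ler_wpM2l.
by rewrite lerD2r ler_wpM2r.
Qed.

Lemma type_one_mangoldt :
  cabs (\sum_(1 <= d < N.+1 | (d <= U)%N) mu R d *
     \sum_(1 <= e < (N %/ d).+1 | (e <= U)%N) lam R e *
        \sum_(1 <= l < (N %/ d %/ e).+1) fexp (d * (e * l))) <=
  lg * (lg ^+ 2 * X * D + U%:R ^+ 2 * err).
Proof.
have lg0 : 0 <= lg by apply: le_trans lg1.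
apply: le_trans (cabs_sum _ _ _) _.
have -> : lg * (lg ^+ 2 * X * D + U%:R ^+ 2 * err) = (lg * (lg * (X * D))) * lg + U%:R * (lg * (U%:R * err)) by ring.
apply: sum_weighted => //; try by rewrite !mulr_ge0.
move=> d /andP[d0 dN] dU; rewrite cabsM; apply: le_trans (ler_wpM2r (cabs_ge0 _) (cabs_mu d)) _.
have dR : 0 < d%:R :> R by rewrite ltr0n.
rewrite mul1r; apply: le_trans (cabs_sum _ _ _) _.
have -> : lg * (lg * (X * D)) / d%:R + lg * (U%:R * err) = lg * (X / d%:R * D) * lg + U%:R * (lg * err).
  by field; rewrite gt_eqF.
apply: sum_weighted; try by rewrite ?leq_div // !mulr_ge0 // ?invr_ge0 // ltW.
move=> e /andP[e0 eN] eU; have eR : 0 < e%:R :> R by rewrite ltr0n.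
rewrite cabsM /lam cabs_real ?mangoldt_ge0 //.
have -> : lg * (X / d%:R * D) / e%:R + lg * err = lg * (X / d%:R / e%:R * D + err).
  by field; rewrite !gt_eqF.
apply: ler_pM; rewrite ?mangoldt_ge0 ?cabs_ge0 //.
  have eN2 : (0 < e <= N)%N by rewrite e0 (leq_trans eN) // leq_div.
  by apply: le_trans (mangoldt_le R e0) _; have /andP[] := ln_lg eN2.
rewrite (eq_bigr (fun l => fexp (d * e * l))); last by move=> l _; rewrite mulnA.
apply: le_trans (linear_sum _ _) _; first by rewrite muln_gt0 d0.
rewrite lerD2r ler_wpM2r // -divnMA; apply: le_trans (div_le (d := (d * e)%N) _ NX) _.
  by rewrite muln_gt0 d0.
by rewrite natrM invfM mulrA.
Qed.

Let beta_small m : (m <= U)%N -> beta R U m = 0.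
Proof.
move=> mU; rewrite /beta; case: (posnP m) => [->|m0]; first by rewrite big_mkcond big_seq1 ltnNge U0.
rewrite big_seq_cond big1 // => e /andP[]; rewrite -dvdn_divisors // => em Ue.
by have := leq_trans (leq_trans Ue (dvdn_leq m0 em)) mU; rewrite ltnn.
Qed.

Let beta_le m : (0 < m <= N)%N -> cabs (beta R U m) <= lg.
Proof.
move=> mN; have /andP[m0 _] := mN; have /andP[_ l1] := ln_lg mN.
apply: le_trans l1; rewrite -(sum_mangoldt R m0) /beta; apply: le_trans (cabs_sum _ _ _) _.
rewrite big_mkcond; apply: ler_sum => e _; rewrite /lam cabs_real ?mangoldt_ge0 //.
by case: ifP; rewrite ?mangoldt_ge0.
Qed.

(** * One dyadic block of the type II sum *)

Section Block.
Variable Mb : nat.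
Hypotheses (MU : (U <= Mb)%N).
Let Y := (N %/ Mb)%N.
Let Mb0 : (0 < Mb)%N. Proof. exact: leq_trans MU. Qed.
Let dd (i : 'I_Mb) := (Mb.+1 + i)%N.
Let be (j : 'I_Y) : R[i] := if (q %| j.+1)%N then 0 else beta R U j.+1.
Let g (i : 'I_Mb) : R[i] :=
  \sum_(j < Y | (dd i * j.+1 <= N)%N) be j * psi (a * (2 ^ (dd i * j.+1))%N%:Z).
Let inner (j j' : 'I_Y) : R[i] :=
  \sum_(i < Mb | (dd i * j.+1 <= N)%N && (dd i * j'.+1 <= N)%N)
     psi (a * (2 ^ (dd i * j.+1))%N%:Z - a * (2 ^ (dd i * j'.+1))%N%:Z).

Definition tail_sum d : R[i] := \sum_(1 <= m < (N %/ d).+1) beta R U m * fexp (d * m).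

Let tail_sum_le i : cabs (tail_sum (dd i)) <= cabs (g i).
Proof.
have d0 : (0 < dd i)%N by rewrite /dd addSn.
have dY : (N %/ dd i <= Y)%N.
  by rewrite leq_divRL //; apply: leq_trans (leq_trunc_div N (dd i)); rewrite leq_mul2l /dd addSnnS leq_addr orbT.
case: (boolP (q %| dd i)%N) => qd.
  rewrite /tail_sum big1 ?cabs0 ?cabs_ge0 // => m _.
  by rewrite /fexp dvdn_mulr // mulr0.
rewrite /tail_sum big_add1 /= big_mkord.
rewrite (big_ord_widen Y (fun m => beta R U m.+1 * fexp (dd i * m.+1))) //.
rewrite le_eqVlt; apply/orP; left; apply/eqP; congr cabs; apply: eq_big => [j|j _].
  by rewrite leq_divRL // mulnC.
by rewrite /be /fexp Euclid_dvdM // (negbTE qd) /=; case: ifP; rewrite ?mulr0 ?mul0r.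
Qed.

Let inner_triv j j' : cabs (inner j j') <= Mb%:R.
Proof.
apply: le_trans (cabs_sum _ _ _) _; rewrite big_mkcond.
rewrite -[X in X%:R](card_ord Mb) -sumr_const; apply: ler_sum => i _.
by case: ifP => _; rewrite ?cabs_psi.
Qed.

(** The two cut-offs amount to one condition on the larger of j + 1 and j' + 1, so [i] runs over an
    initial segment and [bilinear_sum] applies. *)
Let inner_good (j j' : 'I_Y) : ~~ (q %| j.+1)%N -> ~~ (q %| j'.+1)%N ->
  ~~ (E%:Z %| (j.+1)%:Z - (j'.+1)%:Z)%Z -> cabs (inner j j') <= Mb%:R * D + err.
Proof.
move=> h1 h2 h3; set mm := maxn j.+1 j'.+1.
have mm0 : (0 < mm)%N by rewrite leq_max.
set L := minn Mb (N %/ mm - Mb).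
have LM : (L <= Mb)%N by exact: geq_minl.
have -> : inner j j' = \sum_(i < L) psi (a * (2 ^ ((Mb.+1 + i) * j.+1))%N%:Z - a * (2 ^ ((Mb.+1 + i) * j'.+1))%N%:Z).
  rewrite (big_ord_widen Mb (fun i => psi (a * (2 ^ ((Mb.+1 + i) * j.+1))%N%:Z - a * (2 ^ ((Mb.+1 + i) * j'.+1))%N%:Z))) //.
  apply: eq_bigl => i; rewrite /L leq_min ltn_ord /= ltn_subRL -addSn -/(dd i).
  rewrite leq_divRL // /mm maxnMr geq_max //.
apply: le_trans (bilinear_sum _ _ h1 h2 h3) _.
by rewrite lerD2r ler_wpM2r // ler_nat.
Qed.

Let close (j j' : 'I_Y) : bool := (E%:Z %| (j.+1)%:Z - (j'.+1)%:Z)%Z.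

Let close_count j : (#|[pred j' | close j j']| <= (Y %/ E).+1)%N.
Proof.
have lt (j' : 'I_Y) : (j' %/ E < (Y %/ E).+1)%N.
  by rewrite ltnS leq_div2r // ltnW.
pose f (j' : 'I_Y) := Ordinal (lt j').
have fI : {in [pred j' | close j j'] &, injective f}.
  move=> j1 j2; rewrite !inE => c1 c2 /(congr1 val) /= e; apply: val_inj => /=.
  have : (E%:Z %| (j1 : nat)%:Z - (j2 : nat)%:Z)%Z.
    have := rpredB c2 c1.
    by have -> : (j.+1)%:Z - (j2.+1)%:Z - ((j.+1)%:Z - (j1.+1)%:Z) = (j1 : nat)%:Z - (j2 : nat)%:Z by lia.
  rewrite -eqz_mod_dvd !modz_nat => /eqP[e2].
  by rewrite (divn_eq j1 E) e e2 -divn_eq.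
rewrite -(fintype.card_in_image fI); apply: leq_trans (max_card _) _.
by rewrite card_ord.
Qed.

Let lg0 : 0 <= lg. Proof. exact: le_trans lg1. Qed.

Let be_le j : cabs (be j) <= lg.
Proof.
rewrite /be; case: ifP => _; first by rewrite cabs0.
apply: beta_le; rewrite /=; apply: leq_trans (ltn_ord j) _; exact: leq_div.
Qed.

Let term_le j j' : cabs (be j) * cabs (be j') * cabs (inner j j') <=
  lg ^+ 2 * (Mb%:R * D + err + (if close j j' then Mb%:R else 0)).
Proof.
have r0 : 0 <= Mb%:R * D + err by rewrite addr_ge0 ?mulr_ge0.
have R0 : 0 <= lg ^+ 2 * (Mb%:R * D + err + (if close j j' then Mb%:R else 0)).
  by rewrite mulr_ge0 ?sqr_ge0 // addr_ge0 //; case: ifP.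
case: (boolP (q %| j.+1)%N) => h1; first by rewrite {1}/be h1 cabs0 !mul0r.
case: (boolP (q %| j'.+1)%N) => h2; first by rewrite [be j']/be h2 cabs0 mulr0 mul0r.
apply: ler_pM; rewrite ?mulr_ge0 ?cabs_ge0 //.
  by rewrite expr2; apply: ler_pM; rewrite ?cabs_ge0.
case: (boolP (close j j')) => h3; last by rewrite addr0; apply: inner_good.
by apply: le_trans (inner_triv _ _) _; rewrite lerDr.
Qed.

(** The square is opened and the sum over d taken inside. Pairs not congruent modulo [E] save the
    factor [D]; the congruent ones are few and are bounded trivially. *)
Let second_moment : \sum_i cabs (g i) ^+ 2 <=
  lg ^+ 2 * (Y%:R ^+ 2 * (Mb%:R * D + err) + Mb%:R * (Y%:R * (Y %/ E).+1%:R)).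
Proof.
have S0 : 0 <= \sum_i cabs (g i) ^+ 2 by apply: sumr_ge0 => i _; exact: sqr_ge0.
have EQ : (\sum_i cabs (g i) ^+ 2)%:C = \sum_(j < Y) \sum_(j' < Y) be j * (be j')^*%C * inner j j'.
  rewrite rmorph_sum /=.
  transitivity (\sum_(i < Mb) \sum_(j < Y) \sum_(j' < Y)
     (if (dd i * j.+1 <= N)%N && (dd i * j'.+1 <= N)%N then
       be j * (be j')^*%C * psi (a * (2 ^ (dd i * j.+1))%N%:Z - a * (2 ^ (dd i * j'.+1))%N%:Z) else 0)).
    apply: eq_bigr => i _; rewrite sqr_cabs rmorph_sum big_distrlr.
    rewrite big_mkcond; apply: eq_bigr => j _; case: (dd i * j.+1 <= N)%N => /=; last first.
      by rewrite big1.
    rewrite big_mkcond; apply: eq_bigr => j' _; case: ifP => // _.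
    have cM (x y : R[i]) : (x * y)^*%C = x^*%C * y^*%C by exact: rmorphM.
    by rewrite cM -psiN mulrACA -psiD.
  rewrite exchange_big; apply: eq_bigr => j _; rewrite exchange_big; apply: eq_bigr => j' _.
  by rewrite /inner mulr_sumr [RHS]big_mkcond.
rewrite -(cabs_real S0) EQ; apply: le_trans (cabs_sum _ _ _) _.
apply: (@le_trans _ _ (\sum_(j < Y) \sum_(j' < Y) lg ^+ 2 * (Mb%:R * D + err + (if close j j' then Mb%:R else 0)))).
  apply: ler_sum => j _; apply: le_trans (cabs_sum _ _ _) _; apply: ler_sum => j' _.
  by rewrite !cabsM cabs_conj; apply: term_le.
have row j : \sum_(j' < Y) lg ^+ 2 * (Mb%:R * D + err + (if close j j' then Mb%:R else 0)) <=
   lg ^+ 2 * (Y%:R * (Mb%:R * D + err) + Mb%:R * (Y %/ E).+1%:R).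
  rewrite -mulr_sumr ler_wpM2l ?sqr_ge0 // big_split /= sumr_const card_ord.
  rewrite -[X in X + _]mulr_natl lerD2l -big_mkcond sumr_const -[X in X <= _]mulr_natr.
  by rewrite ler_wpM2l // ler_nat close_count.
apply: le_trans (ler_sum _ (fun j _ => row j)) _.
rewrite sumr_const card_ord -[X in X <= _]mulr_natl mulrCA ler_wpM2l ?sqr_ge0 //.
by rewrite le_eqVlt; apply/orP; left; apply/eqP; ring.
Qed.

Lemma block_sum :
  cabs (\sum_(i < Mb) mu R (Mb.+1 + i) * tail_sum (Mb.+1 + i)) ^+ 2 <=
  lg ^+ 2 * X ^+ 2 * (D + err / U%:R + E%:R^-1 + U%:R^-1).
Proof.
have UR : 0 < U%:R :> R by rewrite ltr0n.
have ER : 0 < E%:R :> R by rewrite ltr0n.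
have R0 : 0 <= lg ^+ 2 * X ^+ 2 * (D + err / U%:R + E%:R^-1 + U%:R^-1).
  by rewrite !mulr_ge0 ?sqr_ge0 // !addr_ge0 ?divr_ge0 ?invr_ge0 // ltW.
have Sg : cabs (\sum_(i < Mb) mu R (Mb.+1 + i) * tail_sum (Mb.+1 + i)) <= \sum_i cabs (g i).
  apply: le_trans (cabs_sum _ _ _) _; apply: ler_sum => i _; rewrite cabsM.
  apply: le_trans (ler_wpM2r (cabs_ge0 _) (cabs_mu _)) _; rewrite mul1r.
  exact: tail_sum_le.
(* [beta] vanishes up to U, so the block is zero unless Y > U. In that case, as Mb >= U and Mb Y <=
   X, both Y and Mb are at most X / U. *)
have [YU|UY] := leqP Y U.
  have g0 i : g i = 0.
    rewrite /g big1 // => j _; rewrite /be beta_small ?if_same ?mul0r //.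
    exact: leq_trans YU.
  have S0 : \sum_i cabs (g i) = 0 by rewrite big1 // => i _; rewrite g0 cabs0.
  rewrite S0 in Sg; have -> : cabs (\sum_(i < Mb) mu R (Mb.+1 + i) * tail_sum (Mb.+1 + i)) = 0.
    by apply/le_anti; rewrite Sg cabs_ge0.
  by rewrite expr0n.
apply: (@le_trans _ _ ((\sum_i cabs (g i)) ^+ 2)).
  by rewrite lerXn2r ?nnegrE ?cabs_ge0 // sumr_ge0 // => i _; exact: cabs_ge0.
apply: le_trans (power_mean (A := predT) 1 (fun i _ => cabs_ge0 (g i))) _.
rewrite card_ord expr1; apply: le_trans (ler_wpM2l _ second_moment) _ => //.
have H1 : Mb%:R * Y%:R <= X.
  by apply: le_trans NX; rewrite -natrM ler_nat mulnC leq_trunc_div.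
have YR : U%:R <= Y%:R :> R by rewrite ler_nat ltnW.
have MR : U%:R <= Mb%:R :> R by rewrite ler_nat.
have YE : (Y %/ E).+1%:R <= Y%:R / E%:R + 1 :> R.
  rewrite -natr1 lerD2r ler_pdivlMr // -natrM ler_nat leq_trunc_div //.
have YX : Y%:R <= X / U%:R.
  by rewrite ler_pdivlMr // mulrC; apply: le_trans H1; apply: ler_wpM2r.
have MX : Mb%:R <= X / U%:R.
  by rewrite ler_pdivlMr //; apply: le_trans H1; apply: ler_wpM2l.
have Y0 : 0 <= Y%:R :> R by []. have M0 : 0 <= Mb%:R :> R by [].
rewrite mulrCA -[leRHS]mulrA; apply: ler_wpM2l; first exact: sqr_ge0.
apply: (@le_trans _ _ ((Mb%:R * Y%:R) ^+ 2 * D + (Mb%:R * Y%:R) * Y%:R * err + ((Mb%:R * Y%:R) ^+ 2 / E%:R + (Mb%:R * Y%:R) * Mb%:R))).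
  have := ler_wpM2l (_ : 0 <= Mb%:R * Mb%:R * Y%:R) YE; rewrite !mulr_ge0 // => /(_ isT) H.
  exact: block_expand.
have MY0 : 0 <= Mb%:R * Y%:R :> R by rewrite mulr_ge0.
have sq : (Mb%:R * Y%:R) ^+ 2 <= X ^+ 2 :> R by rewrite lerXn2r ?nnegrE.
have -> : X ^+ 2 * (D + err / U%:R + E%:R^-1 + U%:R^-1) =
   X ^+ 2 * D + X * (X / U%:R) * err + (X ^+ 2 / E%:R + X * (X / U%:R)).
  by field; rewrite !gt_eqF.
apply: lerD; apply: lerD.
- exact: ler_wpM2r.
- by apply: ler_wpM2r => //; apply: ler_pM.
- by apply: ler_wpM2r => //; rewrite invr_ge0 ltW.
- exact: ler_pM.
Qed.

End Block.

(** Dyadic decomposition of (U, U 2^J]; the terms beyond N are zero, so the range may be enlarged to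
    a whole number of blocks. *)
Lemma type_two (B : R) J : 0 <= B -> (N <= U * 2 ^ J)%N ->
  lg ^+ 2 * X ^+ 2 * (D + err / U%:R + E%:R^-1 + U%:R^-1) <= B ^+ 2 ->
  cabs (\sum_(1 <= d < N.+1 | ~~ (d <= U)%N) mu R d * tail_sum d) <= J%:R * B.
Proof.
move=> B0 NJ HB; pose G d := mu R d * tail_sum d.
have G0 d : (N < d)%N -> G d = 0.
  by move=> Nd; rewrite /G /tail_sum divn_small // big_geq // mulr0.
have -> : \sum_(1 <= d < N.+1 | ~~ (d <= U)%N) mu R d * tail_sum d =
   \sum_(U.+1 <= d < (U * 2 ^ J).+1) G d.
  have UW : (U <= U * 2 ^ J)%N by rewrite leq_pmulr // expn_gt0.
  have E1 : \sum_(1 <= d < (U * 2 ^ J).+1 | ~~ (d <= U)%N) G d = \sum_(1 <= d < N.+1 | ~~ (d <= U)%N) G d.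
    rewrite (@big_cat_nat _ _ _ N.+1) //=.
    have -> : \sum_(N.+1 <= d < (U * 2 ^ J).+1 | ~~ (d <= U)%N) G d = 0; last by rewrite addr0.
    by rewrite big_nat_cond big1 // => d /andP[/andP[Nd _] _]; exact: G0.
  rewrite -/G -E1 (@big_cat_nat _ _ _ U.+1) //=.
  have -> : \sum_(1 <= d < U.+1 | ~~ (d <= U)%N) G d = 0.
    by rewrite big_nat_cond big1 // => d /andP[/andP[_ dU]]; rewrite -ltnS dU.
  rewrite add0r big_nat_cond [RHS]big_nat; apply: eq_bigl => d.
  by rewrite -ltnNge; case: (U < d)%N; rewrite ?andbT ?andbF.
elim: (J) => [|j IH]; first by rewrite expn0 muln1 big_geq // cabs0 mul0r.
have Uj : (U <= U * 2 ^ j)%N by rewrite leq_pmulr // expn_gt0.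
have Uj2 : (U * 2 ^ j.+1 = U * 2 ^ j + U * 2 ^ j)%N by rewrite expnS mulnCA mul2n addnn.
rewrite (@big_cat_nat _ _ _ (U * 2 ^ j).+1) //=; last by rewrite Uj2 ltnS leq_addr.
apply: le_trans (cabsD _ _) _; rewrite -natr1 mulrDl mul1r; apply: lerD => //.
rewrite -(ler_pXn2r (ltn0Sn 1)) ?nnegrE ?cabs_ge0 //; apply: le_trans HB.
have -> : \sum_((U * 2 ^ j).+1 <= d < (U * 2 ^ j.+1).+1) G d =
    \sum_(i < U * 2 ^ j) G ((U * 2 ^ j).+1 + i)%N.
  rewrite Uj2 -{1}[(U * 2 ^ j).+1]add0n big_addn subSS addnK big_mkord.
  by apply: eq_bigr => i _; rewrite addnC.
exact: block_sum.
Qed.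

End TypeSums.

(** * Sums over primes *)

Section PrimeSums.
Variables (R : realType) (q g r k : nat) (a : int).
Hypotheses (pq : prime q) (q3 : (3 <= q)%N) (aq : coprimez a q%:Z).
Hypotheses (er : (ord_val q < r)%N) (k100 : (100 <= k)%N) (kr : (4 * k ^ 2 <= r)%N).
Hypotheses (gk : (r * (k - 1) < g)%N) (kg : (g <= r * k)%N).
Variable X : R.
Hypotheses (X1 : 1 <= X) (qX : (q ^ (26 * r))%:R <= X).
Local Notation b := (q%:R : R).
Let M := (q ^ g)%N.
Let D : R := short_gain R q r k.
Let err : R := (q ^ (4 * r + 1))%:R.
Let E := (q ^ (r %/ 4).+1)%N.
(** Large against the error q^(4 r + 1) of a short sum, while U^2 times that error is q^(24 r + 1),
    still below X >= q^(26 r) by more than the saving. *)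
Let U := (q ^ (10 * r))%N.
Let x : R := r%:R / (6 ^+ 6 * k%:R ^+ 2).
(** Half the exponent saved in [short_gain]: the rest is lost in the Cauchy-Schwarz inequality for
    type II sums. *)
Definition saving : R := b `^ (1 - r%:R / (6 ^+ 6 * k%:R ^+ 2) / 2).
Local Notation f := (fexp R q M a).
Local Notation lg := (1 + ln X).

Let q0 : (0 < q)%N. Proof. exact: prime_gt0. Qed.
Let b1 : 1 <= b. Proof. by rewrite ler1n. Qed.
Let b0 : 0 < b. Proof. by rewrite ltr0n. Qed.
Let E0 : (0 < E)%N. Proof. by rewrite expn_gt0 q0. Qed.
Let U0 : (0 < U)%N. Proof. by rewrite expn_gt0 q0. Qed.
Let lg1 : 1 <= lg. Proof. by rewrite lerDl ln_ge0. Qed.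
Let X0 : 0 <= X. Proof. exact: le_trans X1. Qed.
Let D0 : 0 <= D. Proof. exact: powR_ge0. Qed.
Let err0 : 0 <= err. Proof. by []. Qed.

Let not_dvd_a : ~~ (q%:Z %| a)%Z.
Proof.
by rewrite dvdzE -prime_coprime // coprime_sym; move: aq; rewrite coprimezE.
Qed.

Let dvd_2 : (q %| 2)%N = false.
Proof. by rewrite gtnNdvd. Qed.

Let E_q : (q%:Z %| E%:Z)%Z. Proof. by rewrite dvdzE /= dvdn_exp. Qed.

(** [short_sum] with a' = 0 and the indicator of integers prime to q as weight; every [twist] is
    then prime to q. *)
Let linear_sum d K : (0 < d)%N ->
  cabs (\sum_(1 <= l < K.+1) f (d * l)%N) <= K%:R * D + err.
Proof.
move=> d0; have r0 : 0 <= K%:R * D + err by rewrite addr_ge0 ?mulr_ge0.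
case: (boolP (q %| d)%N) => qd.
  by rewrite big1 ?cabs0 // => l _; rewrite /fexp dvdn_mulr.
have tw m i : (0 < i)%N -> ~~ ((E%:Z %| twist a 0 d 0 m i)%Z && (E%:Z %| twist a 0 d 0 m i.+1)%Z).
  move=> i0; apply/negP => /andP[H _]; have := dvdz_trans E_q H.
  rewrite /twist !mul0r subr0 dvdzE !abszM abszX /= Euclid_dvdM // Euclid_dvdM // !Euclid_dvdX //.
  by rewrite dvd_2 (negbTE qd) /= !orbF; apply/negP; move: not_dvd_a; rewrite dvdzE.
have := short_sum (wgt := fun i => if (q %| i)%N then 0 else 1 : R[i]) pq q3 er k100 kr gk kg tw 1 K.
move=> H; apply: le_trans (H _ _); last first.
- by move=> i; rewrite dvdn_addl.
- by move=> i; case: ifP; rewrite ?cabs0 ?cabs1.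
rewrite big_add1 /= big_mkord le_eqVlt; apply/orP; left; apply/eqP; congr cabs.
apply: eq_bigr => i _; rewrite /fexp Euclid_dvdM // (negbTE qd) /= add1n /phase !mul0r subr0 mulnC.
by case: ifP; rewrite ?mul0r ?mul1r.
Qed.

Let bilinear_sum n n' m L : ~~ (q %| n)%N -> ~~ (q %| n')%N ->
  ~~ (E%:Z %| n%:Z - n'%:Z)%Z ->
  cabs (\sum_(i < L) psi R M (a * (2 ^ ((m + i) * n))%N%:Z - a * (2 ^ ((m + i) * n'))%N%:Z))
    <= L%:R * D + err.
Proof.
move=> qn qn' nn.
have tw m1 i : (0 < i)%N -> ~~ ((E%:Z %| twist a a n n' m1 i)%Z && (E%:Z %| twist a a n n' m1 i.+1)%Z).
  move=> i0; apply/negP => /andP[H1 H2]; case/negP: nn.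
  (* This combination cancels the second exponential. What is left is n - n' times a factor prime to
     q, so E would divide n - n'. *)
  have := rpredB H2 (dvdz_mull n'%:Z H1).
  have -> : twist a a n n' m1 i.+1 - n'%:Z * twist a a n n' m1 i =
     (a * (2 ^ (m1 * n))%N%:Z * n%:Z ^+ i) * (n%:Z - n'%:Z).
    by rewrite /twist !exprS; ring.
  rewrite Gauss_dvdzr // coprimezE /E /= coprimeXl // prime_coprime // !abszM abszX /=.
  rewrite Euclid_dvdM // Euclid_dvdM // !Euclid_dvdX // dvd_2 (negbTE qn) /= !orbF.
  by move: not_dvd_a; rewrite dvdzE.
have := short_sum (wgt := fun=> 1 : R[i]) pq q3 er k100 kr gk kg tw m L.
move=> H; apply: le_trans (H _ _) => //; last by move=> i; rewrite cabs1.
by rewrite le_eqVlt; apply/orP; left; apply/eqP; congr cabs; apply: eq_bigr => i _; rewrite mul1r.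
Qed.

Let x_ge0 : 0 <= x.
Proof. by rewrite divr_ge0 // mulr_ge0 // exprn_ge0. Qed.

Let x_le : x <= r%:R / 4.
Proof.
have k1 : 1 <= k%:R ^+ 2 :> R by rewrite exprn_ege1 // ler1n (leq_trans _ k100).
rewrite /x ler_pdivrMr; last by rewrite mulr_gt0 ?exprn_gt0 // ltr0n (leq_trans _ k100).
rewrite -mulrA ler_peMr // !exprS expr0; lra.
Qed.

Let savingE : saving = b `^ (1 - x / 2). Proof. by []. Qed.

Let saving_ge0 : 0 <= saving. Proof. exact: powR_ge0. Qed.

Let saving_sq : D + err / U%:R + E%:R^-1 + U%:R^-1 <= 4 * saving ^+ 2.
Proof.
have -> : saving ^+ 2 = b `^ (2 - x).
  by rewrite savingE expr2 -powRqD //; congr (_ `^ _); lra.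
have h1 : D <= b `^ (2 - x) by apply: ler_powR => //; rewrite -/x; lra.
have h2 : err / U%:R <= b `^ (2 - x).
  rewrite ler_pdivrMr ?ltr0n // /err /U !(powR_nat R q) -powRqD //; apply: ler_powR => //.
  rewrite natrD !natrM.
  have := x_le; have : 0 <= r%:R :> R by []. 
  have : 1 <= r%:R :> R by rewrite ler1n (leq_ltn_trans _ er).
  lra.
have h3 : E%:R^-1 <= b `^ (2 - x).
  rewrite -[leLHS]div1r ler_pdivrMr ?ltr0n // /E (powR_nat R q) -powRqD // -[leLHS](powRr0 b).
  apply: ler_powR => //; have : r%:R <= 4 * (r %/ 4).+1%:R :> R.
    by rewrite -natrM ler_nat mulnC ltnW // ltn_ceil.
  have := x_le; lra.
have h4 : U%:R^-1 <= b `^ (2 - x).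
  rewrite -[leLHS]div1r ler_pdivrMr ?ltr0n // /U (powR_nat R q) -powRqD // -[leLHS](powRr0 b).
  apply: ler_powR => //; rewrite natrM; have := x_le; have : 0 <= r%:R :> R by []. lra.
lra.
Qed.

Let D_le : D <= saving.
Proof. by apply: ler_powR => //; rewrite -/x; have := x_ge0; lra. Qed.

Let X_saving : U%:R ^+ 2 * err <= X * saving.
Proof.
apply: (@le_trans _ _ ((q ^ (26 * r))%:R * saving)); last exact: ler_wpM2r.
rewrite /U /err -natrX -expnM !(powR_nat R q) savingE -!powRqD //; apply: ler_powR => //.
rewrite natrD !natrM; have := x_le.
have : 1 <= r%:R :> R by rewrite ler1n (leq_ltn_trans _ er).
lra.
Qed.

Let log_count N : N%:R <= X -> exists2 J, (N <= 2 ^ J)%N & J%:R <= 4 * lg.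
Proof.
move=> NX; case: (posnP N) => [->|N0].
  by exists 0%N => //; have := lg1; lra.
exists (trunc_log 2 N).+1; first by have /andP[_ /ltnW] := trunc_log_bounds (isT : 1 < 2)%N N0.
have /andP[h _] := trunc_log_bounds (isT : 1 < 2)%N N0.
have l2 : 2^-1 <= ln 2 :> R.
  have := @le_ln1Dx R (- 2^-1) _; have -> : 1 + - 2^-1 = 2^-1 :> R by lra.
  rewrite lnV ?posrE // => H; have := H _; lra.
have H : (trunc_log 2 N)%:R * ln 2 <= ln X.
  rewrite mulr_natl -lnXn //; apply: ln_mono; first by rewrite exprn_gt0.
  by apply: le_trans NX; rewrite -natrX ler_nat.
rewrite -natr1; have t0 : 0 <= (trunc_log 2 N)%:R :> R by [].
have := lg1; nra.
Qed.

(** The constant is 4 + 2 + 8, from the two type I sums and the type II sum; all powers of the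
    logarithm are raised to the third. *)
Lemma mangoldt_tail N : N%:R <= X ->
  cabs (\sum_(1 <= n < N.+1 | (U < n)%N) lam R n * f n) <= 14 * (lg ^+ 3 * X * saving).
Proof.
move=> NX; rewrite (vaughan _ U).
have H1 := type_one_log U X1 NX D0 err0 linear_sum.
have H2 := type_one_mangoldt U X1 NX D0 err0 linear_sum.
have [J NJ JL] := log_count NX.
have lg0 : 0 <= lg by have := lg1; lra.
have B0 : 0 <= 2 * lg * X * saving by rewrite !mulr_ge0.
have HB : lg ^+ 2 * X ^+ 2 * (D + err / U%:R + E%:R^-1 + U%:R^-1) <= (2 * lg * X * saving) ^+ 2.
  have -> : (2 * lg * X * saving) ^+ 2 = lg ^+ 2 * X ^+ 2 * (4 * saving ^+ 2) by ring.
  by apply: ler_wpM2l => //; rewrite mulr_ge0 ?sqr_ge0.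
have NJ2 : (N <= U * 2 ^ J)%N by apply: leq_trans NJ _; rewrite leq_pmull.
have H3 := type_two pq X1 NX D0 err0 E0 U0 bilinear_sum B0 NJ2 HB.
apply: le_trans (cabsD _ _) _; apply: le_trans (lerD (cabsB _ _) H3) _.
apply: le_trans (lerD (lerD H1 H2) (lexx _)) _.
have U1 : 1 <= U%:R :> R by rewrite ler1n.
have Xs := X_saving; have Dl := D_le; have s0 := saving_ge0.
have XD : X * D <= X * saving by apply: ler_wpM2l.
have Ue : U%:R * err <= X * saving.
  by apply: le_trans Xs; apply: ler_wpM2r => //; rewrite expr2 ler_peMl.
have XS : 0 <= X * saving by rewrite mulr_ge0.
have L1 := lg1; move: L1 lg0 JL; move: (1 + ln X) => l L1 lg0 JL.
have e1 : lg ^+ 0 = 1 by [].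
have l2 : l <= l ^+ 2 by rewrite expr2 ler_peMl.
have l3 : l ^+ 2 <= l ^+ 3 by rewrite [l ^+ 3]exprS ler_peMl ?sqr_ge0.
have t1 : 2 * l * (l * X * D + U%:R * err) <= 4 * (l ^+ 3 * (X * saving)).
  apply: (@le_trans _ _ (2 * l * (l * (X * saving) + l * (X * saving)))).
    apply: ler_wpM2l; first by rewrite mulr_ge0.
    rewrite -mulrA; apply: lerD; first by apply: ler_wpM2l.
    by apply: le_trans Ue _; rewrite ler_peMl.
  have := ler_wpM2r XS l3; rewrite expr2; lra.
have t2 : l * (l ^+ 2 * X * D + U%:R ^+ 2 * err) <= 2 * (l ^+ 3 * (X * saving)).
  apply: (@le_trans _ _ (l * (l ^+ 2 * (X * saving) + l ^+ 2 * (X * saving)))).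
    apply: ler_wpM2l => //; rewrite -[l ^+ 2 * X * D]mulrA; apply: lerD.
      by apply: ler_wpM2l; rewrite ?sqr_ge0.
    by apply: le_trans Xs _; rewrite ler_peMl // (le_trans L1).
  by rewrite [l ^+ 3]exprS; lra.
have t3 : J%:R * (2 * l * X * saving) <= 8 * (l ^+ 3 * (X * saving)).
  apply: (@le_trans _ _ (4 * l * (2 * l * (X * saving)))).
    by rewrite -[2 * l * X * saving]mulrA; apply: ler_wpM2r => //; rewrite !mulr_ge0.
  have := ler_wpM2r XS l3; rewrite expr2; lra.
rewrite -[l ^+ 3 * X * saving]mulrA; lra.
Qed.

Let lg0 : 0 <= lg. Proof. by have := lg1; lra. Qed.

Let mangoldt_lg n : (0 < n)%N -> n%:R <= X -> mangoldt R n <= lg.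
Proof.
move=> n0 nX; apply: le_trans (mangoldt_le R n0) _.
apply: (@le_trans _ _ (ln X)); last by rewrite lerDr.
by apply: ln_mono; rewrite ?ltr0n.
Qed.

Let f_le n : cabs (f n) <= 1.
Proof. by rewrite /fexp; case: ifP; rewrite ?cabs0 ?cabs_psi. Qed.

Let lg3 : lg <= lg ^+ 3.
Proof.
by rewrite exprS ler_peMr // expr_ge1 // lg0.
Qed.

Let lg23 : lg ^+ 2 <= lg ^+ 3.
Proof. by rewrite [lg ^+ 3]exprS ler_peMl // sqr_ge0. Qed.

Lemma mangoldt_sum N : N%:R <= X ->
  cabs (\sum_(1 <= n < N.+1) lam R n * f n) <= 15 * (lg ^+ 3 * X * saving).
Proof.
move=> NX; rewrite (bigID (fun n => U < n)%N) /=; apply: le_trans (cabsD _ _) _.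
have -> : 15 * (lg ^+ 3 * X * saving) = 14 * (lg ^+ 3 * X * saving) + lg ^+ 3 * (X * saving) by ring.
apply: lerD; first exact: mangoldt_tail.
apply: le_trans (cabs_sum _ _ _) _.
apply: (@le_trans _ _ (\sum_(1 <= n < N.+1 | (n <= U)%N) lg)).
  rewrite big_nat_cond [leRHS]big_nat_cond.
  under eq_bigl => n do rewrite -leqNgt.
  apply: ler_sum => n /andP[/andP[n0 nN] _]; rewrite cabsM /lam cabs_real ?mangoldt_ge0 //.
  rewrite -[leRHS]mulr1; apply: ler_pM; rewrite ?mangoldt_ge0 ?cabs_ge0 //.
  by apply: mangoldt_lg => //; apply: le_trans NX; rewrite ler_nat -ltnS.
rewrite (eq_bigr (fun=> lg * 1)); last by move=> n _; rewrite mulr1.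
rewrite -mulr_sumr; apply: ler_pM => //.
  by apply: sumr_ge0.
apply: le_trans (count_le R U N) _.
apply: le_trans X_saving; rewrite -[leLHS]mulr1; apply: ler_pM => //.
  by rewrite expr2 ler_peMl // ler1n.
by rewrite ler1n expn_gt0 q0.
Qed.

(** A proper prime power n <= X has p^2 <= X, and q^(2 r) <= X then gives p <= X / q^r. The
    exponents are at most logarithmic, and a pair (p, exponent) determines n. *)
Let prime_powers N : N%:R <= X ->
  \sum_(1 <= n < N.+1 | ~~ prime n) mangoldt R n <= 10 * (lg ^+ 2 * (X * saving)).
Proof.
move=> NX; have [J NJ JL] := log_count NX.
have qr : 0 < (q ^ r)%:R :> R by rewrite ltr0n expn_gt0 q0.
pose s := Num.truncn (X / (q ^ r)%:R).
pose A := [pred n : 'I_N.+1 | [&& (0 < n)%N, ~~ prime n & size (primes n) == 1%N]].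
have HA (n : 'I_N.+1) : A n -> [/\ (pdiv n < s.+1)%N, (logn (pdiv n) n < J.+1)%N & n = (pdiv n ^ logn (pdiv n) n)%N :> nat].
  case/and3P=> n0 np s1.
  have n1 : (1 < n)%N by case: (val n) n0 s1 => [|[|]].
  have pp := pdiv_prime n1; set p := pdiv n in pp *.
  have pin : p \in primes n by rewrite mem_primes pp n0 pdiv_dvd.
  have En : n = (p ^ logn p n)%N :> nat := primes1_pow s1 pin.
  have j2 : (2 <= logn p n)%N.
    have : (0 < logn p n)%N by rewrite logn_gt0.
    rewrite leq_eqVlt => /orP[/eqP e|//]; case/negP: np.
    by rewrite En -e expn1.
  have nN : (n <= N)%N by rewrite -ltnS.
  split=> //; last first.
    rewrite ltnS -(leq_exp2l _ _ (isT : 1 < 2)%N); apply: leq_trans NJ; apply: leq_trans nN.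
    by rewrite {2}En leq_exp2r ?prime_gt1 // (leq_trans _ j2).
  rewrite ltnS /s truncn_ge_nat; last by rewrite divr_ge0 // ltW.
  rewrite ler_pdivlMr // -(ler_pXn2r (isT : 0 < 2)%N) ?nnegrE ?mulr_ge0 ?(ltW qr) //.
  rewrite exprMn expr2 [X ^+ 2]expr2 [_ ^+ 2]expr2; apply: ler_pM; rewrite ?mulr_ge0 ?(ltW qr) //.
    apply: le_trans NX; rewrite -natrM ler_nat; apply: leq_trans nN.
    by rewrite mulnn; have := leq_exp2l 2 (logn p n) (prime_gt1 pp); rewrite -En j2 => ->.
  apply: le_trans qX; rewrite -natrM -expnD ler_nat leq_exp2l ?prime_gt1 //.
  by rewrite addnn -mul2n leq_mul2r orbT.
have cA : (#|A| <= s.+1 * J.+1)%N.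
  pose h (n : 'I_N.+1) : 'I_s.+1 * 'I_J.+1 := (inord (pdiv n), inord (logn (pdiv n) n)).
  have hI : {in A &, injective h}.
    move=> n n' An An'; have [a1 a2 a3] := HA n An; have [b1' b2 b3] := HA n' An'.
    move=> e; apply: val_inj => /=; rewrite a3 b3.
    have := congr1 (fun u => val u.1) e; rewrite /= !inordK // => e1.
    by have := congr1 (fun u => val u.2) e; rewrite /= !inordK // e1 => ->.
  rewrite -(fintype.card_in_image hI); apply: leq_trans (max_card _) _.
  by rewrite card_prod !card_ord.
have -> : \sum_(1 <= n < N.+1 | ~~ prime n) mangoldt R n = \sum_(n < N.+1 | A n) mangoldt R n.
  rewrite -[RHS](big_mkord (fun n => [&& (0 < n)%N, ~~ prime n & size (primes n) == 1%N]) (mangoldt R)).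
  rewrite [RHS]big_ltn_cond //= [LHS]big_mkcond [RHS]big_mkcond /=.
  apply: eq_big_nat => n /andP[n0 _]; rewrite n0 /= /mangoldt.
  by case: (prime n) => //=; case: ifP.
apply: (@le_trans _ _ (\sum_(n < N.+1 | A n) lg)).
  apply: ler_sum => n /and3P[n0 _ _]; apply: mangoldt_lg => //; apply: le_trans NX.
  by rewrite ler_nat -ltnS.
rewrite sumr_const -[leLHS]mulr_natr.
have sle : s%:R <= X / (q ^ r)%:R by rewrite truncn_le // divr_ge0 // ltW.
have iq : (q ^ r)%:R^-1 <= saving.
  rewrite -[leLHS]div1r ler_pdivrMr // (powR_nat R q) savingE -powRqD // -[leLHS](powRr0 b).
  apply: ler_powR => //; have := x_le; have : 0 <= r%:R :> R by []. lra.
have Xq : 1 <= X / (q ^ r)%:R.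
  rewrite ler_pdivlMr // mul1r; apply: le_trans qX; rewrite ler_nat leq_exp2l ?prime_gt1 //.
  exact: leq_pmull.
have sX : s.+1%:R <= 2 * (X * saving).
  rewrite -natr1; have : X / (q ^ r)%:R <= X * saving by apply: ler_wpM2l.
  lra.
have Jl : J.+1%:R <= 5 * lg by rewrite -natr1; have := lg1; lra.
apply: (@le_trans _ _ (lg * (2 * (X * saving) * (5 * lg)))).
  apply: ler_wpM2l => //; apply: (@le_trans _ _ (s.+1 * J.+1)%:R); first by rewrite ler_nat.
  by rewrite natrM; apply: ler_pM.
by rewrite expr2; lra.
Qed.

Lemma log_prime_sum N : N%:R <= X ->
  cabs (\sum_(1 <= n < N.+1 | prime n) (ln n%:R)%:C * f n) <= 25 * (lg ^+ 3 * X * saving).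
Proof.
move=> NX.
have -> : \sum_(1 <= n < N.+1 | prime n) (ln n%:R)%:C * f n =
  \sum_(1 <= n < N.+1) lam R n * f n - \sum_(1 <= n < N.+1 | ~~ prime n) lam R n * f n.
  rewrite [X in _ = X - _](bigID prime) /= addrK; apply: eq_bigr => n pn.
  by rewrite /lam mangoldt_prime.
apply: le_trans (cabsB _ _) _.
have -> : 25 * (lg ^+ 3 * X * saving) = 15 * (lg ^+ 3 * X * saving) + 10 * (lg ^+ 3 * (X * saving)) by ring.
apply: lerD; first exact: mangoldt_sum.
apply: le_trans (cabs_sum _ _ _) _; apply: (@le_trans _ _ (\sum_(1 <= n < N.+1 | ~~ prime n) mangoldt R n)).
  apply: ler_sum => n _; rewrite cabsM /lam cabs_real ?mangoldt_ge0 //.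
  by rewrite ler_piMr ?mangoldt_ge0.
apply: le_trans (prime_powers NX) _; rewrite ler_wpM2l // ler_wpM2r // mulr_ge0 //.
Qed.

Lemma prime_sum N : N%:R <= X ->
  cabs (\sum_(1 <= n < N.+1 | prime n) f n) <= 50 * (lg ^+ 3 * X * saving).
Proof.
move=> NX; case: (posnP N) => [->|N0].
  by rewrite big_geq // cabs0 !mulr_ge0 // exprn_ge0.
(* The inverse logarithm, made positive and decreasing from n = 1 on; its first value 1 / log 2 <= 2
   doubles the constant 25. *)
pose w n : R := (ln (maxn n 2)%:R)^-1.
have l2 : 2^-1 <= ln 2 :> R.
  have := @le_ln1Dx R (- 2^-1) _; have -> : 1 + - 2^-1 = 2^-1 :> R by lra.
  rewrite lnV ?posrE // => H; have := H _; lra.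
have lm n : ln 2 <= ln (maxn n 2)%:R :> R.
  by apply: ln_mono => //; rewrite (ler_nat R 2) leq_maxr.
have lp n : 0 < ln (maxn n 2)%:R :> R by have := lm n; lra.
pose c n : R[i] := if prime n then (ln n%:R)%:C * f n else 0.
have -> : \sum_(1 <= n < N.+1 | prime n) f n = \sum_(1 <= n < N.+1) (w n)%:C * c n.
  rewrite big_mkcond; apply: eq_bigr => n _; rewrite /c; case: ifP => pn; last by rewrite mulr0.
  rewrite mulrA -rmorphM /w /= (maxn_idPl (prime_gt1 pn)) mulVf ?mul1r //.
  by rewrite gt_eqF //; have := lp n; rewrite (maxn_idPl (prime_gt1 pn)).
have := abel_decreasing (w := w) (c := c) (B := 25 * (lg ^+ 3 * X * saving)) (K := N) _ N0.
move=> H; apply: le_trans (H _ _ _) _.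
- move=> m _; rewrite lef_pV2 ?posrE //; apply: ln_mono; first by rewrite ltr0n leq_max orbT.
  by rewrite ler_nat geq_max !leq_max leqnSn !leqnn orbT.
- by rewrite invr_ge0 ltW.
- move=> j jN; rewrite /c -big_mkcond; apply: log_prime_sum; apply: le_trans NX.
  by rewrite ler_nat.
have w1 : w 1%N <= 2.
  by rewrite /w invf_ple ?posrE.
have T0 : 0 <= lg ^+ 3 * X * saving by rewrite !mulr_ge0 // exprn_ge0.
have := ler_wpM2r T0 w1; lra.
Qed.

End PrimeSums.

(** * Chebyshev's bound *)

Section Chebyshev.
Variable R : realType.

Lemma prod_primes_dvd (s : seq nat) x :
  uniq s -> all prime s -> all (fun p => p %| x)%N s -> (\prod_(p <- s) p %| x)%N.
Proof.
elim: s => [|p s IH] /=; first by rewrite big_nil dvd1n.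
move=> /andP[ps us] /andP[pp sp] /andP[px sx]; rewrite big_cons Gauss_dvd ?px ?IH //.
rewrite prime_coprime //; apply: contra ps => H.
have : has (fun y => p %| y)%N s.
  elim: s sp H {IH us sx} => [|y s IH] /=; first by rewrite big_nil dvdn1 => _ /eqP p1; rewrite p1 in pp.
  by move=> /andP[py sp]; rewrite big_cons Euclid_dvdM // => /orP[->//|/(IH sp) ->]; rewrite orbT.
case/hasP => y ys; rewrite dvdn_prime2 //; last exact: (allP sp).
by move/eqP->.
Qed.

Lemma bin_le_pow2 n m : ('C(n, m) <= 2 ^ n)%N.
Proof.
case: (leqP m n) => mn; last by rewrite bin_small.
have -> : (2 ^ n = \sum_(i < n.+1) 'C(n, i))%N.
  by rewrite -[2%N]/(1 + 1)%N expnDn; apply: eq_bigr => i _; rewrite !exp1n !muln1.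
by rewrite (bigD1 (Ordinal (mn : m < n.+1)%N)) //= leq_addr.
Qed.

(** The primes in (m, 2m] divide (2m)! but not m!, hence they all divide the central binomial
    coefficient. *)
Lemma prod_primes_dyadic m : (\prod_(m.+1 <= p < (2 * m).+1 | prime p) p <= 2 ^ (2 * m))%N.
Proof.
apply: leq_trans (bin_le_pow2 (2 * m) m); apply: dvdn_leq; first by rewrite bin_gt0 mul2n -addnn leq_addr.
rewrite -big_filter; apply: prod_primes_dvd.
- by rewrite filter_uniq // iota_uniq.
- exact: filter_all.
apply/allP => p; rewrite mem_filter mem_index_iota => /and3P[pp mp p2].
have : (p %| (2 * m)`!)%N by rewrite dvdn_fact // prime_gt0.
have m2 : (m <= 2 * m)%N by rewrite leq_pmull.
rewrite -(bin_fact m2) Euclid_dvdM // => /orP[//|].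
have -> : (2 * m - m = m)%N by rewrite mul2n -addnn addnK.
rewrite Euclid_dvdM // orbb => H; exfalso.
have : (0 < logn p m`!)%N by rewrite logn_gt0 mem_primes pp fact_gt0.
rewrite logn_fact // big1_seq // => i /andP[_]; rewrite mem_index_iota => /andP[i0 _].
by rewrite divn_small // (leq_trans mp) // -{1}(expn1 p) leq_exp2l // prime_gt1.
Qed.

Lemma primorial_pow2 j : (\prod_(1 <= p < (2 ^ j).+1 | prime p) p <= 2 ^ (2 ^ j.+1))%N.
Proof.
elim: j => [|j IH]; first by rewrite big_mkcond big_nat1.
rewrite (@big_cat_nat _ _ _ (2 ^ j).+1) //=; last by rewrite ltnS leq_exp2l.
rewrite [X in (_ <= _ ^ X)%N]expnS mul2n -addnn expnD leq_mul //.
by have := prod_primes_dyadic (2 ^ j); rewrite -expnS.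
Qed.

(** N is rounded up to a power of two, which is at most 2N, and [primorial_pow2] costs another
    factor 2. *)
Lemma sum_ln_primes N : (0 < N)%N -> \sum_(1 <= p < N.+1 | prime p) ln p%:R <= 4 * N%:R :> R.
Proof.
move=> N0; have /andP[h1 h2] := trunc_log_bounds (isT : 1 < 2)%N N0.
set j := (trunc_log 2 N).+1 in h2.
have ln2 : ln 2 <= 1 :> R.
  have := @le_ln1Dx R 1; have -> : 1 + 1 = 2 :> R by lra.
  by apply; lra.
have E n : \sum_(1 <= p < n.+1 | prime p) ln p%:R = ln (\prod_(1 <= p < n.+1 | prime p) p)%:R :> R.
  elim: n => [|n IH]; first by rewrite !big_geq // ln1.
  rewrite big_mkcond big_nat_recr // -big_mkcond /= IH [in RHS]big_mkcond big_nat_recr // -big_mkcond /=.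
  case: ifP => pn; last by rewrite addr0 muln1.
  rewrite natrM lnM ?posrE ?ltr0n //; apply: prodn_cond_gt0 => p; exact: prime_gt0.
apply: (@le_trans _ _ (\sum_(1 <= p < (2 ^ j).+1 | prime p) ln p%:R)).
  rewrite [leRHS](@big_cat_nat _ _ _ N.+1) //=; last by rewrite ltnS ltnW.
  rewrite lerDl; apply: sumr_ge0 => p pp; apply: ln_ge0; by rewrite ler1n prime_gt0.
rewrite E; apply: (@le_trans _ _ (ln (2 ^ (2 ^ j.+1))%:R)).
  apply: ln_mono; last by rewrite ler_nat primorial_pow2.
  by rewrite ltr0n; apply: prodn_cond_gt0 => p; exact: prime_gt0.
rewrite natrX lnXn // -[leLHS]mulr_natl; apply: (@le_trans _ _ ((2 ^ j.+1)%:R * 1)).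
  exact: ler_wpM2l.
rewrite mulr1 -natrM ler_nat /j !expnS; lia.
Qed.

(** Up to the square root of N the trivial count suffices, as log N <= 2 sqrt N; beyond it log N <=
    2 log p. *)
Lemma prime_count_le N : (0 < N)%N ->
  (\sum_(1 <= p < N.+1 | prime p) 1) * ln N%:R <= 10 * N%:R :> R.
Proof.
move=> N0; set L : R := ln N%:R.
have NR : 0 < N%:R :> R by rewrite ltr0n.
have L0 : 0 <= L by rewrite ln_ge0 // ler1n.
rewrite (bigID (fun p => p ^ 2 <= N)%N) /= mulrDl.
have -> : 10 * N%:R = 2 * N%:R + 2 * (4 * N%:R) :> R by lra.
apply: lerD.
  set s : R := Num.sqrt N%:R.
  have s0 : 0 < s by rewrite sqrtr_gt0.
  have ss : s ^+ 2 = N%:R by rewrite sqr_sqrtr // ltW.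
  have Ls : L <= 2 * s.
    rewrite /L -ss lnXn // -[leLHS]mulr_natl ler_wpM2l //; apply: ltW; exact: ln_sublinear.
  have c : \sum_(1 <= p < N.+1 | prime p && (p ^ 2 <= N)%N) 1 <= s.
    apply: (@le_trans _ _ (\sum_(1 <= p < N.+1 | (p <= Num.truncn s)%N) 1)).
      rewrite big_mkcond [leRHS]big_mkcond; apply: ler_sum => p _.
      case: ifP => [/andP[_ pN]|_]; last by case: ifP.
      rewrite truncn_ge_nat ?(ltW s0) //; suff -> : p%:R <= s by [].
      by rewrite -(ler_pXn2r (isT : 0 < 2)%N) ?nnegrE ?(ltW s0) // ss -natrX ler_nat pN.
    apply: le_trans (count_le R _ _) _; rewrite truncn_le // ltW //.
  apply: le_trans (ler_pM _ L0 c Ls) _; first by apply: sumr_ge0.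
  by rewrite -ss; lra.
apply: (@le_trans _ _ (\sum_(1 <= p < N.+1 | prime p) 2 * ln p%:R)); last first.
  by rewrite -mulr_sumr ler_wpM2l // sum_ln_primes.
rewrite mulr_suml big_mkcond [leRHS]big_mkcond; apply: ler_sum => p _.
case: (boolP (prime p)) => //= pp; have p1 : 0 <= ln p%:R :> R by rewrite ln_ge0 // ler1n prime_gt0.
case: ifP => pN; last by rewrite mulr_ge0.
rewrite mul1r /L mulr_natl -lnXn ?ltr0n ?prime_gt0 //; apply: ln_mono => //.
by rewrite -natrX ler_nat ltnW // ltnNge.
Qed.

End Chebyshev.

(** * The corollary *)

Section Final.
Variable R : realType.

(* [L] is the logarithm: if [L <= b] the saving absorbs it, otherwise Chebyshev's
   bound already saves [b]. *)
Lemma power_saving_dichotomy (S X L s Q b : R) : 0 <= S -> 0 <= X -> 0 < Q -> 1 <= b ->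
  1 <= L -> s <= Q * b ^- 6 -> S <= 51 * (L ^+ 3 * X * s) -> S * L <= 40 * X ->
  S <= (51 * Q + 40) * (X * b^-1).
Proof.
move=> S0 X0 Q0 b1 L1 sb SL3 SL; have b0 : 0 < b by lra.
have i0 : 0 <= X * b^-1 by rewrite mulr_ge0 // invr_ge0 ltW.
case: (leP L b) => Lb; rewrite mulrDl.
  apply: (@le_trans _ _ (51 * Q * (X * b^-1))); last by rewrite lerDl; nra.
  apply: le_trans SL3 _; rewrite -[leRHS]mulrA ler_pM2l //.
  apply: (@le_trans _ _ (b ^+ 3 * X * (Q * b ^- 6))).
    apply: le_trans (ler_wpM2l _ sb) _.
      by rewrite mulr_ge0 // exprn_ge0 // (le_trans _ L1).
    rewrite ler_wpM2r //; first by rewrite mulr_ge0 ?(ltW Q0) // invr_ge0 exprn_ge0 // ltW.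
    by rewrite ler_wpM2r // lerXn2r // nnegrE ?(ltW b0) // (le_trans _ L1).
  have -> : b ^+ 3 * X * (Q * b ^- 6) = Q * (X * b ^- 3) by field; rewrite gt_eqF.
  rewrite ler_pM2l // ler_wpM2l // lef_pV2 ?posrE ?exprn_gt0 //.
  exact: ler_eXnr.
apply: (@le_trans _ _ (40 * (X * b^-1))); last by rewrite lerDr; nra.
rewrite mulrA ler_pdivlMr //; apply: le_trans SL; rewrite ler_wpM2l //; exact: ltW.
Qed.

Lemma powRE (z y : R) : 0 < z -> z `^ y = expR (y * ln z).
Proof. by move=> z0; rewrite /powR gt_eqF. Qed.

(** With Y = log_q X, the first term is X q^(- delta Y^3 / gamma^2) and the second is X q^(- delta
    gamma^3 / gamma^2). The one with the smaller of Y and gamma is kept, so a single exponent [Z] is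
    left to compare with. *)
Lemma rhs_lower (q gamma : nat) (delta X Z : R) :
  (1 < q)%N -> (0 < gamma)%N -> 0 < delta -> 1 <= X ->
  Num.min (ln X / ln q%:R) gamma%:R ^+ 3 <= Z * gamma%:R ^+ 2 ->
  X * q%:R `^ (- (delta * Z)) <=
  X `^ (1 - delta * (ln X / ln (q ^ gamma)%:R) ^+ 2)
    + X * q%:R `^ (- (delta * gamma%:R)).
Proof.
move=> q1 g0 d0 X1 H.
have X0 : 0 < X by apply: lt_le_trans X1.
have qR : 0 < q%:R :> R by rewrite ltr0n ltnW.
have lq : 0 < ln q%:R :> R by rewrite ln_gt0 // ltr1n.
have gR : 0 < gamma%:R :> R by rewrite ltr0n.
have L0 : 0 <= ln X by exact: ln_ge0.
have lqg : ln (q ^ gamma)%:R = gamma%:R * ln q%:R :> R.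
  by rewrite natrX lnXn // mulr_natl.
set Y := ln X / ln q%:R in H; have LY : ln X = Y * ln q%:R by rewrite /Y divfK // gt_eqF.
have Y0 : 0 <= Y by rewrite divr_ge0 // ltW.
case: (leP Y gamma%:R) => Yg.
  rewrite (min_idPl Yg) in H.
  apply: (@le_trans _ _ (X `^ (1 - delta * (ln X / ln (q ^ gamma)%:R) ^+ 2))); last first.
    by rewrite lerDl mulr_ge0 ?powR_ge0 // ltW.
  rewrite !powRE // -{1}(lnK (_ : X \is Num.pos)) ?posrE // -expRD ler_expR lqg.
  rewrite mulrBl mul1r lerD2l mulNr lerN2 LY.
  have -> : Y * ln q%:R / (gamma%:R * ln q%:R) = Y / gamma%:R.
    by field; rewrite !gt_eqF.
  rewrite mulrA ler_pM2r // -mulrA ler_pM2l //.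
  rewrite expr_div_n mulrAC ler_pdivrMr ?exprn_gt0 //.
  by rewrite -exprSr.
apply: (@le_trans _ _ (X * q%:R `^ (- (delta * gamma%:R)))); last by rewrite lerDr powR_ge0.
rewrite ler_pM2l //; apply: ler_powR; first by rewrite ler1n ltnW.
rewrite lerN2 ler_pM2l //; rewrite (min_idPr (ltW Yg)) in H.
by rewrite -(ler_pM2r (_ : 0 < gamma%:R ^+ 2)) ?exprn_gt0 // -exprS.
Qed.

Variables (q gamma : nat) (a : int) (X : R).
Hypotheses (pq : prime q) (q3 : (3 <= q)%N) (g0 : (0 < gamma)%N) (X2 : 2 <= X).
Hypothesis (aq : coprimez a q%:Z).
Let M := (q ^ gamma)%N.
Let N := Num.truncn X.
Let X0 : 0 <= X. Proof. by apply: le_trans X2. Qed.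
Let X1 : 1 <= X. Proof. by apply: le_trans X2; rewrite ler1n. Qed.
Let q0 : (0 < q)%N. Proof. exact: prime_gt0. Qed.
Let NX : N%:R <= X. Proof. by rewrite truncn_le. Qed.
Let N2 : (2 <= N)%N. Proof. by rewrite truncn_ge_nat. Qed.
Let XN : X < N.+1%:R. Proof. exact: truncnS_gt. Qed.

Let S := mersenne_sum (q ^ gamma) a X.
Let count : R := \sum_(1 <= p < N.+1 | prime p) 1.

(** The 1 subtracted in a Mersenne number only contributes a constant factor of modulus one. *)
Lemma mersenne_sumE :
  S = psi R M (- a) * \sum_(1 <= p < N.+1 | prime p) psi R M (a * (2 ^ p)%N%:Z).
Proof.
rewrite /S /mersenne_sum -/N big_ltn_cond //= mulr_sumr; apply: eq_bigr => p _.
rewrite -psiD /psi; congr em; rewrite /mersenne rmorphD rmorphM rmorphN /=.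
rewrite natrB ?expn_gt0 // mulrBr mulr1 addrC; congr (_ + _ * _).
Qed.

Lemma mersenne_le_count : cabs S <= count.
Proof.
rewrite mersenne_sumE cabsM cabs_psi mul1r; apply: le_trans (cabs_sum _ _ _) _.
by apply: ler_sum => p _; rewrite cabs_psi.
Qed.

Lemma count_le_X : count <= X.
Proof.
apply: le_trans NX; apply: le_trans (count_le R N N).
rewrite /count big_nat_cond [leRHS]big_nat_cond big_mkcond [leRHS]big_mkcond.
apply: ler_sum => p _; case: (boolP (1 <= p < N.+1)%N) => //= /andP[_ pN].
by rewrite -ltnS pN; case: ifP.
Qed.

Lemma mersenne_le_fexp :
  cabs S <= cabs (\sum_(1 <= p < N.+1 | prime p) fexp R q M a p) + 1.
Proof.
rewrite mersenne_sumE cabsM cabs_psi mul1r.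
have -> : \sum_(1 <= p < N.+1 | prime p) psi R M (a * (2 ^ p)%N%:Z) =
  \sum_(1 <= p < N.+1 | prime p) fexp R q M a p +
  \sum_(1 <= p < N.+1 | prime p) (if (q %| p)%N then psi R M (a * (2 ^ p)%N%:Z) else 0).
  rewrite -big_split /=; apply: eq_bigr => p _; rewrite /fexp.
  by case: ifP; rewrite ?add0r ?addr0.
apply: le_trans (cabsD _ _) _; rewrite lerD2l; apply: le_trans (cabs_sum _ _ _) _.
apply: (@le_trans _ _ (\sum_(1 <= p < N.+1 | p == q) 1)).
  rewrite big_mkcond [leRHS]big_mkcond; apply: ler_sum => p _.
  case: (boolP (prime p)) => pp; last by case: ifP.
  by rewrite (dvdn_prime2 pq pp) eq_sym; case: ifP; rewrite ?cabs_psi ?cabs0.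
rewrite (eq_bigr (fun=> 1%:R)) // -natr_sum -[leRHS]/(1%:R) ler_nat sum1_count.
by rewrite -/(count_mem q _) count_uniq_mem ?iota_uniq // leq_b1.
Qed.

(** As X < N + 1 <= 2N and N >= 2, 1 + log X <= 4 log N, whence 40 = 4 * 10. *)
Lemma chebyshev_lg : cabs S * (1 + ln X) <= 40 * X.
Proof.
have N0 : (0 < N)%N by apply: leq_trans N2.
have NR : 0 < N%:R :> R by rewrite ltr0n.
have l2 : 2^-1 <= ln 2 :> R.
  have := @le_ln1Dx R (- 2^-1) _; have -> : 1 + - 2^-1 = 2^-1 :> R by lra.
  rewrite lnV ?posrE // => H; have := H _; lra.
have lN : ln 2 <= ln N%:R :> R by apply: ln_mono => //; rewrite (ler_nat R 2).
have lX : ln X <= ln 2 + ln N%:R.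
  rewrite -lnM ?posrE //; apply: ln_mono; first exact: lt_le_trans X2.
  apply: ltW; apply: lt_le_trans XN _; rewrite -natrM ler_nat; lia.
have lg : 1 + ln X <= 4 * ln N%:R by lra.
apply: (@le_trans _ _ (count * (4 * ln N%:R))).
  apply: ler_pM; rewrite ?cabs_ge0 ?mersenne_le_count //.
  by rewrite addr_ge0 // ln_ge0.
have := prime_count_le R N0; rewrite -/count => H.
have := NX; nra.
Qed.

Let T := trunc_log q N.
(** The divisor 100 ensures both q^(26 r) <= X and gamma / r >= 100, the latter giving k >= 100. *)
Let r := (minn T gamma %/ 100)%N.
(** The saving exponent up to an absolute constant, since r / k^2 is of this order for k near gamma
    / r. *)
Let Th : R := r%:R ^+ 3 / gamma%:R ^+ 2.
Let q1 : (1 < q)%N. Proof. exact: prime_gt1. Qed.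
Let gR : 0 < gamma%:R :> R. Proof. by rewrite ltr0n. Qed.

Lemma min_exponent_le : Num.min (ln X / ln q%:R) gamma%:R <= 100 * r.+1%:R.
Proof.
have lq : 0 < ln q%:R :> R by rewrite ln_gt0 // ltr1n.
have H : Num.min (ln X / ln q%:R) gamma%:R <= (minn T gamma).+1%:R.
  case: (leqP T gamma) => _; rewrite ge_min; apply/orP; [left|right]; last first.
    by rewrite ler_nat.
  rewrite ler_pdivrMr // mulr_natl -lnXn ?ltr0n //; apply: ln_mono.
    by apply: lt_le_trans X2.
  apply: ltW; apply: lt_le_trans XN _; rewrite -natrX ler_nat.
  exact: trunc_log_ltn.
apply: le_trans H _; rewrite -(natrM R 100) ler_nat.
have := ltn_ceil (minn T gamma) (isT : (0 < 100)%N); rewrite -/r; lia.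
Qed.

Lemma level_le : (100 * r <= gamma)%N.
Proof. by rewrite mulnC; apply: leq_trans (leq_trunc_div _ _) (geq_minr _ _). Qed.

Lemma qr_le_X : (q ^ (26 * r))%:R <= X.
Proof.
apply: le_trans NX; rewrite ler_nat.
apply: leq_trans (trunc_logP q1 (leq_trans _ N2)) => //.
rewrite leq_exp2l //; apply: leq_trans (geq_minl T gamma).
by apply: leq_trans (leq_trunc_div _ 100); rewrite mulnC leq_mul2l orbT.
Qed.

Let Z : R := (100 * r.+1%:R) ^+ 3 / gamma%:R ^+ 2.

(** Uses (r + 1)^3 <= 8 (r^3 + 1) and gamma >= 1; rounding to the integer [r] thus costs a constant
    factor and an additive constant. *)
Lemma Z_le : Z <= 8 * 100 ^+ 3 * (Th + 1).
Proof.
have g2 : 1 <= gamma%:R ^+ 2 :> R by rewrite exprn_ege1 // ler1n.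
have g20 : 0 < gamma%:R ^+ 2 :> R by apply: lt_le_trans g2.
rewrite /Z ler_pdivrMr // exprMn.
have -> : 8 * 100 ^+ 3 * (Th + 1) * gamma%:R ^+ 2 =
    100 ^+ 3 * (8 * ((Th + 1) * gamma%:R ^+ 2)) by move: (100 ^+ 3) => C; ring.
rewrite ler_pM2l ?exprn_gt0 //.
have -> : (Th + 1) * gamma%:R ^+ 2 = r%:R ^+ 3 + gamma%:R ^+ 2.
  by rewrite mulrDl mul1r /Th divfK // gt_eqF.
have H : ((r.+1) ^ 3 <= 8 * (r ^ 3 + 1))%N by rewrite !expnS; nia.
have H2 : r.+1%:R ^+ 3 <= 8 * (r%:R ^+ 3 + 1) :> R.
  by rewrite -!natrX -(natrD _ _ 1) -(natrM _ 8) ler_nat.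
apply: le_trans H2 _; rewrite ler_pM2l //; lra.
Qed.

(** [k] is the ceiling of gamma / r. From r k <= 2 gamma follows 4 k^2 <= 16 gamma^2 / r^2, and this
    is below r exactly because [Th] exceeds 16. *)
Lemma level_count (k := (gamma.-1 %/ r).+1) : (0 < r)%N -> 16 < Th ->
  [/\ (100 <= k)%N, (4 * k ^ 2 <= r)%N, (r * (k - 1) < gamma)%N, (gamma <= r * k)%N
    & (r * k <= 2 * gamma)%N].
Proof.
move=> r0 Th16; have := level_le => lv.
have h1 : (gamma.-1 %/ r * r <= gamma.-1)%N := leq_trunc_div _ _.
have h2 : (gamma.-1 < k * r)%N := ltn_ceil _ r0.
have h3 : (16 * gamma ^ 2 < r ^ 3)%N.
  by rewrite -(ltr_nat R) natrM !natrX -ltr_pdivlMr ?exprn_gt0.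
have k99 : (99 <= gamma.-1 %/ r)%N by rewrite leq_divRL //; lia.
have h4 : (r * k <= 2 * gamma)%N by rewrite /k mulnC mulSn; lia.
split => //; last by rewrite mulnC; lia.
  rewrite -(leq_pmul2r (_ : 0 < r ^ 2)%N) ?expn_gt0 ?r0 //.
  rewrite -expnS (leq_trans _ (ltnW h3)) // -mulnA -expnMn mulnC [(k * r)%N]mulnC.
  rewrite mulnC; apply: (@leq_trans (4 * (2 * gamma) ^ 2)); first by rewrite leq_mul2l leq_sqr h4.
  by rewrite expnMn mulnA.
by rewrite /k subn1 /= mulnC; lia.
Qed.

Lemma saving_exponent k : (0 < r)%N -> (0 < k)%N -> (r * k <= 2 * gamma)%N ->
  saving R q r k <= q%:R * q%:R `^ (- (Th / (8 * 6 ^+ 6))).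
Proof.
move=> r0 k0 rk; have qR : 0 < q%:R :> R by rewrite ltr0n.
rewrite /saving powRqD // powRr1 ?(ltW qR) // ler_pM2l //.
apply: ler_powR; first by rewrite ler1n.
rewrite lerN2; have kR : 0 < k%:R :> R by rewrite ltr0n.
have D0 : 0 < 6 ^+ 6 :> R by rewrite exprn_gt0.
have rkR : (r%:R * k%:R) ^+ 2 <= (2 * gamma%:R) ^+ 2 :> R.
  by rewrite -!(natrM R) -natrX -[leRHS]natrX ler_nat leq_sqr.
rewrite /Th; set D := _ ^+ 6 in D0 *.
have -> : r%:R ^+ 3 / gamma%:R ^+ 2 / (8 * D) = r%:R ^+ 3 / (gamma%:R ^+ 2 * (8 * D)).
  by field; rewrite !gt_eqF.
have -> : r%:R / (D * k%:R ^+ 2) / 2 = r%:R / (2 * D * k%:R ^+ 2) by field; rewrite !gt_eqF.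
rewrite ler_pdivrMr ?mulr_gt0 ?exprn_gt0 // mulrAC ler_pdivlMr ?mulr_gt0 ?exprn_gt0 //.
have -> : r%:R ^+ 3 * (2 * D * k%:R ^+ 2) = 2 * D * r%:R * (r%:R * k%:R) ^+ 2 :> R by ring.
have -> : r%:R * (gamma%:R ^+ 2 * (8 * D)) = 2 * D * r%:R * (2 * gamma%:R) ^+ 2 :> R by ring.
by rewrite ler_wpM2l // !mulr_ge0 // ltW.
Qed.

(** Lets the main bound absorb the 1 lost by dropping p = q, so that 50 becomes 51. *)
Lemma X_saving_ge1 k : (0 < k)%N -> 1 <= X * saving R q r k.
Proof.
move=> k0; have qR : 0 < q%:R :> R by rewrite ltr0n.
have kR : 1 <= k%:R ^+ 2 :> R by rewrite exprn_ege1 // ler1n.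
have D0 : 1 <= 6 ^+ 6 :> R by rewrite exprn_ege1 // ler1n.
have h : q%:R `^ (- r%:R) <= saving R q r k.
  rewrite /saving; apply: ler_powR; first by rewrite ler1n.
  suff : r%:R / (6 ^+ 6 * k%:R ^+ 2) <= r%:R :> R.
    have : 0 <= r%:R :> R by []. lra.
  rewrite ler_pdivrMr; last by rewrite mulr_gt0 // (lt_le_trans _ D0, lt_le_trans _ kR).
  by rewrite ler_peMr // -[leLHS]mulr1 ler_pM.
apply: le_trans (ler_wpM2l X0 h).
rewrite powRN powR_mulrn ?(ltW qR) // ler_pdivlMr ?exprn_gt0 // mul1r -natrX.
apply: le_trans qr_le_X; rewrite ler_nat leq_exp2l //; lia.
Qed.

Lemma mersenne_large : (16 + ord_val q)%:R < Th ->
  cabs S <= (51 * q%:R + 40) * (X * q%:R `^ (- (Th / (8 * 6 ^+ 7)))).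
Proof.
move=> ThT; have Th16 : 16 < Th.
  by apply: le_lt_trans ThT; rewrite (ler_nat R 16) leq_addr.
have qR : 0 < q%:R :> R by rewrite ltr0n.
have r0 : (0 < r)%N.
  rewrite lt0n; apply/eqP => r0; move: Th16; rewrite /Th r0 expr0n /= mul0r; lra.
have Thr : Th <= r%:R.
  rewrite /Th ler_pdivrMr ?exprn_gt0 // exprS ler_pM2l ?ltr0n //.
  rewrite lerXn2r ?nnegrE // ler_nat; apply: leq_trans level_le; lia.
(* As r <= gamma, [Th] is at most r, so the lower bound on [Th] also takes care of the valuation. *)
have er : (ord_val q < r)%N.
  by rewrite -(ltr_nat R); apply: lt_le_trans Thr; apply: le_lt_trans ThT; rewrite ler_nat leq_addl.
have [k100 kr gk kg rk] := level_count r0 Th16; set k := ((_ %/ r).+1)%N in k100 kr gk kg rk.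
have k0 : (0 < k)%N by [].
have L1 : 1 <= 1 + ln X by rewrite lerDl ln_ge0.
have := mersenne_le_fexp; have := prime_sum pq q3 aq er k100 kr gk kg X1 qr_le_X NX.
rewrite -/M => h1 h2.
(* The sixth root of the saving in [saving_exponent]: the dichotomy spends b^3 on the logarithms and
   needs a saving b^6 to keep b. *)
pose b : R := q%:R `^ (Th / (8 * 6 ^+ 7)).
have b1 : 1 <= b.
  rewrite /b -[leLHS](powRr0 q%:R); apply: ler_powR; first by rewrite ler1n.
  by rewrite divr_ge0 ?mulr_ge0 // ?exprn_ge0 //; lra.
rewrite powRN -/b; apply: (@power_saving_dichotomy _ _ (1 + ln X) (saving R q r k)) => //.
- exact: cabs_ge0.
- apply: le_trans (saving_exponent r0 k0 rk) _; rewrite ler_pM2l //.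
  rewrite /b -powR_mulrn ?powR_ge0 // -powRrM -powRN le_eqVlt; apply/orP; left; apply/eqP.
  by congr (_ `^ (- _)); rewrite [6 ^+ 7]exprS; field.
- have h3 := X_saving_ge1 k0; have : 1 <= (1 + ln X) ^+ 3 by rewrite exprn_ege1.
  rewrite -mulrA in h1 *; set P := X * _ in h1 h3 *; nra.
- exact: chebyshev_lg.
Qed.

End Final.

Theorem corollary1p2 (R : realType) :
  forall A : R, 0 < A ->
  exists2 delta0 : R, 0 < delta0 &
  forall q : nat, prime q -> (3 <= q)%N ->
  exists c : R,
  forall (gamma : nat) (X : R),
    (0 < gamma)%N -> 2 <= X -> X <= q%:R `^ (A * gamma%:R) ->
  let rho := ln X / ln ((q ^ gamma)%:R : R) in
  forall a : int, coprimez a q%:Z ->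
    `| mersenne_sum (q ^ gamma) a X | <=
      (c * (X `^ (1 - delta0 * rho ^+ 2)
            + X * q%:R `^ (- (delta0 * gamma%:R))))%:C.
Proof.
(* Chosen so that [Z_le] gives d Z <= (Th + 1) / (16 * 6^7), which is at most the exponent Th / (8 *
   6^7) of [mersenne_large] once Th >= 1. *)
move=> A _; pose d : R := (6 ^+ 7 * 128 * 100 ^+ 3)^-1.
have d0 : 0 < d by rewrite invr_gt0 !mulr_gt0 // exprn_gt0.
exists d => // q pq q3.
have q1 := prime_gt1 pq; have qR : 0 < q%:R :> R by rewrite ltr0n prime_gt0.
have q1R : 1 <= q%:R :> R by rewrite ler1n prime_gt0.
pose T0 : R := (16 + ord_val q)%:R; have T00 : 0 <= T0 by rewrite /T0.
(* The first summand serves the range Th <= T0, where the claimed saving is at most q^(T0 + 1) and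
   counting primes by X suffices; the second is the constant of [mersenne_large]. *)
exists (q%:R `^ (T0 + 1) + (51 * q%:R + 40)) => gamma X g0 X2 _ rho a aq.
have X1 : 1 <= X by lra.
have gR : 0 < gamma%:R ^+ 2 :> R by rewrite exprn_gt0 // ltr0n.
apply/cabs_le.
pose r := (minn (trunc_log q (Num.truncn X)) gamma %/ 100)%N.
pose Th : R := r%:R ^+ 3 / gamma%:R ^+ 2.
pose Z : R := (100 * r.+1%:R) ^+ 3 / gamma%:R ^+ 2.
have m0 : 0 <= Num.min (ln X / ln q%:R) gamma%:R.
  by rewrite le_min ler0n andbT divr_ge0 ?ln_ge0.
have low : X * q%:R `^ (- (d * Z)) <=
    X `^ (1 - d * rho ^+ 2) + X * q%:R `^ (- (d * gamma%:R)).
  apply: rhs_lower => //; rewrite /Z divfK ?gt_eqF // lerXn2r ?nnegrE //.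
  exact: (min_exponent_le pq q3 g0 X2 aq).
have Zle : Z <= 8 * 100 ^+ 3 * (Th + 1) by exact: (Z_le pq q3 g0 X2 aq).
have Th0 : 0 <= Th by rewrite divr_ge0 ?exprn_ge0 // ltW.
have dZ : d * Z <= (Th + 1) / (16 * 6 ^+ 7).
  apply: le_trans (ler_wpM2l (ltW d0) Zle) _; rewrite le_eqVlt; apply/orP; left; apply/eqP.
  rewrite /d; have : 100 ^+ 3 != 0 :> R by rewrite expf_neq0.
  have : 6 ^+ 7 != 0 :> R by rewrite expf_neq0.
  by set C := 100 ^+ 3; set D := 6 ^+ 7 => ? ?; field; apply/andP.
have D1 : 1 <= 6 ^+ 7 :> R by rewrite exprn_ege1 // ler1n.
have qT0 : 0 <= q%:R `^ (T0 + 1) :> R by exact: powR_ge0.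
have XZ0 : 0 <= X * q%:R `^ (- (d * Z)) by rewrite mulr_ge0 ?powR_ge0 //; lra.
apply: (@le_trans _ _ ((q%:R `^ (T0 + 1) + (51 * q%:R + 40)) * (X * q%:R `^ (- (d * Z))))); last first.
  by rewrite ler_wpM2l //; lra.
rewrite mulrDl; case: (leP Th T0) => ThT.
  apply: (@le_trans _ _ (q%:R `^ (T0 + 1) * (X * q%:R `^ (- (d * Z))))); last first.
    by rewrite lerDl mulr_ge0 //; lra.
  apply: le_trans (mersenne_le_count _ _ _ _) _; apply: le_trans (count_le_X X2) _.
  rewrite mulrCA -powRqD //.
  rewrite ler_peMr //; first by lra.
  rewrite -[leLHS](powRr0 q%:R); apply: ler_powR => //.
  suff : (Th + 1) / (16 * 6 ^+ 7) <= Th + 1 by lra.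
  rewrite ler_pdivrMr; [nra | lra].
apply: le_trans (mersenne_large pq q3 g0 X2 aq ThT) _.
rewrite -[leLHS]add0r lerD ?mulr_ge0 //; first by lra.
rewrite ler_wpM2l //.
rewrite ler_wpM2l //; first by lra.
apply: ler_powR => //; rewrite lerN2; apply: le_trans dZ _.
have T16 : 1 <= T0 by rewrite /T0 (ler_nat R 1) addn_gt0.
rewrite -/r -/Th; have Th1 : 1 <= Th by lra.
rewrite ler_pdivrMr; last by lra.
have -> : Th / (8 * 6 ^+ 7) * (16 * 6 ^+ 7) = 2 * Th.
  by set D := 6 ^+ 7 in D1 *; field; lra.
lra.
Qed.
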